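(* Let $\mathcal{Z}$ be the class of all matroids $M$ such that, for every element $e\in E(M)$, at least one of $M\backslash e$ and $M/e$ is binary. Then the set of excluded minors for $\mathcal{Z}$ (the minor-minimal matroids not in $\mathcal{Z}$, up to isomorphism) is $$\{Q_6,\ P_6,\ U_{3,6},\ R_6,\ U_{2,4}\oplus U_{1,1},\ U_{2,4}\oplus U_{0,1}\}\cup\mathcal{D}.$$
   Context: Relaxation: if $H$ is a circuit and a hyperplane (a circuit-hyperplane) of a matroid $M$, the matroid on $E(M)$ whose bases are the bases of $M$ together with $H$ is said to be obtained from $M$ by relaxing $H$. $\mathcal{D}$ denotes the collection of all matroids obtained from a connected binary matroid $M$ having two disjoint circuit-hyperplanes $X,Y$ with $X\cup Y=E(M)$ by relaxing both $X$ and $Y$ (i.e. the matroid on $E(M)$ whose bases are the bases of $M$ together with $X$ and $Y$). $U_{m,n}$ is the uniform matroid of rank $m$ on $n$ elements. $P_6$ is the six-element rank-3 matroid whose only non-spanning circuit is a single 3-element circuit (triangle). $Q_6$ is the six-element rank-3 matroid whose non-spanning circuits are exactly two triangles that share one element. $R_6$ is the six-element rank-3 matroid whose non-spanning circuits are exactly two disjoint triangles; equivalently $R_6\cong U_{2,4}\oplus_2 U_{2,4}$ (2-sum). *)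

(* Defs.v *)
From HB Require Import structures.
From mathcomp Require Import all_boot all_order all_algebra.
Set Implicit Arguments.
Unset Strict Implicit.
Unset Printing Implicit Defensive.
Import GRing.Theory.

Record mat (T : finType) := Mat { ground : {set T}; indep : {set {set T}} }.

Definition is_matroid (T : finType) (M : mat T) : Prop :=
  [/\ set0 \in indep M,
      (forall X : {set T}, X \in indep M -> X \subset ground M),
      (forall X Y : {set T}, Y \subset X -> X \in indep M -> Y \in indep M) &
      (forall X Y : {set T}, X \in indep M -> Y \in indep M -> #|X| < #|Y| ->
          exists2 y, y \in Y :\: X & y |: X \in indep M)].

Definition rk (T : finType) (M : mat T) (X : {set T}) : nat :=
  \max_(Y in indep M | Y \subset X) #|Y|.

Definition minor (T : finType) (M : mat T) (C D : {set T}) : mat T :=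
  Mat (ground M :\: (C :|: D))
      [set Y : {set T} | (Y \subset ground M :\: (C :|: D))
                         && (rk M (Y :|: C) == #|Y| + rk M C)].

Definition del (T : finType) (M : mat T) (e : T) : mat T := minor M set0 [set e].
Definition con (T : finType) (M : mat T) (e : T) : mat T := minor M [set e] set0.

Definition binary (T : finType) (M : mat T) : Prop :=
  exists (n : nat) (v : T -> 'rV['F_2]_n),
    forall X : {set T}, X \subset ground M ->
      (X \in indep M) = free [seq v x | x <- enum X].

Definition classZ (T : finType) (M : mat T) : Prop :=
  forall e, e \in ground M -> binary (del M e) \/ binary (con M e).

Definition excluded_minor_Z (T : finType) (M : mat T) : Prop :=
  [/\ is_matroid M, ~ classZ M &
      forall C D : {set T}, [disjoint C & D] -> C :|: D \subset ground M ->
        C :|: D != set0 -> classZ (minor M C D)].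

Definition iso (T1 T2 : finType) (M1 : mat T1) (M2 : mat T2) : Prop :=
  exists f : T1 -> T2,
    [/\ {in ground M1 &, injective f}, f @: ground M1 = ground M2 &
        forall X : {set T1}, X \subset ground M1 -> (X \in indep M1) = (f @: X \in indep M2)].

Definition U (m n : nat) : mat 'I_n := Mat [set: 'I_n] [set X : {set 'I_n} | #|X| <= m].

Definition dsum (T1 T2 : finType) (M1 : mat T1) (M2 : mat T2) : mat (T1 + T2)%type :=
  Mat (inl @: ground M1 :|: inr @: ground M2)
      [set X : {set (T1 + T2)%type} | (X \subset inl @: ground M1 :|: inr @: ground M2)
               && (inl @^-1: X \in indep M1) && (inr @^-1: X \in indep M2)].

(* rank-3 matroids on six elements given by their non-spanning circuits:
   independent sets are the sets of size <= 3 not equal to a listed triangle *)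
Definition rank3_6 (tri : seq {set 'I_6}) : mat 'I_6 :=
  Mat [set: 'I_6] [set X : {set 'I_6} | (#|X| <= 3) && (X \notin tri)].

Definition i6 (k : nat) : 'I_6 := inord k.

Definition P6 : mat 'I_6 := rank3_6 [:: [set i6 0; i6 1; i6 2]].
Definition Q6 : mat 'I_6 := rank3_6 [:: [set i6 0; i6 1; i6 2]; [set i6 2; i6 3; i6 4]].
Definition R6 : mat 'I_6 := rank3_6 [:: [set i6 0; i6 1; i6 2]; [set i6 3; i6 4; i6 5]].

Definition circuit (T : finType) (M : mat T) (C : {set T}) : bool :=
  [&& C \subset ground M, C \notin indep M & [forall x in C, C :\ x \in indep M]].

Definition hyperplane (T : finType) (M : mat T) (H : {set T}) : bool :=
  [&& H \subset ground M, rk M H + 1 == rk M (ground M) &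
      [forall e in ground M :\: H, rk M (e |: H) == rk M (ground M)]].

Definition circuit_hyperplane (T : finType) (M : mat T) (H : {set T}) : bool :=
  circuit M H && hyperplane M H.

Definition connected (T : finType) (M : mat T) : Prop :=
  forall x y, x \in ground M -> y \in ground M -> x != y ->
    exists C : {set T}, circuit M C /\ x \in C /\ y \in C.

Definition bases (T : finType) (M : mat T) : {set {set T}} :=
  [set B in indep M | #|B| == rk M (ground M)].

Definition relax2 (T : finType) (M : mat T) (X Y : {set T}) : mat T :=
  Mat (ground M) [set Z : {set T} | [exists B in bases M :|: [set X; Y], Z \subset B]].

Definition inD (T : finType) (N : mat T) : Prop :=
  exists (M : mat T) (X Y : {set T}),
    [/\ is_matroid M /\ connected M, binary M,
        circuit_hyperplane M X /\ circuit_hyperplane M Y,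
        [disjoint X & Y] /\ X :|: Y = ground M &
        N = relax2 M X Y].

(* Main.v *)
(** By Tutte, a matroid is binary iff it has no U_{2,4}-minor; such a minor M/C\D of M with C
   independent and D coindependent is recorded as a witness: C and D are disjoint, four elements
   are left, and C together with any two of them is a basis. M is outside Z iff some e lies in
   D1 for one witness (C1, D1) and in C2 for another one, up to loops and coloops.

   In an excluded minor, two witnesses with C1 meeting D2 satisfy C1 & C2 = D1 & D2 = 0: otherwise
   a common element could be contracted or deleted without entering Z. Applied to the sets
   C + P with at most eight moving elements this is a finite condition; a search shows that, on at
   least seven elements, every witness (C, D) extends to a free basis X, one for which every
   exchange X - x + y is a basis, with C inside X and D outside. The free bases are then exactly
   two complementary sets, and removing both from the bases leaves a matroid without witnesses.
   On six elements the search leaves at most two triangles, meeting in at most one element, and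
   loops or coloops give the two direct sums.

   Conversely, in a member of D every witness lies around X or around Y, since M is binary; hence
   the minors by two elements that matter are binary. *)

Require Import Defs.
From mathcomp Require Import all_boot all_order all_algebra.
From mathcomp Require Import zify.
Set Implicit Arguments.
Unset Strict Implicit.
Unset Printing Implicit Defensive.
Import GRing.Theory.

(** A free basis C + P needs one pair P that serves every c in C and every d in D, while the search
    sees only a few elements at a time. The pair is therefore fixed at a reference pair (c0, d0),
    chosen so that d0 is parallel to some b of Q in M/C but not in M/(C - c0); these two facts are
    handed to the search and force the other pairs (c, d) to accept the same P. Replacing d0,
    replacing c0 and replacing both involve 7, 7 and 8 elements, whence the bound. Finding c0
    requires that M has no parallel pairs, which follows from the condition on pairs of witnesses.
    Seven elements matter because a window of six then leaves out an element of C or D: two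
    witnesses extending the window share that element, so nothing in the window is contracted by one
    and deleted by the other. Tutte's theorem is proved by comparison with a matrix over F_2: in the
    absence of witnesses, one base and its neighbours determine all bases. *)

Lemma subz (T : finType) (A B : {set T}) : A \subset B -> forall z, (z \in A) ==> (z \in B).
Proof. by move=> /subsetP AB z; apply/implyP/AB. Qed.
Lemma disjz (T : finType) (A B : {set T}) : [disjoint A & B] -> forall z, ~~ ((z \in A) && (z \in B)).
Proof. by move=> /pred0P AB z; move: (AB z) => /= ->. Qed.
Ltac pt_sets z :=
  repeat match goal with
  | H : is_true (subset _ _) |- _ => move/subz/(_ z): H
  | H : is_true (disjoint _ _) |- _ => move/disjz/(_ z): H
  | H : _ = _ |- _ => move/setP/(_ z): H
  end; rewrite ?inE.
Ltac pt_atoms :=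
  repeat match goal with
  | H : is_true (?x \in _) |- _ => move: H
  | H : is_true (~~ (?x \in _)) |- _ => move: H
  | H : is_true (~~ (?x == _)) |- _ => move: H
  | H : is_true (?x == _) |- _ => move: H
  end; rewrite ?inE ?eqxx.
Ltac pt_eqs :=
  repeat match goal with
  | H : is_true (negb (@eq_op _ ?x ?y)) |- context [@eq_op ?T ?x ?y] => rewrite (negPf H) /=
  | H : is_true (negb (@eq_op _ ?x ?y)) |- context [@eq_op ?T ?y ?x] =>
      rewrite (eq_sym y x) (negPf H) /=
  | |- context [@eq_op ?T ?x ?y] =>
      let e := fresh in case: (eqVneq x y) => e;
      [first [subst x | subst y | rewrite e] |]; rewrite ?inE ?eqxx //=
  end.
Ltac pt_at z := pt_sets z; pt_atoms; pt_eqs;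
  repeat match goal with
  | |- context [in_mem ?x ?A] => case: (in_mem x A) => //=
  end; by [].
(* Proves equalities, inclusions and disjointness of sets elementwise from the context. *)
Ltac pt := let z := fresh "z" in
  match goal with
  | |- is_true (disjoint _ _) => rewrite -setI_eq0; apply/eqP/setP=> z
  | |- is_true (subset _ _) => apply/subsetP=> z; apply/implyP
  | |- _ => apply/setP=> z
  end; pt_at z.

(** * Matroids, rank and minors *)

Section Matroid.
Variables (T : finType) (M : mat T).
Hypothesis Mm : is_matroid M.
Implicit Types (X Y Z I B C D : {set T}).

Lemma indep0 : set0 \in indep M. Proof. by case: Mm. Qed.
Lemma indep_ground X : X \in indep M -> X \subset ground M.
Proof. by case: Mm => _ + _ _; apply. Qed.
Lemma indepS X Y : Y \subset X -> X \in indep M -> Y \in indep M.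
Proof. by case: Mm => _ _ + _; apply. Qed.

Lemma indep_extend X Y : X \in indep M -> Y \in indep M -> #|X| <= #|Y| ->
  exists Z : {set T}, [/\ Z \in indep M, X \subset Z, Z \subset X :|: Y & #|Z| = #|Y|].
Proof.
move=> XI YI; move: {2}(#|Y| - #|X|) (erefl (#|Y| - #|X|)) => n.
elim: n X XI => [|n IH] X XI En leXY.
  by exists X; split=> //; [exact: subsetUl | lia].
case: Mm => _ _ _ /(_ X Y XI YI) []; first by lia.
move=> y; rewrite inE => /andP[yX yY] yXI.
have cyX: #|y |: X| = #|X|.+1 by rewrite cardsU1 yX.
case: (IH _ yXI); [by lia | by lia | move=> Z [ZI /subUsetP[_ XZ] ZS cZ]].
exists Z; split=> //; apply: subset_trans ZS _.
by rewrite !subUset subsetUl subsetUr sub1set inE yY orbT.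
Qed.

Lemma rk_ub X Y : Y \in indep M -> Y \subset X -> #|Y| <= rk M X.
Proof. by move=> YI YX; rewrite /rk (bigD1 Y) ?YI //= leq_maxl. Qed.

Lemma rk_ex X : exists Y : {set T}, [/\ Y \in indep M, Y \subset X & #|Y| = rk M X].
Proof.
have P0 : (set0 \in indep M) && ((set0 : {set T}) \subset X) by rewrite indep0 sub0set.
have /= E := @eq_bigmax_cond _ [pred Y : {set T} | (Y \in indep M) && (Y \subset X)]
                     (fun Y : {set T} => #|Y|) _.
case: E => [|Y]; first by apply/card_gt0P; exists set0.
by rewrite inE => /andP[YI YX] E; exists Y; split=> //; rewrite -E.
Qed.

Lemma rk_indep I : I \in indep M -> rk M I = #|I|.
Proof.
move=> II; apply/eqP; rewrite eqn_leq rk_ub // andbT.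
by have [Y [_ YX <-]] := rk_ex I; exact: subset_leq_card.
Qed.

Lemma basesP B : B \in bases M <-> B \in indep M /\ #|B| = rk M (ground M).
Proof.
by rewrite inE; split=> [/andP[? /eqP?]|[-> ->]]; rewrite ?eqxx.
Qed.

Lemma base_ex : exists B, B \in bases M.
Proof. by have [Y [? ? ?]] := rk_ex (ground M); exists Y; apply/basesP. Qed.

Lemma base_extend I B : I \in indep M -> B \in bases M ->
  exists B', [/\ B' \in bases M, I \subset B' & B' \subset I :|: B].
Proof.
move=> II /basesP[BI cB]; case: (indep_extend II BI) => [|Z [ZI IZ ZS cZ]].
  by rewrite cB rk_ub // indep_ground.
by exists Z; split=> //; apply/basesP; rewrite cZ.
Qed.

Lemma indep_base I : I \in indep M <-> exists2 B, B \in bases M & I \subset B.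
Proof.
split=> [II|[B /basesP[BI _] IB]]; last exact: indepS IB BI.
have [B BB] := base_ex; have [B' [? ? _]] := base_extend II BB.
by exists B'.
Qed.

(** Replaces the rank formula of [minor] by the usual one. If the ranks add up, extend I to an
    independent subset of Y + C of full rank: it has at most rk C elements in C, hence contains all
    of Y. *)
Lemma minor_indep C D I Y : I \in indep M -> I \subset C -> #|I| = rk M C ->
  Y \subset ground M :\: (C :|: D) ->
  (Y \in indep (minor M C D)) = (Y :|: I \in indep M).
Proof.
move=> II IC cI YS; rewrite inE YS /=.
have YC : [disjoint Y & C].
  by pt.
have YI : Y :&: I = set0 by apply/eqP; rewrite setI_eq0; apply: disjointWr YC.
apply/eqP/idP => [E|YII]; last first.
  apply/eqP; rewrite eqn_leq; apply/andP; split; last first.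
    rewrite -cI; apply: (@leq_trans #|Y :|: I|); last by apply: rk_ub => //; exact: setUS.
    by rewrite cardsU YI cards0 subn0.
  have [Z [ZI ZS <-]] := rk_ex (Y :|: C).
  rewrite -(cardsID Y Z) leq_add ?subset_leq_card ?subsetIr //.
  apply: rk_ub; first by apply: indepS ZI; exact: subsetDl.
  by rewrite subDset.
have [Z [ZI ZS cZ]] := rk_ex (Y :|: C).
case: (indep_extend II ZI); first by lia.
move=> Z' [Z'I IZ' Z'S cZ'].
have Z'YC : Z' \subset Y :|: C.
  by apply: subset_trans Z'S _; rewrite subUset ZS andbT subsetU // IC orbT.
have le1 : #|Z' :&: C| <= rk M C.
  by apply: rk_ub; rewrite ?subsetIr //; apply: indepS Z'I; exact: subsetIl.
have sub : Z' :\: C \subset Y by rewrite subDset setUC.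
have /eqP E2 : Z' :\: C == Y.
  by rewrite eqEcard sub /=; have := cardsID C Z'; move: E cZ cZ' le1; clear; lia.
by apply: indepS Z'I; rewrite subUset IZ' andbT -E2 subsetDl.
Qed.

Lemma minor_matroid C D : is_matroid (minor M C D).
Proof.
have [I [II IC cI]] := rk_ex C.
have sub X : X \in indep (minor M C D) -> X \subset ground M :\: (C :|: D).
  by rewrite inE => /andP[].
have XI X : X \subset ground M :\: (C :|: D) -> X :&: I = set0.
  by move=> XS; pt.
split.
- by rewrite (minor_indep II IC cI) ?sub0set // set0U.
- exact: sub.
- move=> X Y YX XM; have XS := sub _ XM; move: XM.
  rewrite (minor_indep II IC cI) // (minor_indep II IC cI) ?(subset_trans YX) //.
  by apply: indepS; exact: setSU.
- move=> X Y XM YM ltXY; have XS := sub _ XM; have YS := sub _ YM.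
  move: XM YM; rewrite (minor_indep II IC cI) // (minor_indep II IC cI) // => XM YM.
  case: Mm => _ _ _ /(_ _ _ XM YM) [].
    by rewrite !cardsU !XI // cards0 !subn0 ltn_add2r.
  move=> y; rewrite !inE => /andP[]; rewrite negb_or => /andP[yX yI].
  rewrite (negPf yI) orbF => yY yXI; exists y; first by rewrite inE yX.
  rewrite (minor_indep II IC cI) -?setUA // subUset XS andbT sub1set.
  exact: (subsetP YS).
Qed.

End Matroid.

Lemma mat_eq (T : finType) (M N : mat T) :
  ground M = ground N -> indep M = indep N -> M = N.
Proof. by case: M N => [? ?] [? ?] /= -> ->. Qed.

(** If I is maximal independent in C, and I' maximal independent in C' in the first minor, then I +
    I' is maximal independent in C + C'; [minor_indep] then turns both sides into the same
    condition. *)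
Lemma minor_minor (T : finType) (M : mat T) (C D C' D' : {set T}) : is_matroid M ->
  C' \subset ground M :\: (C :|: D) ->
  minor (minor M C D) C' D' = minor M (C :|: C') (D :|: D').
Proof.
move=> Mm sC'.
have g : ground M :\: (C :|: D) :\: (C' :|: D') = ground M :\: (C :|: C' :|: (D :|: D')).
  by rewrite setDDl setUACA.
apply: mat_eq => //=; apply/setP=> Y.
have [YS|YS] := boolP (Y \subset ground M :\: (C :|: C' :|: (D :|: D'))); last first.
  by rewrite !inE /= g (negPf YS).
have [I [II IC cI]] := rk_ex Mm C.
have Nm := minor_matroid Mm C D.
have [I' [II' IC' cI']] := rk_ex Nm C'.
have sI' : I' \subset ground M :\: (C :|: D) by exact: subset_trans IC' sC'.
have YS1 : Y \subset ground M :\: (C :|: D).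
  apply: subset_trans YS _; apply: setDS.
  by apply/subsetP=> z; rewrite !inE => /orP[] ->; rewrite ?orbT.
rewrite (minor_indep Nm II' IC' cI') /= ?g //.
have dII : I' :&: I = set0 by clear - sI' IC; pt.
rewrite (minor_indep Mm II IC cI) ?subUset ?YS1 // -setUA.
have III : I' :|: I \in indep M by move: II'; rewrite (minor_indep Mm II IC cI).
rewrite (minor_indep Mm III) //; first by rewrite setUC setUSS.
apply/eqP; rewrite eqn_leq rk_ub //=; last by rewrite setUC setUSS.
have [Z [ZI ZS <-]] := rk_ex Mm (C :|: C').
case: (leqP #|Z| #|I' :|: I|) => // lt.
case: (indep_extend Mm III ZI (ltnW lt)) => Z' [Z'I /subUsetP[sI'Z IZ] Z'S cZ'].
have Z'CC : Z' \subset C :|: C'.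
  apply: subset_trans Z'S _; rewrite subUset ZS andbT setUC; exact: setUSS.
have le1 : #|Z' :&: C| <= #|I|.
  by rewrite cI rk_ub ?subsetIr //; apply: indepS Z'I; rewrite ?subsetIl.
have le2 : #|Z' :\: C| <= #|I'|.
  rewrite cI' rk_ub //; last by rewrite subDset.
  rewrite (minor_indep Mm II IC cI).
    by apply: indepS Z'I; rewrite // subUset subsetDl IZ.
  by apply: subset_trans sC'; rewrite subDset.
have := cardsID C Z'.
have : #|I' :|: I| = #|I'| + #|I|.
  by rewrite cardsU dII cards0 subn0.
by clear - lt cZ' le1 le2; lia.
Qed.

(** * Families of bases *)

Lemma subset_card_succ (T : finType) (A B : {set T}) :
  A \subset B -> #|B| = #|A|.+1 -> exists2 y, y \in B :\: A & B = y |: A.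
Proof.
move=> AB cB; have /card_gt0P[y yBA] : 0 < #|B :\: A| by rewrite cardsD (setIidPr AB) cB; lia.
exists y => //; apply/eqP; rewrite eq_sym eqEcard cB cardsU1.
move: yBA; rewrite inE => /andP[yA yB].
by rewrite yA leqnn andbT; pt.
Qed.

Lemma subset_card_pred (T : finType) (A B : {set T}) :
  A \subset B -> #|B| = #|A|.+1 -> exists2 x, x \in B :\: A & A = B :\ x.
Proof.
move=> AB cB; have [x xBA ->] := subset_card_succ AB cB; exists x; last by move: xBA; rewrite inE => /andP[? ?]; pt.
by move: xBA; rewrite !inE eqxx => /andP[-> _].
Qed.

(** Bases are studied apart from [mat], so that dual families and families with a base removed fall
    under the same lemmas. *)
Definition basefam (T : finType) (E : {set T}) (bs : {set {set T}}) (r : nat) : Prop :=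
  [/\ bs != set0, forall B : {set T}, B \in bs -> B \subset E,
      forall B : {set T}, B \in bs -> #|B| = r &
      forall (B1 B2 : {set T}) x, B1 \in bs -> B2 \in bs -> x \in B1 :\: B2 ->
        exists2 y, y \in B2 :\: B1 & y |: (B1 :\ x) \in bs].

Lemma basefam_bases (T : finType) (M : mat T) : is_matroid M ->
  basefam (ground M) (bases M) (rk M (ground M)).
Proof.
move=> Mm; split.
- by have [B BB] := base_ex Mm; apply/set0Pn; exists B.
- by move=> B /basesP[/(indep_ground Mm)].
- by move=> B /basesP[].
- move=> B1 B2 x /basesP[B1I c1] B2b; rewrite inE => /andP[xB2 xB1].
  have I1 : B1 :\ x \in indep M by apply: indepS B1I; rewrite // subsetDl.
  have [B [/basesP[BI cB] sB Bs]] := base_extend Mm I1 B2b.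
  have [|y yB EB] := subset_card_succ sB; first by rewrite cB -c1 (cardsD1 x B1) xB1.
  exists y; last by rewrite -EB; apply/basesP.
  by clear - xB2 yB Bs; pt_at y.
Qed.

Section BaseFamily.
Variables (T : finType) (E : {set T}) (bs : {set {set T}}) (r : nat).
Hypothesis bf : basefam E bs r.
Implicit Types (B I J X Z : {set T}).

Lemma bf_ground B : B \in bs -> B \subset E. Proof. by case: bf => _ + _ _; apply. Qed.
Lemma bf_card B : B \in bs -> #|B| = r. Proof. by case: bf => _ _ + _; apply. Qed.
Lemma bf_exchange B1 B2 x : B1 \in bs -> B2 \in bs -> x \in B1 -> x \notin B2 ->
  exists y, [/\ y \in B2, y \notin B1 & y |: (B1 :\ x) \in bs].
Proof.
move=> b1 b2 x1 x2; case: bf => _ _ _ /(_ B1 B2 x b1 b2) []; first by rewrite inE x2.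
by move=> y; rewrite inE => /andP[? ?]; exists y.
Qed.

(** Exchange away the elements of B1 outside I + B2: each exchange brings in an element of B2, so
    their number decreases. *)
Lemma bf_extend I B1 B2 : B1 \in bs -> B2 \in bs -> I \subset B1 ->
  exists B, [/\ B \in bs, I \subset B & B \subset I :|: B2].
Proof.
move: {2}#|B1 :\: (I :|: B2)| (leqnn #|B1 :\: (I :|: B2)|) => n.
elim: n B1 => [|n IH] B1 le b1 b2 IB1.
  exists B1; split=> //; rewrite -setD_eq0 -cards_eq0; lia.
case: (posnP #|B1 :\: (I :|: B2)|) => [/eqP|/card_gt0P[x]].
  by rewrite cards_eq0 setD_eq0; exists B1.
rewrite !inE negb_or => /andP[/andP[xI xB2] xB1].
have [y [yB2 yB1 bB]] := bf_exchange b1 b2 xB1 xB2.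
apply: IH bB b2 _; last by clear - IB1 xI; pt.
have /subset_leq_card : (y |: (B1 :\ x)) :\: (I :|: B2) \subset (B1 :\: (I :|: B2)) :\ x.
  by clear - yB2; pt.
have := cardsD1 x (B1 :\: (I :|: B2)); rewrite !inE negb_or xI xB2 xB1 /=.
by move: le; clear; lia.
Qed.

(** Extend y + (B1 meet B2), a part of B2, by elements of B1: the resulting base lies in y + B1 and
    misses exactly one element of it, the required x. *)
Lemma bf_exchange_dual B1 B2 y : B1 \in bs -> B2 \in bs -> y \in B2 -> y \notin B1 ->
  exists x, [/\ x \in B1, x \notin B2 & y |: (B1 :\ x) \in bs].
Proof.
move=> b1 b2 y2 y1.
have [|B [bB IB BI]] := @bf_extend (y |: (B1 :&: B2)) B2 B1 b2 b1; first by pt.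
have BS : B \subset y |: B1 by pt.
have [|x xB eB] := subset_card_pred BS; first by rewrite cardsU1 y1 (bf_card b1) (bf_card bB).
move: xB; rewrite !inE => /andP[xB].
have yB : y \in B by apply: (subsetP IB); rewrite !inE eqxx.
case: eqP => [xy|/eqP xy] /= xB1; first by rewrite xy yB in xB.
exists x; split=> //.
  by apply: contra xB => x2; apply: (subsetP IB); rewrite !inE xB1 x2 orbT.
suff -> : y |: (B1 :\ x) = B by [].
by rewrite eB; clear - yB BS y1 xy; pt.
Qed.

Definition mat_of_bases : mat T := Mat E [set Z : {set T} | [exists B in bs, Z \subset B]].

Lemma mat_of_basesP Z : reflect (exists2 B, B \in bs & Z \subset B) (Z \in indep mat_of_bases).
Proof. by rewrite inE; apply: exists_inP. Qed.

(** For augmentation of I by J, take a base B1 above I and a base B2 above J inside J + B1. If no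
    element of J can be added to I, then J - I lies in B2 - B1 and, by exchange, B1 - B2 lies in I -
    J; comparing sizes gives #|J| <= #|I|. *)
Lemma mat_of_bases_matroid : is_matroid mat_of_bases.
Proof.
split.
- by case: bf => /set0Pn[B bB] _ _ _; apply/mat_of_basesP; exists B; rewrite ?sub0set.
- by move=> X /mat_of_basesP[B /bf_ground BE XB]; exact: subset_trans XB BE.
- by move=> X Y YX /mat_of_basesP[B bB XB]; apply/mat_of_basesP; exists B => //; exact: subset_trans YX XB.
move=> I J /mat_of_basesP[B1 b1 IB1] /mat_of_basesP[B2' b2' JB2'] lt.
have [B2 [b2 JB2 B2J]] := bf_extend b2' b1 JB2'.
case: (boolP [exists y in J :\: I, y |: I \in indep mat_of_bases]).
  by case/exists_inP=> y; exists y.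
move/exists_inPn=> noaug.
have noJ y : y \in J -> y \notin I -> y \notin B1.
  move=> yJ yI; have := noaug y; rewrite inE yI yJ => /(_ isT).
  by apply: contra => yB; apply/mat_of_basesP; exists B1 => //; rewrite subUset sub1set yB.
have D2 : B2 :\: B1 \subset J :\: I.
  apply/subsetP=> z; rewrite !inE => /andP[z1 z2].
  have := subsetP B2J z z2; rewrite inE (negPf z1) orbF => ->; rewrite andbT.
  by apply: contra z1 => /(subsetP IB1).
have D1 : B1 :\: B2 \subset I :\: J.
  apply/subsetP=> x; rewrite !inE => /andP[x2 x1].
  rewrite (contra (subsetP JB2 x) x2) /=; case: (boolP (x \in I)) => // xI.
  have [y [y2 y1 bB]] := bf_exchange b1 b2 x1 x2.
  have yD : y \in J :\: I by apply: (subsetP D2); rewrite inE y1.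
  have := noaug y yD; case/negP; apply/mat_of_basesP; exists (y |: (B1 :\ x)) => //.
  by pt.
have := subset_leq_card D1; have := subset_leq_card D2.
have DJ : J :\: I \subset B2 :\: B1.
  apply/subsetP=> y; rewrite !inE => /andP[yI yJ].
  by rewrite noJ // (subsetP JB2).
have := subset_leq_card DJ.
have := cardsID B1 B2; have := cardsID B2 B1; have := cardsID I J; have := cardsID J I.
rewrite (setIC B2 B1) (setIC J I) (bf_card b1) (bf_card b2); clear -lt; lia.
Qed.

Lemma mat_of_bases_rk : rk mat_of_bases E = r.
Proof.
have Mm := mat_of_bases_matroid; apply/eqP; rewrite eqn_leq; apply/andP; split.
  have [Y [/mat_of_basesP[B bB YB] _ <-]] := rk_ex Mm E.
  by rewrite -(bf_card bB) subset_leq_card.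
case: bf => /set0Pn[B bB] _ _ _; rewrite -(bf_card bB) rk_ub ?bf_ground //.
by apply/mat_of_basesP; exists B.
Qed.

Lemma bases_mat_of_bases : bases mat_of_bases = bs.
Proof.
apply/setP=> B; apply/idP/idP => [/basesP[/mat_of_basesP[B' b' BB']]|bB].
  rewrite mat_of_bases_rk => cB.
  suff /eqP -> : B == B' by [].
  by rewrite eqEcard BB' cB (bf_card b') leqnn.
apply/basesP; rewrite mat_of_bases_rk (bf_card bB); split=> //.
by apply/mat_of_basesP; exists B.
Qed.

Definition dual_bs : {set {set T}} := [set B : {set T} | (B \subset E) && (E :\: B \in bs)].

Lemma dual_bsP B : B \subset E -> (B \in dual_bs) = (E :\: B \in bs).
Proof. by rewrite inE => ->. Qed.

Lemma basefam_dual : basefam E dual_bs (#|E| - r).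
Proof.
split.
- case: bf => /set0Pn[B bB] _ _ _; apply/set0Pn; exists (E :\: B).
  rewrite dual_bsP ?subsetDl // setDDr setDv set0U.
  by rewrite (setIidPr (bf_ground bB)).
- by move=> B; rewrite inE => /andP[].
- move=> B; rewrite inE => /andP[BE /bf_card <-].
  rewrite cardsD (setIidPr BE); have := subset_leq_card BE; clear; lia.
move=> B1 B2 x; rewrite !inE => /andP[B1E b1] /andP[B2E b2] /andP[x2 x1].
have xE := subsetP B1E x x1.
have [||y [y1 y2 bB]] := @bf_exchange_dual _ _ x b1 b2; rewrite ?inE ?x1 ?x2 //.
move: y1 y2; rewrite !inE negb_and negbK => /andP[y1 yE]; rewrite yE orbF => y2.
exists y; rewrite !inE ?y1 //.
have -> : y |: (B1 :\ x) \subset E by pt.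
suff -> : E :\: (y |: (B1 :\ x)) = x |: ((E :\: B1) :\ y) by [].
by pt.
Qed.

(** This is how a relaxed circuit-hyperplane looks among the bases: taking a free basis out of the
    family undoes the relaxation. *)
Definition freebase X := X \in bs /\ forall x y, x \in X -> y \in E -> y \notin X -> y |: (X :\ x) \in bs.

(** An exchange can only fail by producing X itself. Then B1 = X - y + x with x outside X, and any
    other z in B2 - B1 gives X - y + z, a base by freeness; if there is no such z, then B2 = X. *)
Lemma basefam_remove_free X : freebase X -> (exists2 B, B \in bs & B != X) ->
  basefam E (bs :\ X) r.
Proof.
move=> [bX fX] [B0 b0 n0]; split.
- by apply/set0Pn; exists B0; rewrite !inE n0.
- by move=> B; rewrite !inE => /andP[_]; exact: bf_ground.
- by move=> B; rewrite !inE => /andP[_]; exact: bf_card.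
move=> B1 B2 x; rewrite !inE => /andP[n1 b1] /andP[n2 b2] /andP[x2 x1].
have [y [y2 y1 bB]] := bf_exchange b1 b2 x1 x2.
case: (eqVneq (y |: (B1 :\ x)) X) => [EX|nX]; last by exists y; rewrite !inE ?y1 ?nX.
have xX : x \notin X by rewrite -EX !inE eqxx orbF; apply: contraNneq y1 => <-.
have yX : y \in X by rewrite -EX !inE eqxx.
have EB1 : B1 = x |: (X :\ y) by rewrite -EX; pt.
case: (boolP [exists z in B2 :\: B1, z != y]) => [/exists_inP[z]|/exists_inPn noz].
  rewrite inE => /andP[z1 z2] zy; exists z; first by rewrite inE z1.
  have -> : z |: (B1 :\ x) = z |: (X :\ y) by rewrite EB1; pt.
  have zX : z \notin X by move: z1; rewrite EB1 !inE zy; case: (z \in X) => //; rewrite orbT.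
  rewrite !inE fX ?(subsetP (bf_ground b2)) // andbT.
  by apply: contraNneq zX => <-; rewrite !inE eqxx.
case/eqP: n2; apply/eqP; rewrite eqEcard (bf_card b2) (bf_card bX) leqnn andbT.
apply/subsetP=> z z2; case: (boolP (z \in B1)) => z1.
  have : z != x by apply: contraNneq x2 => <-.
  by move: z1; rewrite EB1 !inE; case: eqP => //= _ /andP[].
by have := noz z; rewrite inE z1 z2 negbK => /(_ isT) /eqP ->.
Qed.

End BaseFamily.

(** * Tutte's characterization of binary matroids *)

(* A U_{2,4}-minor on [Q] obtained by contracting the independent set [C]. *)
Definition u24 (T : finType) (I : {set {set T}}) (C Q : {set T}) : bool :=
  [&& [disjoint C & Q], #|Q| == 4,
      [forall x in Q, forall y in Q, (x != y) ==> (C :|: [set x; y] \in I)] &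
      [forall x in Q, forall y in Q, forall z in Q,
         [&& x != y, x != z & y != z] ==> (C :|: [set x; y; z] \notin I)]].

Lemma u24P (T : finType) (I : {set {set T}}) (C Q : {set T}) :
  reflect [/\ [disjoint C & Q], #|Q| = 4,
     forall x y, x \in Q -> y \in Q -> x != y -> C :|: [set x; y] \in I &
     forall x y z, x \in Q -> y \in Q -> z \in Q -> x != y -> x != z -> y != z ->
       C :|: [set x; y; z] \notin I] (u24 I C Q).
Proof.
apply: (iffP and4P) => [] [d c].
  move=> p t; split=> //; first exact/eqP.
    by move=> x y xQ yQ; move/forall_inP: p => /(_ x xQ) /forall_inP/(_ y yQ)/implyP.
  move=> x y z xQ yQ zQ xy xz yz.
  by move/forall_inP: t => /(_ x xQ)/forall_inP/(_ y yQ)/forall_inP/(_ z zQ)/implyP; apply; rewrite xy xz.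
move=> p t; split=> //; first exact/eqP.
  by apply/forall_inP=> x xQ; apply/forall_inP=> y yQ; apply/implyP; exact: p.
apply/forall_inP=> x xQ; apply/forall_inP=> y yQ; apply/forall_inP=> z zQ.
by apply/implyP=> /and3P[]; exact: t.
Qed.

Lemma uniq4P (T : finType) (Q : {set T}) : #|Q| = 4 ->
  exists a b c d, [/\ Q = [set a; b; c; d], a != b, a != c & a != d] /\ [/\ b != c, b != d & c != d].
Proof.
rewrite cardE; case E : (enum Q) => [|a [|b [|c [|d []]]]] //= _.
have := enum_uniq (mem Q); rewrite E /= !inE !negb_or => /and4P[/and3P[n1 n2 n3] /andP[n4 n5] n6 _].
exists a, b, c, d; split=> //; split=> //; apply/setP=> z.
by rewrite -mem_enum E !inE !orbA.
Qed.

(** * Vectors over F_2 contain no U_{2,4}-minor *)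

Section LinearMatroid.
Variables (T : finType) (E : {set T}) (n : nat) (v : T -> 'rV['F_2]_n).
Implicit Types (X Y C : {set T}).
Local Notation sp X := <<[seq v x | x <- enum X]>>%VS.
Local Notation fr X := (free [seq v x | x <- enum X]).

Definition lin_mat : mat T := Mat E [set X : {set T} | (X \subset E) && fr X].

Lemma perm_enumU1 x X : x \notin X -> perm_eq [seq v z | z <- enum (x |: X)] (v x :: [seq v z | z <- enum X]).
Proof.
move=> xX; rewrite -map_cons; apply: perm_map; apply: uniq_perm; rewrite ?enum_uniq //=.
  by rewrite mem_enum xX enum_uniq.
by move=> z; rewrite mem_enum !inE mem_enum.
Qed.

Lemma fr_cons x X : x \notin X -> fr (x |: X) = (v x \notin sp X) && fr X.
Proof. by move=> xX; rewrite (perm_free (perm_enumU1 xX)) free_cons. Qed.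

Lemma sp_cons x X : x \notin X -> sp (x |: X) = (<[v x]> + sp X)%VS.
Proof. by move=> xX; rewrite -span_cons; apply: eq_span; exact: perm_mem (perm_enumU1 xX). Qed.

Lemma fr_sub X Y : X \subset Y -> fr Y -> fr X.
Proof.
move=> XY; have : perm_eq [seq v z | z <- enum Y]
    ([seq v z | z <- enum X] ++ [seq v z | z <- enum (Y :\: X)]).
  rewrite -map_cat; apply: perm_map; apply: uniq_perm; rewrite ?enum_uniq //.
    rewrite cat_uniq !enum_uniq /= andbT; apply/hasPn => z.
    by rewrite !mem_enum inE => /andP[].
  move=> z; rewrite mem_cat !mem_enum inE; case: (boolP (z \in X)) => //= zX.
  by rewrite (subsetP XY).
by move/perm_free => ->; apply: catl_free.
Qed.

Lemma lin_mat_matroid : is_matroid lin_mat.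
Proof.
split.
- by rewrite inE sub0set /= enum_set0 nil_free.
- by move=> X; rewrite inE => /andP[].
- by move=> X Y YX; rewrite !inE => /andP[XE /(fr_sub YX) ->]; rewrite (subset_trans YX).
move=> X Y; rewrite !inE => /andP[XE fX] /andP[YE fY] lt.
case: (boolP [exists y in Y :\: X, v y \notin sp X]) => [/exists_inP[y yYX yn]|/exists_inPn no].
  exists y => //; move: yYX; rewrite !inE => /andP[yX yY].
  by rewrite fr_cons // yn fX subUset sub1set (subsetP YE) // XE.
have sub : (sp Y <= sp X)%VS.
  apply/span_subvP=> u /mapP[y]; rewrite mem_enum => yY ->.
  case: (boolP (y \in X)) => yX.
    by apply: memv_span; apply: map_f; rewrite mem_enum.
  by have := no y; rewrite inE yX yY negbK; apply.
have := dimvS sub; move: fX fY; rewrite /free => /eqP -> /eqP ->.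
by rewrite !size_map -!cardE leqNgt lt.
Qed.

Lemma F2_neq0 (a : 'F_2) : (a != 0)%R -> a = 1%R.
Proof. by case: a => [[|[|]]] //= i _; apply/val_inj. Qed.

(** Modulo the span of C, a plane over F_2 has only three nonzero vectors: both c and d must equal a
    + b, so c and d are not independent. *)
Lemma lin_mat_no_u24 C Q : ~~ u24 (indep lin_mat) C Q.
Proof.
apply/negP=> /u24P[dCQ /uniq4P[a [b [c [d [[eQ ab ac ad] [bc bd cd]]]]]] pair triple].
have [aQ bQ cQ dQ] : [/\ a \in Q, b \in Q, c \in Q & d \in Q].
  by rewrite eQ !inE !eqxx !orbT.
have nC z : z \in Q -> z \notin C by move=> zQ; apply/negP=> zC; move/disjz/(_ z): dCQ; rewrite zQ zC.
have P x y : x \in Q -> y \in Q -> x != y ->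
    [/\ v x \notin sp (y |: C), v y \notin sp C & C :|: [set x; y] \subset E].
  move=> xQ yQ xy; move: (pair x y xQ yQ xy).
  have -> : C :|: [set x; y] = x |: (y |: C) by clear; pt.
  by rewrite inE fr_cons ?fr_cons ?nC // ?inE ?negb_or ?xy ?nC // => /andP[-> /and3P[-> ->]].
have key z : z \in Q -> z != a -> z != b -> exists2 w, w \in sp C & v z = (v a + v b + w)%R.
  move=> zQ za zb.
  have [n1 _ s1] := P a b aQ bQ ab; have [n2 _ s2] := P z b zQ bQ zb; have [n3 _ _] := P z a zQ aQ za.
  have := triple a b z aQ bQ zQ ab; rewrite !(eq_sym _ z) => /(_ za zb).
  have -> : C :|: [set a; b; z] = z |: (a |: (b |: C)) by clear; pt.
  have nb : b \notin C by exact: nC. have na : a \notin b |: C by rewrite !inE negb_or ab nC.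
  have nz : z \notin a |: (b |: C) by rewrite !inE !negb_or za zb nC.
  have f2 : fr (a |: (b |: C)).
    have eab : C :|: [set a; b] = a |: (b |: C) by clear; pt.
    by have := pair a b aQ bQ ab; rewrite eab inE => /andP[].
  have sE : z |: (a |: (b |: C)) \subset E by clear - s1 s2; pt.
  rewrite inE sE fr_cons // f2 andbT negbK sp_cons // => /memv_addP[u /vlineP[al ->] [w1]].
  rewrite sp_cons // => /memv_addP[u' /vlineP[be ->] [w wC ->]] eq.
  have al1 : al = 1%R.
    apply: F2_neq0; apply: contraNneq n2 => al0.
    by rewrite eq al0 scale0r add0r sp_cons // memv_add // memvZ // memv_line.
  have be1 : be = 1%R.
    apply: F2_neq0; apply: contraNneq n3 => be0.
    by rewrite eq be0 scale0r add0r sp_cons ?nC // memv_add // memvZ // memv_line.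
  by exists w => //; rewrite eq al1 be1 !scale1r addrA.
have [w wC ec] : exists2 w, w \in sp C & v c = (v a + v b + w)%R by apply: key; rewrite // eq_sym.
have [w' wC' ed] : exists2 w, w \in sp C & v d = (v a + v b + w)%R by apply: key; rewrite // eq_sym.
have [] := P d c dQ cQ; first by rewrite eq_sym.
rewrite sp_cons ?nC // => /negP[].
have -> : v d = (v c + (w' - w))%R by rewrite ec ed -!addrA; do 2 congr (_ + _)%R; rewrite addrC subrK.
by rewrite memv_add ?memv_line ?memvB.
Qed.
End LinearMatroid.

(** No clause on triples as in [u24] is needed: the members of a basis family have equal size, so C
    with three more elements is too large to be independent. It also follows that all witnesses have
    equally large C and equally large D ([wit_cards]). *)
Definition wit (T : finType) (E : {set T}) (bs : {set {set T}}) (C D : {set T}) : Prop :=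
  [/\ [disjoint C & D], C :|: D \subset E, #|E :\: (C :|: D)| = 4 &
      forall x y, x \in E :\: (C :|: D) -> y \in E :\: (C :|: D) -> x != y ->
        C :|: [set x; y] \in bs].

Lemma wit_pairs (T : finType) (E : {set T}) bs (C D : {set T}) : wit E bs C D ->
  forall x, exists2 y, y \in E :\: (C :|: D) & x != y.
Proof.
move=> [_ _ /uniq4P[a [b [c [d [[eQ ab _ _] _]]]]] _] x.
case: (eqVneq x a) => [->|xa]; [exists b | exists a] => //; by rewrite eQ !inE eqxx ?orbT.
Qed.

Lemma wit_cards (T : finType) (E : {set T}) (bs : {set {set T}}) r (C D : {set T}) :
  basefam E bs r -> wit E bs C D -> r = #|C| + 2 /\ #|E| = #|C| + #|D| + 4.
Proof.
move=> bf w; have [dCD sE cQ pair] := w; split.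
  have /card_gt0P[x xQ] : 0 < #|E :\: (C :|: D)| by rewrite cQ.
  have [y yQ xy] := wit_pairs w x; rewrite -(bf_card bf (pair x y xQ yQ xy)).
  have -> : C :|: [set x; y] = x |: (y |: C) by clear; pt.
  move: xQ yQ; rewrite !inE !negb_or => /andP[/andP[xC _] _] /andP[/andP[yC _] _].
  by rewrite !cardsU1 !inE negb_or xy xC yC addn2.
rewrite -cQ -(cardsID (C :|: D)) (setIidPr sE) cardsU.
by move: dCD; rewrite -setI_eq0 => /eqP ->; rewrite cards0 subn0.
Qed.

(** * Families without witnesses are determined by the neighbours of one base *)

Section Compare.
Variables (T : finType) (E : {set T}) (r : nat).
Implicit Types (bs : {set {set T}}) (B C D : {set T}).

Lemma bf_pair_exchange bs C a b c d : basefam E bs r ->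
  [/\ a \notin C, b \notin C, c \notin C & d \notin C] -> [/\ a != b, a != c & a != d] ->
  [/\ b != c, b != d & c != d] ->
  C :|: [set a; b] \in bs -> C :|: [set c; d] \in bs ->
  (C :|: [set b; c] \in bs) || (C :|: [set b; d] \in bs).
Proof.
move=> bf [aC bC cC dC] [ab ac ad] [bc bd cd] b1 b2.
have [||y [y2 y1 bB]] := bf_exchange bf b1 b2 (x := a).
- by rewrite !inE eqxx orbT.
- by rewrite !inE !negb_or aC ac ad.
have e : y |: (C :|: [set a; b]) :\ a = C :|: [set b; y] by clear - aC ab y1; pt.
rewrite e in bB; move: y1 y2; rewrite !inE; case: (y \in C) => //= _.
by case/orP => /eqP <-; rewrite bB ?orbT.
Qed.

(** The three-term Plücker relation over F_2, with [ab] = 1. Exchange excludes that exactly one of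
    the products [ab][cd], [ac][bd], [ad][bc] is nonzero; all three nonzero would make the six pairs
    bases, which is a witness. *)
Lemma bf_pair_formula bs C a b c d : basefam E bs r -> (forall C D, ~ wit E bs C D) ->
  C \subset E -> [/\ a \in E, b \in E, c \in E & d \in E] ->
  [/\ a \notin C, b \notin C, c \notin C & d \notin C] -> [/\ a != b, a != c & a != d] ->
  [/\ b != c, b != d & c != d] ->
  C :|: [set a; b] \in bs ->
  (C :|: [set c; d] \in bs) =
  ((C :|: [set a; c] \in bs) && (C :|: [set b; d] \in bs))
  (+) ((C :|: [set a; d] \in bs) && (C :|: [set b; c] \in bs)).
Proof.
move=> bf nw CE [aE bE cE dE] [aC bC cC dC] [ab ac ad] [bc bd cd] fab.
pose f x y := C :|: [set x; y] \in bs.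
have fS x y : f x y = f y x by rewrite /f setUC [[set x; y]]setUC setUC.
have fE x y : (C :|: [set x; y] \in bs) = f x y by [].
rewrite !fE in fab *.
have sy (x y : T) : x != y -> y != x by rewrite eq_sym.
have H1 := @bf_pair_exchange bs C a b c d bf; have H2 := @bf_pair_exchange bs C b a c d bf.
have H3 := @bf_pair_exchange bs C c d a b bf; have H4 := @bf_pair_exchange bs C d c a b bf.
have H5 := @bf_pair_exchange bs C b d a c bf; have H6 := @bf_pair_exchange bs C a c b d bf.
have H7 := @bf_pair_exchange bs C b c a d bf; have H8 := @bf_pair_exchange bs C a d b c bf.
have {H1} H1 := H1 (And4 aC bC cC dC) (And3 ab ac ad) (And3 bc bd cd).
have {H2} H2 := H2 (And4 bC aC cC dC) (And3 (sy _ _ ab) bc bd) (And3 ac ad cd).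
have {H3} H3 := H3 (And4 cC dC aC bC) (And3 cd (sy _ _ ac) (sy _ _ bc)) (And3 (sy _ _ ad) (sy _ _ bd) ab).
have {H4} H4 := H4 (And4 dC cC aC bC) (And3 (sy _ _ cd) (sy _ _ ad) (sy _ _ bd)) (And3 (sy _ _ ac) (sy _ _ bc) ab).
have {H5} H5 := H5 (And4 bC dC aC cC) (And3 bd (sy _ _ ab) bc) (And3 (sy _ _ ad) (sy _ _ cd) ac).
have {H6} H6 := H6 (And4 aC cC bC dC) (And3 ac ab ad) (And3 (sy _ _ bc) cd bd).
have {H7} H7 := H7 (And4 bC cC aC dC) (And3 bc (sy _ _ ab) bd) (And3 (sy _ _ ac) cd ad).
have {H8} H8 := H8 (And4 aC dC bC cC) (And3 ad ab ac) (And3 (sy _ _ bd) (sy _ _ cd) bc).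
rewrite !fE in H1 H2 H3 H4 H5 H6 H7 H8.
rewrite !(fS b a) !(fS c a) !(fS c b) !(fS d a) !(fS d b) !(fS d c) in H1 H2 H3 H4 H5 H6 H7 H8.
have no : ~~ [&& f a b, f a c, f a d, f b c, f b d & f c d].
  apply/negP => /and5P[Fab Fac Fad Fbc /andP[Fbd Fcd]].
  pose Q := [set a; b; c; d].
  have QE : Q \subset E by rewrite /Q; clear -aE bE cE dE; pt.
  have cQ : #|Q| = 4.
    by rewrite /Q -setUA -setUA !cardsU1 cards1 !inE !negb_or ab ac ad bc bd cd.
  have QC : [disjoint Q & C] by rewrite /Q; clear - aC bC cC dC; pt.
  have eQ : E :\: (C :|: (E :\: (C :|: Q))) = Q.
    by clear - CE QE QC; move: Q QE QC => Q QE QC; pt.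
  apply: (nw C (E :\: (C :|: Q))); split; rewrite ?eQ //.
  - by clear; pt.
  - by clear - CE; pt.
  move=> x y; rewrite fE /Q !inE -!orbA.
  by do 2 (case/or4P => /eqP ->); rewrite ?eqxx // => _; rewrite // fS.
move: H1 H2 H3 H4 H5 H6 H7 H8 no fab.
case: (f a b); case: (f a c); case: (f a d); case: (f b c); case: (f b d); case: (f c d) => //= h1 h2 h3 h4 h5 h6 h7 h8;
  first [by []|by case: (h1 isT isT)|by case: (h2 isT isT)|by case: (h3 isT isT)|by case: (h4 isT isT)|by case: (h5 isT isT)|by case: (h6 isT isT)|by case: (h7 isT isT)|by case: (h8 isT isT)].
Qed.

Definition near bs1 bs2 B := forall x b, x \in E -> x \notin B -> b \in B ->
  (x |: (B :\ b) \in bs1) = (x |: (B :\ b) \in bs2).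

Section Near.
Variables (bs1 bs2 : {set {set T}}).
Hypotheses (bf1 : basefam E bs1 r) (bf2 : basefam E bs2 r).
Hypotheses (nw1 : forall C D, ~ wit E bs1 C D) (nw2 : forall C D, ~ wit E bs2 C D).

Lemma near_agree1 B B' : B \in bs1 -> B \in bs2 -> near bs1 bs2 B ->
  #|B' :\: B| <= 1 -> #|B'| = r -> B' \subset E -> (B' \in bs1) = (B' \in bs2).
Proof.
move=> b1 b2 nB le cB' B'E; have cB := bf_card bf1 b1.
case: (posnP #|B' :\: B|) => [/eqP|gt].
  rewrite cards_eq0 setD_eq0 => sB.
  have /eqP -> : B' == B by rewrite eqEcard sB cB cB' leqnn.
  by rewrite b1 b2.
have /eqP/cards1P[x ex] : #|B' :\: B| = 1 by apply/eqP; rewrite eqn_leq le.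
have /cards1P[b eb] : #|B :\: B'| == 1.
  by have := cardsID B' B; have := cardsID B B'; rewrite (setIC B') ex cards1 cB cB'; clear; lia.
have : x \in B' :\: B by rewrite ex inE.
have : b \in B :\: B' by rewrite eb inE.
rewrite !inE => /andP[bB' bB] /andP[xB xB'].
have -> : B' = x |: (B :\ b) by clear - ex eb bB' bB xB xB'; pt.
by apply: nB => //; apply: (subsetP B'E).
Qed.

(** At distance two from B the Plücker relation expresses membership through sets at distance one,
    on which the two families agree. *)
Lemma near_agree2 B B' : B \in bs1 -> B \in bs2 -> near bs1 bs2 B ->
  #|B' :\: B| <= 2 -> #|B'| = r -> B' \subset E -> (B' \in bs1) = (B' \in bs2).
Proof.
move=> b1 b2 nB le cB' B'E; have cB := bf_card bf1 b1.
case: (leqP #|B' :\: B| 1) => [le1|gt]; first exact: near_agree1 nB le1 cB' B'E.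
have cD : #|B' :\: B| = 2 by apply/eqP; rewrite eqn_leq le.
have /cards2P[c [d [cd ecd]]] : #|B' :\: B| == 2 by rewrite cD.
have /cards2P[a [b [ab eab]]] : #|B :\: B'| == 2.
  by have := cardsID B' B; have := cardsID B B'; rewrite (setIC B') cD cB cB'; clear; lia.
have BE := bf_ground bf1 b1.
have mem x y (X Y : {set T}) : X :\: Y = [set x; y] -> (x \in X /\ x \notin Y) /\ (y \in X /\ y \notin Y).
  by move/setP => e; move: (e x) (e y); rewrite !inE !eqxx orbT /= => /andP[-> ->] /andP[-> ->].
have [[cBp nc] [dBp nd]] := mem _ _ _ _ ecd.
have [[aB na] [bB nb]] := mem _ _ _ _ eab.
have ne x y (X : {set T}) : x \in X -> y \notin X -> x != y by move=> xX; apply: contraNneq => <-.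
pose C := B :&: B'.
have eB : C :|: [set a; b] = B by rewrite /C; clear - eab; pt.
have eB' : C :|: [set c; d] = B' by rewrite /C; clear - ecd; pt.
have F bs : basefam E bs r -> (forall C D, ~ wit E bs C D) -> B \in bs -> (B' \in bs) =
  ((C :|: [set a; c] \in bs) && (C :|: [set b; d] \in bs))
  (+) ((C :|: [set a; d] \in bs) && (C :|: [set b; c] \in bs)).
  move=> bf nw bB'; rewrite -{1}eB'; apply: bf_pair_formula bf nw _ _ _ _ _ _; rewrite ?eB //.
  - by rewrite /C subIset // BE.
  - by split; first [exact: (subsetP BE) | exact: (subsetP B'E)].
  - by rewrite /C !inE (negPf na) (negPf nb) (negPf nc) (negPf nd) !andbF.
  - by split=> //; first [exact: (ne _ _ _ _ nc) | exact: (ne _ _ _ _ nd)].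
  - by split=> //; first [exact: (ne _ _ _ _ nc) | exact: (ne _ _ _ _ nd)].
have G u w x y : [set u; w] = [set a; b] -> [set x; y] = [set c; d] ->
    (C :|: [set u; x] \in bs1) = (C :|: [set u; x] \in bs2).
  move=> euw exy; have [uB _] := mem u w B B' (etrans eab (esym euw)).
  have [wB' _] := mem w u B B' (etrans eab (etrans (esym euw) (setUC _ _))).
  have [[xB' nx] _] := mem x y B' B (etrans ecd (esym exy)).
  have uw : u != w.
    by apply: contraTneq ab => e; move: euw; rewrite e setUid => /setP E2; move: (E2 a) (E2 b); rewrite !inE !eqxx orbT => /eqP -> /eqP ->; rewrite negbK.
  have -> : C :|: [set u; x] = x |: (B :\ w).
    rewrite /C; case: uB wB' => uB uB' [wB wB'].
    have e : B :\: B' = [set u; w] by rewrite euw.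
    by clear - e uB uB' wB wB' uw nx xB'; pt.
  by apply: nB => //; [exact: (subsetP B'E) | case: wB'].
rewrite !F //; congr ((_ && _) (+) (_ && _)).
- exact: (G a b c d).
- by apply: (G b a d c); rewrite setUC.
- by apply: (G a b d c); rewrite // setUC.
- by apply: (G b a c d); rewrite // setUC.
Qed.
End Near.

(** Move B one exchange towards B'. The neighbours of the new base are within distance two of the
    old one, so [near] is inherited by [near_agree2]; the same lemma starts the induction at
    distance two. *)
Lemma near_bases_sub (n : nat) bs1 bs2 B B' : basefam E bs1 r -> basefam E bs2 r ->
  (forall C D, ~ wit E bs1 C D) -> (forall C D, ~ wit E bs2 C D) ->
  B \in bs1 -> B \in bs2 -> near bs1 bs2 B -> #|B' :\: B| <= n.+2 -> B' \in bs1 -> B' \in bs2.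
Proof.
move=> bf1 bf2 nw1 nw2; elim: n B => [|n IH] B b1 b2 nB le b'.
  by rewrite -(near_agree2 bf1 bf2 nw1 nw2 b1 b2 nB) ?(bf_card bf1 b') ?(bf_ground bf1 b').
case: (leqP #|B' :\: B| n.+2) => [le1|gt]; first exact: (IH _ b1 b2 nB le1 b').
have /card_gt0P[b] : 0 < #|B :\: B'|.
  have := cardsID B' B; have := cardsID B B'; rewrite (setIC B') (bf_card bf1 b1) (bf_card bf1 b').
  by move: gt; clear; lia.
rewrite inE => /andP[bB' bB].
have [x [xB' xB bb1]] := bf_exchange bf1 b1 b' bB bB'.
have xE := subsetP (bf_ground bf1 b') x xB'.
have bb2 : x |: (B :\ b) \in bs2 by rewrite -nB.
apply: (IH (x |: (B :\ b))) => //; last first.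
  have : B' :\: (x |: (B :\ b)) \subset (B' :\: B) :\ x by clear - bB'; pt.
  move/subset_leq_card; have := cardsD1 x (B' :\: B); rewrite inE xB xB'.
  by move: le; clear; lia.
move=> y z yE yB zB.
apply: (near_agree2 bf1 bf2 nw1 nw2 b1 b2 nB).
- have : (y |: ((x |: (B :\ b)) :\ z)) :\: B \subset [set x; y] by clear; pt.
  by move/subset_leq_card; rewrite cards2 => /leq_trans; apply; case: (x != y).
- rewrite cardsU1 !inE; move: yB; rewrite !inE => /negPf ->; rewrite andbF.
  by have := cardsD1 z (x |: (B :\ b)); rewrite zB (bf_card bf1 bb1).
- have s1 := bf_ground bf1 bb1; rewrite subUset sub1set yE.
  by rewrite (subset_trans _ s1) ?subsetDl.
Qed.

Lemma near_bases_eq bs1 bs2 B : basefam E bs1 r -> basefam E bs2 r ->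
  (forall C D, ~ wit E bs1 C D) -> (forall C D, ~ wit E bs2 C D) ->
  B \in bs1 -> B \in bs2 -> near bs1 bs2 B -> bs1 = bs2.
Proof.
move=> bf1 bf2 nw1 nw2 b1 b2 nB; apply/setP=> B'; apply/idP/idP.
  by apply: (near_bases_sub bf1 bf2 nw1 nw2 b1 b2 nB (n := #|B' :\: B|)); lia.
apply: (near_bases_sub bf2 bf1 nw2 nw1 b2 b1 _ (n := #|B' :\: B|)); last by lia.
by move=> x b xE xB bB; rewrite nB.
Qed.
End Compare.

(** * Witnesses and U_{2,4}-minors *)

Section Witness.
Variables (T : finType) (M : mat T).
Hypothesis Mm : is_matroid M.
Local Notation E := (ground M).
Implicit Types (X Y C D Q I B : {set T}).

Lemma wit_u24 C D : wit E (bases M) C D -> u24 (indep M) C (E :\: (C :|: D)).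
Proof.
move=> [dCD sCD cQ pair]; apply/u24P; split=> //.
- by clear; pt.
- by move=> x y xQ yQ xy; have /basesP[] := pair x y xQ yQ xy.
move=> x y z xQ yQ zQ xy xz yz; apply/negP => XI.
have /basesP[_ c2] := pair x y xQ yQ xy.
have := rk_ub XI (indep_ground Mm XI); rewrite -c2.
have -> : C :|: [set x; y; z] = z |: (C :|: [set x; y]) by clear; pt.
rewrite cardsU1 (_ : z \notin _) ?ltnn //.
by move: zQ; rewrite !inE !negb_or !(eq_sym z) xz yz => /andP[/andP[-> _] _].
Qed.

(** The minor given by C and Q may leave out elements that are neither contracted nor deleted. The
    contracted set is enlarged inside the base B0 until it completes to bases, and all remaining
    elements are deleted; as B0 avoids D0, so does the enlarged set. *)
Lemma u24_wit C Q D0 B0 : u24 (indep M) C Q -> [disjoint C :|: Q & D0] ->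
  B0 \in bases M -> [disjoint B0 & D0] ->
  exists C' D', [/\ wit E (bases M) C' D', C \subset C' & E :&: D0 \subset D'].
Proof.
move=> /u24P[dCQ cQ pair triple] dD0 bB0 dB0.
have [a [b [c [d [[eQ ab _ _] _]]]]] := uniq4P cQ.
have [aQ bQ] : a \in Q /\ b \in Q by rewrite eQ !inE !eqxx !orbT.
have iab := pair a b aQ bQ ab.
have [B [bB sB Bs]] := base_extend Mm iab bB0.
have two B1 x y : B1 \in indep M -> C :|: [set x; y] \subset B1 -> x \in Q -> y \in Q -> x != y ->
    forall z, z \in Q -> z \in B1 -> z != x -> z != y -> False.
  move=> i1 s1 xQ yQ xy z zQ zB zx zy.
  have := triple x y z xQ yQ zQ xy; rewrite !(eq_sym _ z) => /(_ zx zy)/negP; apply.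
  apply: indepS i1 => //; clear - s1 zB; pt.
have QE : Q \subset E.
  apply/subsetP=> x xQ; have [y yQ xy] : exists2 y, y \in Q & x != y.
    by case: (eqVneq x a) => [->|xa]; [exists b | exists a].
  by apply: (subsetP (indep_ground Mm (pair x y xQ yQ xy))); rewrite !inE eqxx orbT.
have /basesP[BI cB] := bB.
have BQ z : z \in Q -> z \in B -> z = a \/ z = b.
  move=> zQ zB; case: (eqVneq z a) => [|za]; first by left.
  case: (eqVneq z b) => [|zb]; first by right.
  by case: (two B a b BI sB aQ bQ ab z zQ zB za zb).
(* B contains no element of Q besides a and b, since C with three elements of Q is dependent; so C'
   avoids Q. An extension of C + x + y by B likewise meets Q in x and y only, hence equals C' + x +
   y. *)
pose C' := B :\: [set a; b].
have dC'Q : [disjoint C' & Q].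
  rewrite -setI_eq0 -subset0; apply/subsetP=> z; rewrite !inE negb_or => /andP[/andP[/andP[za zb] zB] zQ].
  by case: (BQ z zQ zB) => e; [rewrite e eqxx in za | rewrite e eqxx in zb].
have C'E : C' \subset E by apply: subset_trans (indep_ground Mm BI); exact: subsetDl.
have eQ' : E :\: (C' :|: (E :\: (C' :|: Q))) = Q.
  by clear - dC'Q QE C'E; move: C' dC'Q C'E => C' dC'Q C'E; pt.
exists C', (E :\: (C' :|: Q)); split.
- split; rewrite ?eQ' //.
  + by move: C' {dC'Q eQ' C'E} => C'; clear; pt.
  + by move: C' {dC'Q eQ'} C'E => C' C'E; clear - C'E; pt.
  move=> x y xQ yQ xy.
  have [B2 [b2 s2 B2s]] := base_extend Mm (pair x y xQ yQ xy) bB.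
  have /basesP[B2I cB2] := b2.
  have sub : B2 \subset C' :|: [set x; y].
    apply/subsetP=> z zB2; rewrite /C' !inE.
    case: (eqVneq z x) => [|zx]; first by rewrite ?orbT.
    case: (eqVneq z y) => [|zy]; first by rewrite ?orbT.
    have zQ : z \notin Q by apply/negP=> zQ; exact: (two B2 x y B2I s2 xQ yQ xy z zQ zB2 zx zy).
    have := subsetP B2s z zB2; rewrite !inE (negPf zx) (negPf zy) /= !orbF.
    have za : z != a by apply: contraNneq zQ => ->.
    have zb : z != b by apply: contraNneq zQ => ->.
    rewrite negb_or za zb => H; suff -> : z \in B by [].
    by case/orP: H => // zC; apply: (subsetP sB); rewrite inE zC.
  suff /eqP <- : B2 == C' :|: [set x; y] by [].
  rewrite eqEcard sub /= cB2 -cB.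
  have cab : #|[set a; b]| = 2 by rewrite cards2 ab.
  have cxy : #|[set x; y]| = 2 by rewrite cards2 xy.
  have sab : [set a; b] \subset B by clear - sB; pt.
  have := cardsU C' [set x; y]; have := cardsD B [set a; b]; rewrite (setIidPr sab) cab cxy -/C'.
  have := subset_leq_card sab; rewrite cab; clear; lia.
- by rewrite /C'; clear - sB dCQ aQ bQ; pt.
have Bd : [disjoint B & D0] by clear - Bs dB0 dD0 aQ bQ; pt.
by rewrite /C'; clear - Bd dD0; pt.
Qed.

Lemma no_u24_no_wit : (forall C Q, ~~ u24 (indep M) C Q) -> forall C D, ~ wit E (bases M) C D.
Proof. by move=> no C D /wit_u24; apply/negP. Qed.

End Witness.

(** * A matrix over F_2 from the fundamental circuits of a base *)

Section Representation.
Variables (T : finType) (M : mat T) (B0 : {set T}).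
Hypotheses (Mm : is_matroid M) (bB0 : B0 \in bases M).
Local Notation E := (ground M).

(** The entry in row b of the column of x in the matrix [I | A] with respect to B0: for x outside B0
    it tells whether b lies in the fundamental circuit of x. Rows are indexed by all of T in [frep];
    those outside B0 vanish. *)
Definition cof x b : bool := if x \in B0 then x == b else (b \in B0) && (x |: (B0 :\ b) \in bases M).
Definition frep x : 'rV['F_2]_#|T| := (\row_j (cof x (enum_val j))%:R)%R.
Local Notation sp X := <<[seq frep x | x <- enum X]>>%VS.
Local Notation fr X := (free [seq frep x | x <- enum X]).

Lemma frep_rank x b : (frep x ord0 (enum_rank b) = (cof x b)%:R)%R.
Proof. by rewrite mxE enum_rankK. Qed.

Lemma cof_base x b : cof x b -> b \in B0.
Proof. by rewrite /cof; case: ifP => [xB /eqP <- //|_ /andP[]]. Qed.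

Lemma span_rank0 (X : {set T}) b u : (forall x, x \in X -> ~~ cof x b) ->
  u \in sp X -> u ord0 (enum_rank b) = 0%R.
Proof.
move=> X0 /(@coord_span _ _ _ (in_tuple [seq frep x | x <- enum X])) ->.
rewrite summxE big1 // => i _; rewrite mxE.
have : nth 0%R [seq frep x | x <- enum X] i \in [seq frep x | x <- enum X] by rewrite mem_nth.
case/mapP => x; rewrite mem_enum => xX ->.
by rewrite frep_rank (negPf (X0 x xX)) mulr0.
Qed.

Lemma frep_sum x : frep x = (\sum_(b in B0 | cof x b) frep b)%R.
Proof.
apply/rowP=> j; rewrite summxE mxE.
have cofB b k : b \in B0 -> cof b k = (b == k) by rewrite /cof => ->.
case: (boolP (cof x (enum_val j))) => cj.
  have jB := cof_base cj.
  rewrite (bigD1 (enum_val j)) /= ?jB // mxE cofB // eqxx big1 ?addr0 // => b /andP[/andP[bB _] bj].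
  by rewrite mxE cofB // (negPf bj).
rewrite big1 // => b /andP[bB cb]; rewrite mxE cofB //.
by case: eqP => // e; rewrite -e cb in cj.
Qed.

Lemma fr_B0 (X : {set T}) : X \subset B0 -> fr X.
Proof.
move: {2}#|X| (erefl #|X|) => n; elim: n X => [|n IH] X cX XB.
  by move/eqP: cX; rewrite cards_eq0 => /eqP ->; rewrite enum_set0 nil_free.
have /card_gt0P[x xX] : 0 < #|X| by rewrite cX.
have cX' : #|X :\ x| = n by have := cardsD1 x X; rewrite xX cX => -[].
have sX' : X :\ x \subset B0 by rewrite (subset_trans _ XB) ?subsetDl.
rewrite -(setD1K xX) fr_cons ?IH //; last by rewrite !inE eqxx.
rewrite andbT; apply/negP => /(span_rank0 (b := x)) H.
have : (frep x ord0 (enum_rank x) = 0)%R.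
  apply: H => y; rewrite !inE => /andP[yx yX]; rewrite /cof (subsetP XB) //.
by rewrite frep_rank /cof (subsetP XB) // eqxx => /eqP; rewrite oner_eq0.
Qed.

Lemma fr_swap x b : x \notin B0 -> b \in B0 -> fr (x |: (B0 :\ b)) = cof x b.
Proof.
move=> xB bB; rewrite fr_cons; last by rewrite !inE negb_and xB orbT.
rewrite fr_B0 ?subsetDl // andbT; case: (boolP (cof x b)) => cb.
  apply/negP => /(span_rank0 (b := b)) H.
  have : (frep x ord0 (enum_rank b) = 0)%R.
    apply: H => y; rewrite !inE => /andP[yb yB]; rewrite /cof yB //.
  by rewrite frep_rank cb => /eqP; rewrite oner_eq0.
apply/negbTE; rewrite negbK frep_sum; apply: memv_suml => y /andP[yB cy].
apply: memv_span; apply: map_f; rewrite mem_enum !inE yB andbT.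
by apply: contraNneq cb => <-.
Qed.

(** The linear matroid of [frep] has B0 as a base, has the same neighbours of B0 as M, and has no
    witnesses; [near_bases_eq] makes it equal to M. *)
Lemma binary_of_no_wit : (forall C D, ~ wit E (bases M) C D) -> binary M.
Proof.
move=> nw; set N := lin_mat E frep.
have Nm : is_matroid N := lin_mat_matroid E frep.
have B0E : B0 \subset E by have [/(indep_ground Mm)] := (basesP M B0).1 bB0.
have B0N : B0 \in indep N by rewrite inE B0E fr_B0.
have cN : rk N E = #|B0|.
  have [Z [ZN ZE cZ]] := rk_ex Nm E.
  apply/eqP; rewrite eqn_leq rk_ub // andbT -cZ leqNgt; apply/negP => lt.
  case: (Nm) => _ _ _ /(_ _ _ B0N ZN lt) [x]; rewrite inE => /andP[xB xZ].
  rewrite inE fr_cons // => /and3P[_ /negP[]].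
  by rewrite frep_sum; apply: memv_suml => y /andP[yB _]; apply: memv_span; apply: map_f; rewrite mem_enum.
have bB0N : B0 \in bases N by apply/basesP.
have cB0 : #|B0| = rk M E by have [] := (basesP M B0).1 bB0.
have bf1 := basefam_bases Mm; have bf2 := basefam_bases Nm; rewrite /= cN cB0 in bf2.
have eb : bases M = bases N.
  apply: (near_bases_eq bf1 bf2 nw _ bB0 bB0N).
    by apply: (no_u24_no_wit Nm) => C Q; exact: lin_mat_no_u24.
  move=> x b xE xB bB.
  have cs : #|x |: (B0 :\ b)| = #|B0|.
    by rewrite cardsU1 !inE negb_and xB orbT (cardsD1 b B0) bB.
  have sE : x |: (B0 :\ b) \subset E by rewrite subUset sub1set xE (subset_trans _ B0E) ?subsetDl.
  rewrite [RHS]inE cs cN eqxx andbT [RHS]inE sE fr_swap //= /cof (negPf xB) bB /=.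
  by [].
exists #|T|, frep => X XE; apply/idP/idP.
  move/(indep_base Mm) => [B]; rewrite eb => bB XB.
  have : X \in indep N by apply/(indep_base Nm); exists B.
  by rewrite inE => /andP[].
move=> fX; have : X \in indep N by rewrite inE XE.
by move/(indep_base Nm) => [B]; rewrite -eb => bB XB; apply/(indep_base Mm); exists B.
Qed.
End Representation.

Lemma binary_no_u24 (T : finType) (M : mat T) : is_matroid M -> binary M ->
  forall C Q, ~~ u24 (indep M) C Q.
Proof.
move=> Mm [n [v hv]] C Q.
have -> : indep M = indep (lin_mat (ground M) v); last exact: lin_mat_no_u24.
apply/setP=> X; rewrite inE; case: (boolP (X \subset ground M)) => XE; first exact: hv.
by apply/negP => /(indep_ground Mm); apply/negP.
Qed.

Lemma binaryP (T : finType) (M : mat T) : is_matroid M ->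
  (binary M <-> forall C Q, ~~ u24 (indep M) C Q).
Proof.
move=> Mm; split=> [|no]; first exact: binary_no_u24.
have [B bB] := base_ex Mm.
exact: (binary_of_no_wit Mm bB (no_u24_no_wit Mm no)).
Qed.

Lemma binary_or_u24 (T : finType) (M : mat T) : is_matroid M ->
  binary M \/ exists C Q, u24 (indep M) C Q.
Proof.
move=> Mm; case: (boolP [exists C, [exists Q, u24 (indep M) C Q]]) => [/existsP[C /existsP[Q u]]|no].
  by right; exists C, Q.
left; apply/binaryP => // C Q; apply: contra no => u.
by apply/existsP; exists C; apply/existsP; exists Q.
Qed.

(** * Minors of excluded minors *)

Lemma u24_ground (T : finType) (M : mat T) (C Q : {set T}) : is_matroid M ->
  u24 (indep M) C Q ->
  C :|: Q \subset ground M.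
Proof.
move=> Mm /u24P[_ cQ pair _]; apply/subsetP=> z zCQ.
have [a [b [c [d [[eQ ab ac ad] [bc bd cd]]]]]] := uniq4P cQ.
have [aQ bQ] : a \in Q /\ b \in Q by rewrite eQ !inE !eqxx !orbT.
case: (boolP (z \in Q)) => zQ.
  have [y yQ zy] : exists2 y, y \in Q & z != y.
    by case: (eqVneq z a) => [->|xa]; [exists b | exists a].
  by apply: (subsetP (indep_ground Mm (pair z y zQ yQ zy))); rewrite !inE eqxx orbT.
apply: (subsetP (indep_ground Mm (pair a b aQ bQ ab))).
by move: zCQ; rewrite !inE (negPf zQ) orbF => ->.
Qed.

Section Minors.
Variables (T : finType) (M : mat T).
Hypothesis Mm : is_matroid M.
Local Notation E := (ground M).
Implicit Types (X Y C D Q I B : {set T}).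

(** Contracting C0 amounts to contracting a maximal independent subset I of C0, which is joined to
    the contracted set of the U_{2,4}-minor. *)
Lemma minor_u24 C0 D0 C Q : u24 (indep (minor M C0 D0)) C Q ->
  exists I, [/\ I \in indep M, I \subset C0, #|I| = rk M C0,
    u24 (indep M) (C :|: I) Q & C :|: Q \subset E :\: (C0 :|: D0)].
Proof.
move=> u; have [I [II IC cI]] := rk_ex Mm C0.
have sub : C :|: Q \subset E :\: (C0 :|: D0) := u24_ground (minor_matroid Mm C0 D0) u.
exists I; split=> //.
have [dCQ cQ pair triple] := u24P _ _ _ u.
have e (S : {set T}) : C :|: I :|: S = (C :|: S) :|: I by rewrite setUAC.
have sS (S : {set T}) : S \subset Q -> C :|: S \subset E :\: (C0 :|: D0).
  by move=> sS; apply: subset_trans sub; exact: setUS.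
apply/u24P; split=> //.
- by clear - dCQ sub IC; pt.
- move=> x y xQ yQ xy; rewrite e -(minor_indep Mm II IC cI (D := D0)); first exact: pair.
  by apply: sS; rewrite subUset !sub1set xQ.
move=> x y z xQ yQ zQ xy xz yz; rewrite e -(minor_indep Mm II IC cI (D := D0)); first exact: triple.
by apply: sS; rewrite !subUset !sub1set xQ yQ.
Qed.

Lemma binary_minor C D : binary M -> binary (minor M C D).
Proof.
move=> /(binaryP Mm) no; apply/(binaryP (minor_matroid Mm C D)) => C' Q.
by apply/negP => /minor_u24[I [_ _ _ u _]]; move: u; apply/negP.
Qed.

Lemma wit_minor_nonbinary C D C0 D0 : wit E (bases M) C D ->
  C0 \subset C -> D0 \subset D -> ~ binary (minor M C0 D0).
Proof.
move=> w sC sD /(binaryP (minor_matroid Mm C0 D0)) /(_ (C :\: C0) (E :\: (C :|: D)))/negP; apply.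
have /u24P[dCQ cQ pair triple] := wit_u24 Mm w.
have [dCD sCD _ _] := w.
have [a [b [c [d [[eQ ab _ _] _]]]]] := uniq4P cQ.
have CI : C \in indep M.
  apply: indepS (pair a b _ _ ab); rewrite ?subsetUl // eQ !inE eqxx ?orbT //.
have C0I := indepS Mm sC CI.
have cC0 : #|C0| = rk M C0 by rewrite rk_indep.
have e (S : {set T}) : (C :\: C0) :|: S :|: C0 = C :|: S by clear - sC; pt.
set Q := E :\: (C :|: D) in dCQ cQ pair triple eQ *.
have sS (S : {set T}) : S \subset Q -> (C :\: C0) :|: S \subset E :\: (C0 :|: D0).
  by rewrite /Q; move=> sS; clear - sC sD sCD sS dCD; pt.
apply/u24P; split=> //.
- by clear - dCQ; pt.
- move=> x y xQ yQ xy; rewrite (minor_indep Mm C0I (subxx _) cC0) ?e; first exact: pair.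
  by apply: sS; rewrite subUset !sub1set xQ.
move=> x y z xQ yQ zQ xy xz yz; rewrite (minor_indep Mm C0I (subxx _) cC0) ?e; first exact: triple.
by apply: sS; rewrite !subUset !sub1set xQ yQ.
Qed.

(** d is a loop of M/C, and deleting a loop is the same as contracting it. *)
Lemma minor_eq_closure C D d : C \in indep M -> d \in E -> d \notin C -> d |: C \notin indep M ->
  minor M (d |: C) D = minor M C (d |: D).
Proof.
move=> CI dE dC dep.
have g : E :\: (d |: C :|: D) = E :\: (C :|: (d |: D)) by clear; pt.
have cC : #|C| = rk M C by rewrite rk_indep.
have cdC : #|C| = rk M (d |: C).
  apply/eqP; rewrite eqn_leq rk_ub ?subsetUr //=.
  have [Z [ZI sZ <-]] := rk_ex Mm (d |: C).
  case: (leqP #|Z| #|C|) => // lt.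
  case/negP: dep; suff /eqP <- : Z == d |: C by [].
  by rewrite eqEcard sZ cardsU1 dC.
apply: mat_eq; first exact: g.
apply/setP=> Y.
have [YS|YS] := boolP (Y \subset E :\: (C :|: (d |: D))); last by rewrite !inE g (negPf YS).
rewrite (minor_indep Mm CI (subsetUr [set d] C) cdC) ?g //.
by rewrite (minor_indep Mm CI (subxx C) cC).
Qed.

End Minors.

Lemma classZ_minor (T : finType) (M : mat T) (C D : {set T}) : is_matroid M ->
  C :|: D \subset ground M -> [disjoint C & D] -> classZ M -> classZ (minor M C D).
Proof.
move=> Mm sCD dCD Z e; rewrite /= inE => /andP[eCD eE].
have e1 : del (minor M C D) e = minor (del M e) C D.
  rewrite /del !minor_minor ?sub0set ?setU0 ?set0U 1?[[set e] :|: _]setUC //.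
  by clear - sCD eCD; pt.
have e2 : con (minor M C D) e = minor (con M e) C D.
  rewrite /con !minor_minor ?setU0 ?set0U 1?[[set e] :|: _]setUC //.
    by clear - sCD eCD; pt.
  by rewrite sub1set inE eCD.
case: (Z e eE) => b; [left|right]; rewrite ?e1 ?e2; apply: binary_minor b; exact: minor_matroid.
Qed.

(** * Constraints on the witnesses of an excluded minor *)

Section ExcludedMinors.
Variables (T : finType) (M : mat T).
Hypothesis Mm : is_matroid M.
Local Notation E := (ground M).
Local Notation bs := (bases M).
Implicit Types (X Y C D Q I B : {set T}).

(** Enough because the class is closed under minors: a proper minor is a minor of some M\f or
    M/f. *)
Lemma excluded_of_single : ~ classZ M ->
  (forall f, f \in E -> classZ (del M f) /\ classZ (con M f)) -> excluded_minor_Z M.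
Proof.
move=> nZ single; split=> // C D dCD sCD /set0Pn[f]; rewrite inE => fCD.
have fE : f \in E by apply: (subsetP sCD); rewrite inE.
have [Zd Zc] := single f fE.
case: (boolP (f \in C)) fCD => fC /=; last move=> fD.
  have -> : minor M C D = minor (con M f) (C :\ f) D.
    rewrite /con minor_minor ?set0U ?setD1K //; clear - sCD dCD; pt.
  move=> _; have fD : f \notin D by have := disjz dCD f; rewrite fC.
  apply: classZ_minor Zc; first exact: minor_matroid.
    by clear - sCD dCD fC fD; rewrite /con /=; pt.
  by clear - dCD; pt.
have -> : minor M C D = minor (del M f) C (D :\ f).
  by rewrite /del minor_minor ?set0U ?setD1K //; clear - sCD fC; pt.
apply: classZ_minor Zd; first exact: minor_matroid.
  by clear - sCD dCD fC fD; rewrite /del /=; pt.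
by clear - dCD; pt.
Qed.

Hypothesis Mex : excluded_minor_Z M.

Lemma excluded_minor_cases C D e : [disjoint C & D] -> C :|: D \subset E -> C :|: D != set0 ->
  e \in E :\: (C :|: D) -> binary (minor M C (e |: D)) \/ binary (minor M (e |: C) D).
Proof.
move=> dCD sCD n0 eE; case: Mex => _ _ /(_ C D dCD sCD n0 e eE).
rewrite /del /con !minor_minor ?sub0set ?sub1set // !setU0.
by rewrite [C :|: _]setUC [D :|: _]setUC.
Qed.

(** With a in both C1 and C2, the proper minor M/a keeps both U_{2,4}-minors, one contracting u and
    the other deleting u, so it is still outside Z; a common element of D1 and D2 is deleted
    instead. *)
Lemma excluded_star C1 D1 C2 D2 u : wit E bs C1 D1 -> wit E bs C2 D2 ->
  u \in C1 -> u \in D2 -> C1 :&: C2 = set0 /\ D1 :&: D2 = set0.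
Proof.
move=> w1 w2 u1 u2.
have [dCD1 sCD1 _ _] := w1; have [dCD2 sCD2 _ _] := w2.
split; apply/eqP; apply/negPn/negP => /set0Pn[a]; rewrite inE => /andP[a1 a2].
  have [||||b|b] := @excluded_minor_cases [set a] set0 u.
  - by rewrite -setI_eq0 setI0.
  - by rewrite setU0 sub1set (subsetP sCD1) // inE a1.
  - by rewrite setU0; apply/set0Pn; exists a; rewrite inE.
  - rewrite !inE orbF (subsetP sCD1) ?inE ?u1 // andbT.
    by apply: contraTneq u2 => ->; have := disjz dCD2 a; rewrite a2 /= => ->.
  - by apply: (wit_minor_nonbinary Mm w2 _ _ b); rewrite ?setU0 ?sub1set.
  - by apply: (wit_minor_nonbinary Mm w1 _ _ b); rewrite ?sub0set // subUset !sub1set u1.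
have [||||b|b] := @excluded_minor_cases set0 [set a] u.
- by rewrite -setI_eq0 set0I.
- by rewrite set0U sub1set (subsetP sCD1) // inE a1 orbT.
- by rewrite set0U; apply/set0Pn; exists a; rewrite inE.
- rewrite !inE /= (subsetP sCD1) ?inE ?u1 // andbT.
  by apply: contraTneq u1 => ->; have := disjz dCD1 a; rewrite a1 andbT => ->.
- by apply: (wit_minor_nonbinary Mm w2 _ _ b); rewrite ?sub0set // subUset !sub1set u2.
- by apply: (wit_minor_nonbinary Mm w1 _ _ b); rewrite ?setU0 ?sub1set.
Qed.

Lemma wit_indep C D : wit E bs C D -> C \in indep M.
Proof.
move=> [_ _ /uniq4P[a [b [c [d [[eQ ab _ _] _]]]]] pair].
have /basesP[i _] : C :|: [set a; b] \in bs by apply: pair; rewrite ?eQ ?inE ?eqxx ?orbT.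
by apply: indepS i; rewrite // subsetUl.
Qed.

(** d is a loop of M/C, so U_{2,4} survives both the deletion and the contraction of d in M/C\(D -
    d). That minor is outside Z and must be M. *)
Lemma excluded_loop C D d : wit E bs C D -> d \in D -> d |: C \notin indep M ->
  C = set0 /\ D = [set d].
Proof.
move=> w dD dep; have [dCD sCD _ _] := w.
have dC : d \notin C by have := disjz dCD d; rewrite dD andbT.
have dE : d \in E by apply: (subsetP sCD); rewrite inE dD orbT.
case: (eqVneq (C :|: (D :\ d)) set0) => [e|n0].
  split; last by clear - e dD; pt.
  by clear - e; pt.
have [|||b|b] := @excluded_minor_cases C (D :\ d) d _ _ n0.
- by clear - dCD; pt.
- by clear - sCD; pt.
- by clear - dC dE; pt_at d.
- by case: (wit_minor_nonbinary Mm w _ _ b); rewrite // setD1K.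
rewrite minor_eq_closure ?(wit_indep w) // setD1K // in b.
by case: (wit_minor_nonbinary Mm w _ _ b).
Qed.

(** Dual to [excluded_loop]: the hypothesis says that c is a coloop of M/(C - c)\D, and deleting c
    there leaves the same U_{2,4} as contracting it. *)
Lemma excluded_coloop C D c : wit E bs C D -> c \in C ->
  (forall q, q \in E :\: (C :|: D) -> (C :\ c) :|: (E :\: (C :|: D) :\ q) \notin bs) ->
  C = [set c] /\ D = set0.
Proof.
move=> w cC dep; have [dCD sCD cQ pair] := w.
have cD : c \notin D by have := disjz dCD c; rewrite cC.
have cE : c \in E by apply: (subsetP sCD); rewrite inE cC.
case: (eqVneq ((C :\ c) :|: D) set0) => [e|n0].
  split; last by clear - e; pt.
  by clear - e cC; pt.
have [|||b|b] := @excluded_minor_cases (C :\ c) D c _ _ n0.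
- by clear - dCD; pt.
- by clear - sCD; pt.
- by clear - cD cE; pt_at c.
- have /negP[] := (binaryP (minor_matroid Mm _ _)).1 b set0 (E :\: (C :|: D)).
  have Ci : C :\ c \in indep M by apply: indepS (wit_indep w); rewrite // subsetDl.
  have cCi : #|C :\ c| = rk M (C :\ c) by rewrite rk_indep.
  have sQ (S : {set T}) : S \subset E :\: (C :|: D) -> S \subset E :\: (C :\ c :|: (c |: D)).
    by move=> sS; clear - sS cC cD; pt.
  apply/u24P; split=> //; first by rewrite -setI_eq0 set0I.
    move=> x y xQ yQ xy.
    have sxy : [set x; y] \subset E :\: (C :|: D) by rewrite subUset !sub1set xQ.
    rewrite set0U (minor_indep Mm Ci (subxx _) cCi) ?sQ //.
    have /basesP[i _] := pair x y xQ yQ xy.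
    by apply: indepS i; rewrite // setUC setSU // subsetDl.
  move=> x y z xQ yQ zQ xy xz yz.
  have sxy : [set x; y; z] \subset E :\: (C :|: D) by rewrite !subUset !sub1set xQ yQ.
  rewrite set0U (minor_indep Mm Ci (subxx _) cCi) ?sQ //.
  have c3 : #|[set x; y; z]| = 3 by rewrite -setUA !cardsU1 cards1 !inE negb_or xy xz yz.
  have [||q qQ e3] := @subset_card_pred _ [set x; y; z] (E :\: (C :|: D)) _ _; rewrite ?c3 //.
  have qE : q \in E :\: (C :|: D) by move: qQ; rewrite inE => /andP[].
  apply/negP => i; move/negP: (dep q qE); apply.
  rewrite -e3; apply/basesP; rewrite setUC; split=> //.
  rewrite (wit_cards (basefam_bases Mm) w).1 addn2 cardsU c3 (_ : _ :&: _ = set0); last by clear - sxy; pt.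
  by rewrite cards0 subn0 -(setD1K cC) setU1K ?cardsU1 !inE eqxx.
have e : c |: C :\ c = C by rewrite setD1K.
rewrite e in b.
by case: (wit_minor_nonbinary Mm w _ _ b).
Qed.

End ExcludedMinors.

(** * Propositional search over bases *)

(* The clause [(a, b)] reads: if all the sets in [a] are bases then some set in [b] is. A set is
   coded by the increasing list of the positions of its elements in a fixed list [g], relative
   to a fixed part [R] of the basis (see [mval]). *)
Definition clause := (seq (seq nat) * seq (seq nat))%type.

Definition holds (F : seq nat -> bool) (c : clause) := all F c.1 ==> has F c.2.

Definition encode (vs : seq (seq nat)) (c : clause) : seq nat * seq nat :=
  ([seq index m vs | m <- c.1], [seq index m vs | m <- c.2]).

Definition falsified i (p : seq bool) (c : seq nat * seq nat) :=
  all (fun j => (j <= i) && nth false p (i - j)) c.1 &&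
  all (fun j => (j <= i) && ~~ nth false p (i - j)) c.2.

(* Backtracking search: variable [i] is decided at depth [i], [p] is the list of the
   values chosen so far (last one first), and a branch is closed by a falsified clause
   among those whose last variable is [i]. *)
Fixpoint refuted (lev : seq (seq (seq nat * seq nat))) i (p : seq bool) : bool :=
  if lev is cls :: lev' then
    all (fun b => if has (falsified i (b :: p)) cls then true else refuted lev' i.+1 (b :: p))
        [:: true; false]
  else false.

Definition last_var (c : seq nat * seq nat) := foldr maxn 0 (c.1 ++ c.2).

Definition unsat (vs : seq (seq nat)) (cls : seq clause) : bool :=
  let es := [seq encode vs c | c <- cls] in
  refuted [seq [seq c <- es | last_var c == i] | i <- iota 0 (size vs)] 0 [::].

Lemma refuted_falsified (v : nat -> bool) lev i p : refuted lev i p -> p = rev (mkseq v i) ->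
  exists i' ls c, [/\ i' < i + size lev, ls \in lev, c \in ls &
    falsified i' (rev (mkseq v i'.+1)) c].
Proof.
elim: lev i p => [|cls lev IH] i p //= /and3P[ht hf _] ep.
have e : v i :: p = rev (mkseq v i.+1).
  by rewrite ep /mkseq -addn1 iotaD map_cat rev_cat.
have : if has (falsified i (v i :: p)) cls then true else refuted lev i.+1 (v i :: p).
  by case: (v i).
case: ifP => [/hasP[c cC fc] _|_ /IH/(_ e)[i' [ls [c [lt lsL cL fc]]]]].
  by exists i, cls, c; split=> //; rewrite -?e ?inE ?eqxx //; lia.
by exists i', ls, c; split=> //; rewrite ?inE ?lsL ?orbT //; lia.
Qed.

(** Follow the branch of the search tree on which every variable has its value under F: it ends in a
    clause that is false for F, and that clause is not in [base]. The statement covers any order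
    [vs] of the variables. *)
Lemma unsat_sound F vs base extra : unsat vs (base ++ extra) -> all (holds F) base ->
  has (fun c => ~~ holds F c) extra.
Proof.
move=> /(refuted_falsified (v := fun j => F (nth [::] vs j)))/(_ erefl).
case=> i [ls [c [lt lsL cL fc]]] hb.
have {}lt : i < size vs by move: lt; rewrite size_map size_iota.
case/mapP: lsL cL => j _ ->; rewrite mem_filter => /andP[_ /mapP[c0 c0in ec]].
have nv k : k <= i -> nth false (rev (mkseq (fun j => F (nth [::] vs j)) i.+1)) (i - k) = F (nth [::] vs k).
  move=> ki; rewrite nth_rev size_mkseq ?subSS; last by lia.
  by rewrite nth_mkseq ?subKn //; lia.
(* A set not listed in [vs] has index [size vs], beyond every depth, so a falsified clause only
   mentions listed sets. *)
have val m : index m vs <= i -> F (nth [::] vs (index m vs)) = F m.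
  by move=> im; rewrite nth_index // -index_mem; exact: leq_ltn_trans im lt.
have nc0 : ~~ holds F c0.
  move: fc; rewrite ec /falsified /= !all_map => /andP[a1 a2].
  rewrite /holds negb_imply; apply/andP; split.
    apply/allP => m /(allP a1) /= /andP[im]; by rewrite nv // val.
  apply/hasPn => m /(allP a2) /= /andP[im]; by rewrite nv // val.
rewrite mem_cat in c0in; case/orP: c0in => c0in.
  by rewrite (allP hb _ c0in) in nc0.
by apply/hasP; exists c0.
Qed.

Fixpoint subs (k : nat) (s : seq nat) : seq (seq nat) :=
  match k, s with
  | 0, _ => [:: [::]]
  | _.+1, [::] => [::]
  | k'.+1, x :: s' => [seq x :: t | t <- subs k' s'] ++ subs k s'
  end.

Lemma mem_subs k s t : uniq s -> (t \in subs k s) = subseq t s && (size t == k).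
Proof.
elim: s k t => [|x s IH] [|k] t /=; rewrite ?inE.
- by case: t.
- by case: t.
- by move=> _; case: t => [|y t] //=; rewrite andbF.
move=> /andP[xs us]; rewrite mem_cat IH //.
case: t => [|y t] /=.
  by rewrite andbF orbF; apply/mapP => -[].
case: (eqVneq y x) => [->|yx].
  rewrite mem_map ?IH //; last by move=> ? ? [].
  rewrite eqSS; case: (boolP (subseq (x :: t) s)) => [h|_]; last by rewrite orbF.
  by have := mem_subseq h (mem_head x t); rewrite (negPf xs).
rewrite [X in X || _](_ : _ = false) //.
by apply/mapP => -[t' _ [e _]]; rewrite e eqxx in yx.
Qed.

(** * The clauses given to the search *)

Definition mask_of n (A : pred nat) := [seq i <- iota 0 n | A i].

Lemma mem_mask_of n A i : (i \in mask_of n A) = (i < n) && A i.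
Proof. by rewrite mem_filter mem_iota andbC. Qed.

(** Filtering [iota 0 n] yields the increasing list again, so that equal sets have equal codes. *)
Definition swap n (m : seq nat) i j := mask_of n (fun k => (k == j) || (k \in m) && (k != i)).

(** With codes of size k + 2 and C of size k, D of size n - k - 4, these are the six sets C + pair;
    (C, D) is a witness when all of them are bases. *)
Definition between (vs : seq (seq nat)) (C D : seq nat) :=
  [seq m <- vs | all (mem m) C && ~~ has (mem m) D].

Definition exchange_clauses n (vs : seq (seq nat)) : seq clause :=
  flatten [seq [seq ([:: p.1; p.2], [seq swap n p.1 i j | j <- p.2 & j \notin p.1])
                   | i <- p.1 & i \notin p.2] | p <- [seq (m1, m2) | m1 <- vs, m2 <- vs]].

Definition meets (s t : seq nat) := has (mem t) s.

Definition mask_wits n k l :=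
  [seq p <- [seq (C, D) | C <- subs k (iota 0 n), D <- subs l (iota 0 n)] | ~~ meets p.1 p.2].

(** By size, the first conclusion lists the sets C + d + q and the second one the sets C - c + (Q -
    q), with q in Q: d is not a loop of M/C and c is not a coloop of M/(C - c)\D. *)
Definition loop_clauses vs (ws : seq (seq nat * seq nat)) : seq clause :=
  flatten [seq [seq (between vs w.1 w.2, between vs (d :: w.1) (rem d w.2)) | d <- w.2] ++
               [seq (between vs w.1 w.2, between vs (rem c w.1) (c :: w.2)) | c <- w.1] | w <- ws].

Definition star_clauses vs (pairs : seq ((seq nat * seq nat) * (seq nat * seq nat))) : seq clause :=
  [seq (between vs p.1.1 p.1.2 ++ between vs p.2.1 p.2.2, [::]) | p <- pairs].

(* Two witnesses sharing the parts [R] of C and [S0] of D always meet when [R] or [S0] is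
   nonempty; this is what [near] stands for. *)
Definition star_ok (near : bool) (ws : seq (seq nat * seq nat)) p :=
  [&& p.1 \in ws, p.2 \in ws & meets p.1.1 p.2.2 && (near || meets p.1.1 p.2.1 || meets p.1.2 p.2.2)].

Definition star_pairs (near : bool) (ws : seq (seq nat * seq nat)) :=
  [seq p <- [seq (w1, w2) | w1 <- ws, w2 <- ws] |
     meets p.1.1 p.2.2 && (near || meets p.1.1 p.2.1 || meets p.1.2 p.2.2)].

Lemma star_pairs_ok near ws : all (star_ok near ws) (star_pairs near ws).
Proof.
apply/allP => p; rewrite mem_filter => /andP[h /allpairsP[[w1 w2] /= [i1 i2 e]]].
by rewrite e /= in h *; rewrite /star_ok /= i1 i2.
Qed.

(** * The clauses hold in the matroid *)

Section Masks.
Variables (T : finType) (E : {set T}) (bs : {set {set T}}) (r : nat).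
Hypothesis bf : basefam E bs r.
Variables (R S0 : {set T}) (g : seq T) (x0 : T) (n k l : nat).
Hypotheses (ug : uniq g) (sg : size g = n) (nkl : n = k + l + 4).
Hypotheses (gR : forall x, x \in g -> x \notin R) (gS : forall x, x \in g -> x \notin S0).
Hypotheses (dRS : [disjoint R & S0]) (ERS : forall x, (x \in E) = [|| x \in R, x \in S0 | x \in g]).
Local Notation vs := (subs k.+2 (iota 0 n)).

Definition mset (m : seq nat) : {set T} := [set x | (x \in g) && (index x g \in m)].
(** R is always contracted and S0 always deleted, so codes range over the bases of the minor on g.
    They have k + 2 elements, since a base exceeds the contracted set of a witness by two. *)
Definition mval (m : seq nat) : bool := R :|: mset m \in bs.

Lemma mem_mset m i : i < n -> (nth x0 g i \in mset m) = (i \in m).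
Proof. by move=> lt; rewrite inE mem_nth ?sg // index_uniq ?sg. Qed.

Lemma mset_sub m : mset m \subset [set x in g].
Proof. by apply/subsetP=> x; rewrite !inE => /andP[]. Qed.

Lemma mset_of (X : {set T}) : X \subset [set x in g] -> #|X| = k.+2 ->
  exists2 m, m \in vs & mset m = X.
Proof.
move=> Xg cX; exists [seq index x g | x <- g & x \in X].
  have eg : [seq index x g | x <- g] = iota 0 n.
    apply: (@eq_from_nth _ 0); rewrite size_map ?size_iota ?sg // => i lt.
    by rewrite (nth_map x0) ?sg // nth_iota // index_uniq ?sg.
  rewrite mem_subs ?iota_uniq // -eg map_subseq ?filter_subseq //=.
  rewrite size_map -cX cardE; apply/eqP/perm_size/uniq_perm; [exact: filter_uniq | exact: enum_uniq |].
  move=> x; rewrite mem_filter mem_enum; case: (boolP (x \in X)) => //= xX.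
  by have := subsetP Xg x xX; rewrite inE.
apply/setP=> x; rewrite inE; case: (boolP (x \in g)) => xg /=.
  apply/mapP/idP => [[y]|xX]; last by exists x; rewrite // mem_filter xX.
  by rewrite mem_filter => /andP[yX yg] e; rewrite -(nth_index x0 xg) e nth_index.
by apply/esym/negP => /(subsetP Xg); rewrite inE (negPf xg).
Qed.

Lemma card_mset m : subseq m (iota 0 n) -> #|mset m| = size m.
Proof.
move=> sm; have um : uniq m := subseq_uniq sm (iota_uniq 0 n).
rewrite cardE -(size_map (nth x0 g)); apply/perm_size/uniq_perm; [exact: enum_uniq | |].
  rewrite map_inj_in_uniq // => i j /(mem_subseq sm) + /(mem_subseq sm).
  rewrite !mem_iota /= add0n => li lj /eqP; rewrite nth_uniq ?sg //; exact/eqP.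
move=> x; rewrite mem_enum inE; apply/andP/mapP => [[xg xm]|[i im ->]].
  by exists (index x g); rewrite ?nth_index.
have lt : i < n by have := mem_subseq sm im; rewrite mem_iota add0n.
by rewrite mem_nth ?sg // index_uniq ?sg.
Qed.

Lemma mset_swap m i j : i < n -> j < n -> mset (swap n m i j) = nth x0 g j |: (mset m :\ nth x0 g i).
Proof.
move=> li lj; apply/setP=> x; rewrite !inE.
have xi t : t < n -> x \in g -> (x == nth x0 g t) = (index x g == t).
  by move=> lt xg; rewrite -{1}(nth_index x0 xg) nth_uniq ?sg ?index_mem // -sg index_mem.
case: (boolP (x \in g)) => xg /=.
  by rewrite mem_mask_of -sg index_mem xg !xi //= andbC.
by rewrite andbF orbF; apply/esym/eqP => e; move: xg; rewrite e mem_nth ?sg.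
Qed.

Lemma mval_swap m i j : i < n -> j < n -> mval (swap n m i j) = (nth x0 g j |: ((R :|: mset m) :\ nth x0 g i) \in bs).
Proof.
move=> li lj; rewrite /mval mset_swap //; congr (_ \in bs).
have h1 : nth x0 g i \notin R by rewrite gR // mem_nth ?sg.
by clear - h1; pt.
Qed.

Lemma subs_lt q m i : m \in subs q (iota 0 n) -> i \in m -> i < n.
Proof.
by rewrite mem_subs ?iota_uniq // => /andP[sm _] /(mem_subseq sm); rewrite mem_iota.
Qed.

Lemma exchange_hold : all (holds mval) (exchange_clauses n vs).
Proof.
apply/allP => c /flatten_mapP[p /allpairsP[[m1 m2] /= [v1 v2 ->]] /= /mapP[i]].
rewrite mem_filter => /andP[i2 i1] ->; apply/implyP => /= /and3P[b1 b2 _].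
have li := subs_lt v1 i1.
have [||y [y2 y1 bB]] := bf_exchange bf b1 b2 (x := nth x0 g i).
- by rewrite in_setU mem_mset ?i1 ?orbT.
- by rewrite in_setU negb_or mem_mset // i2 gR // mem_nth ?sg.
move: y1 y2; rewrite !inE negb_or => /andP[yR y1]; rewrite (negPf yR) /= => /andP[yg y2].
rewrite yg /= in y1.
have lj : index y g < n by rewrite -sg index_mem.
apply/hasP; exists (swap n m1 i (index y g)); first by rewrite map_f // mem_filter y1.
by rewrite mval_swap // nth_index.
Qed.

Lemma maskP p : p \in mask_wits n k l ->
  [/\ p.1 \in subs k (iota 0 n), p.2 \in subs l (iota 0 n) & ~~ meets p.1 p.2].
Proof. by rewrite mem_filter => /andP[nm /allpairsP[[C1 D1] /= [? ? e]]]; rewrite e in nm *. Qed.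

Lemma mask_disjoint C1 D1 : ~~ meets C1 D1 -> [disjoint mset C1 & mset D1].
Proof.
move=> nm; rewrite -setI_eq0 -subset0; apply/subsetP=> x; rewrite !inE.
case/andP => /andP[_ x1] /andP[_ x2]; case/negP: nm.
by apply/hasP; exists (index x g).
Qed.

Lemma card_subs q m : m \in subs q (iota 0 n) -> #|mset m| = q.
Proof. by rewrite mem_subs ?iota_uniq // => /andP[sm /eqP <-]; exact: card_mset. Qed.

Lemma ERS_set : E = R :|: S0 :|: [set x in g].
Proof. by apply/setP => x; rewrite !inE ERS orbA. Qed.

Lemma gR_set : [disjoint [set x in g] & R].
Proof. by rewrite -setI_eq0 -subset0; apply/subsetP => x; rewrite !inE => /andP[/gR/negPf ->]. Qed.
Lemma gS_set : [disjoint [set x in g] & S0].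
Proof. by rewrite -setI_eq0 -subset0; apply/subsetP => x; rewrite !inE => /andP[/gS/negPf ->]. Qed.

Lemma mask_rest C1 D1 : E :\: (R :|: mset C1 :|: (S0 :|: mset D1)) =
  [set x in g] :\: (mset C1 :|: mset D1).
Proof.
have h1 := gR_set; have h2 := gS_set; have h3 := mset_sub C1; have h4 := mset_sub D1; rewrite ERS_set.
by move: [set x in g] h1 h2 h3 h4 => G h1 h2 h3 h4; clear - h1 h2 h3 h4; pt.
Qed.

Lemma between_mem m C1 D1 : {subset C1 <= iota 0 n} -> {subset D1 <= iota 0 n} -> m \in vs ->
  mset C1 \subset mset m -> [disjoint mset m & mset D1] -> m \in between vs C1 D1.
Proof.
move=> C1n D1n mv sC dD; rewrite mem_filter mv andbT; apply/andP; split.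
  apply/allP => i iC; have := C1n i iC; rewrite mem_iota add0n => /= lt.
  by rewrite -(mem_mset _ lt) (subsetP sC) // mem_mset.
apply/hasPn => i iD; have := D1n i iD; rewrite mem_iota add0n => /= lt.
by have := disjz dD (nth x0 g i); rewrite !mem_mset // iD andbT.
Qed.

Lemma betweenP m C1 D1 : m \in between vs C1 D1 ->
  [/\ m \in vs, mset C1 \subset mset m & [disjoint mset m & mset D1]].
Proof.
rewrite mem_filter => /andP[/andP[/allP aC /hasPn aD] mv]; split=> //.
  by apply/subsetP => x; rewrite !inE => /andP[-> /aC].
rewrite -setI_eq0 -subset0; apply/subsetP => x; rewrite !inE => /andP[/andP[_ xm] /andP[_ /aD]].
by rewrite /= xm.
Qed.

Lemma mset_consE i s : i < n -> mset (i :: s) = nth x0 g i |: mset s.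
Proof.
move=> li; apply/setP => x; rewrite !inE; case: (boolP (x \in g)) => xg /=.
  congr (_ || _); apply/eqP/eqP => [<-|->]; first by rewrite nth_index.
  by rewrite index_uniq ?sg.
by rewrite orbF; apply/esym/eqP => e; rewrite e mem_nth ?sg in xg.
Qed.

Lemma mset_nil : mset [::] = set0.
Proof. by apply/setP => x; rewrite !inE andbF. Qed.

(** A coded witness of the window is a witness of the whole matroid, with R and S0 added; this lets
    conditions on M be stated as clauses about the window. *)
Lemma mask_witP C1 D1 : (C1, D1) \in mask_wits n k l ->
  all mval (between vs C1 D1) <-> wit E bs (R :|: mset C1) (S0 :|: mset D1).
Proof.
case/maskP => /= vC vD nm; have dCD := mask_disjoint nm.
have cC := card_subs vC; have cD := card_subs vD.
have C1n : {subset C1 <= iota 0 n} by move=> i /(subs_lt vC); rewrite mem_iota.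
have D1n : {subset D1 <= iota 0 n} by move=> i /(subs_lt vD); rewrite mem_iota.
have h1 := gR_set; have h2 := gS_set; have h3 := mset_sub C1; have h4 := mset_sub D1.
split=> [/allP hall|[_ _ _ pair]].
  split.
  - have h0 := dRS; move: [set x in g] (mset C1) (mset D1) dCD h1 h2 h3 h4 => G A B dCD h1 h2 h3 h4.
    by clear - h0 h1 h2 h3 h4 dCD; pt.
  - rewrite ERS_set; move: [set x in g] (mset C1) (mset D1) h3 h4 => G A B h3 h4.
    by clear - h3 h4; pt.
  - rewrite mask_rest cardsD (setIidPr _); last by rewrite subUset h3.
    rewrite cardsU (_ : _ :&: _ = set0); last by apply/eqP; rewrite setI_eq0.
    by rewrite cards0 cC cD subn0 cardsE (card_uniqP ug) sg nkl; clear; lia.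
  move=> x y; rewrite !mask_rest => xQ yQ xy.
  have [||m mv em] := @mset_of (mset C1 :|: [set x; y]).
  - move: [set x in g] (mset C1) (mset D1) xQ yQ h3 => G A B xQ yQ h3.
    by clear - xQ yQ h3; pt.
  - move: xQ yQ; move: (mset C1) (mset D1) cC => A B cA; rewrite !inE !negb_or => /andP[/andP[x1 _] _] /andP[/andP[y1 _] _].
    have -> : A :|: [set x; y] = x |: (y |: A) by clear; pt.
    by rewrite !cardsU1 cA !inE !negb_or xy x1 y1.
  rewrite -setUA -em; apply: hall; apply: between_mem => //; rewrite em ?subsetUl //.
  move: (mset C1) (mset D1) dCD xQ yQ => A B dCD xQ yQ.
  by clear - xQ yQ dCD; pt.
apply/allP => m /betweenP[mv sC dD].
have cm := card_subs mv; have h5 := mset_sub m.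
have /cards2P[x [y [xy exy]]] : #|mset m :\: mset C1| == 2.
  by rewrite cardsD (setIidPr sC) cm cC; clear; lia.
have := pair x y; rewrite !mask_rest => /(_ _ _ xy).
have -> : R :|: mset C1 :|: [set x; y] = R :|: mset m.
  by move: (mset C1) (mset m) sC exy => A B sC exy; clear - sC exy; pt.
apply.
  have : x \in mset m :\: mset C1 by rewrite exy !inE eqxx.
  move: [set x in g] (mset C1) (mset D1) (mset m) h5 dD => G A B C h5 dD.
  by clear - h5 dD; pt_at x.
have : y \in mset m :\: mset C1 by rewrite exy !inE eqxx orbT.
move: [set x in g] (mset C1) (mset D1) (mset m) h5 dD => G A B C h5 dD.
by clear - h5 dD; pt_at y.
Qed.

Hypothesis Lc : forall C D d, wit E bs C D -> d \in D ->
  exists2 q, q \in E :\: (C :|: D) & C :|: [set d; q] \in bs.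
Hypothesis Ld : forall C D c, wit E bs C D -> c \in C ->
  exists2 q, q \in E :\: (C :|: D) & (C :\ c) :|: (E :\: (C :|: D) :\ q) \in bs.

Lemma loop_hold ws : {subset ws <= mask_wits n k l} -> all (holds mval) (loop_clauses vs ws).
Proof.
move=> sw; apply/allP => cl /flatten_mapP[[C1 D1] /sw cw]; have wP := mask_witP cw.
have [/= vC vD nm] := maskP cw; have dCD := mask_disjoint nm.
have cC := card_subs vC; have cD := card_subs vD.
have C1n : {subset C1 <= iota 0 n} by move=> i /(subs_lt vC); rewrite mem_iota.
have D1n : {subset D1 <= iota 0 n} by move=> i /(subs_lt vD); rewrite mem_iota.
have h1 := gR_set; have h2 := gS_set; have h3 := mset_sub C1; have h4 := mset_sub D1.
have uD : uniq D1 by move: vD; rewrite mem_subs ?iota_uniq // => /andP[/subseq_uniq-> //]; rewrite iota_uniq.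
have uC : uniq C1 by move: vC; rewrite mem_subs ?iota_uniq // => /andP[/subseq_uniq-> //]; rewrite iota_uniq.
have mset_rem i s : uniq s -> i < n -> mset (rem i s) = mset s :\ nth x0 g i.
  move=> us li; apply/setP => x; rewrite !inE mem_rem_uniq // inE.
  case: (boolP (x \in g)) => xg /=; last by rewrite andbF.
  congr (~~ _ && _); apply/eqP/eqP => [<-|->]; first by rewrite nth_index.
  by rewrite index_uniq ?sg.
rewrite mem_cat => /orP[] /mapP[i iin ->]; apply/implyP => /= /wP w.
  have li := subs_lt vD iin; set x := nth x0 g i.
  have xD : x \in mset D1 by rewrite mem_mset.
  have [|q] := Lc w (d := x); first by rewrite in_setU xD orbT.
  rewrite mask_rest => qQ qb.
  have [||m mv em] := @mset_of (mset C1 :|: [set x; q]).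
  - move: [set x in g] (mset C1) (mset D1) xD qQ h3 h4 => G A B xD qQ h3 h4.
    by clear - xD qQ h3 h4; pt.
  - have : q != x /\ q \notin mset C1 /\ x \notin mset C1.
      move: [set x in g] (mset C1) (mset D1) dCD xD qQ => G A B dCD xD qQ.
      split; first by apply: contraTneq qQ => ->; rewrite !inE xD orbT.
      by split; [clear - qQ; pt_at q | clear - dCD xD; pt_at x].
    move=> [qx [q1 x1]]; move: (mset C1) cC q1 x1 => A cA q1 x1.
    have -> : A :|: [set x; q] = q |: (x |: A) by clear; pt.
    by rewrite !cardsU1 cA !inE !negb_or qx q1 x1.
  apply/hasP; exists m; last by rewrite /mval em setUA.
  apply: between_mem => //.
  - by move=> j; rewrite inE => /orP[/eqP ->|/C1n //]; rewrite mem_iota.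
  - by move=> j /mem_rem /D1n.
  - rewrite mset_consE // em -/x; move: (mset C1) => A; by clear; pt.
  rewrite em mset_rem // -/x.
  move: [set x in g] (mset C1) (mset D1) dCD qQ => G A B dCD qQ.
  by clear - dCD qQ; pt.
have li := subs_lt vC iin; set x := nth x0 g i.
have xC : x \in mset C1 by rewrite mem_mset.
have xR : x \notin R by rewrite gR // mem_nth ?sg.
have [|q] := Ld w (c := x); first by rewrite in_setU xC orbT.
have [_ _ cQ _] := w; move: cQ; rewrite mask_rest => cQ qQ qb.
set Q := [set x in g] :\: (mset C1 :|: mset D1) in cQ qQ qb.
have dQC : [disjoint Q & mset C1].
  by rewrite /Q; move: [set x in g] (mset C1) (mset D1) => G A B; clear; pt.
have dQD : [disjoint Q & mset D1].
  by rewrite /Q; move: [set x in g] (mset C1) (mset D1) => G A B; clear; pt.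
have Qg : Q \subset [set x in g] by rewrite subsetDl.
clearbody Q.
have [||m mv em] := @mset_of ((mset C1 :\ x) :|: (Q :\ q)).
- move: [set x in g] (mset C1) h3 Qg => G A h3 Qg.
  by clear - h3 Qg; pt.
- rewrite cardsU (_ : _ :&: _ = set0).
    have := cardsD1 x (mset C1); have := cardsD1 q Q.
    by rewrite xC qQ cC cQ cards0; clear; lia.
  move: (mset C1) dQC => A dQC.
  by clear - dQC; pt.
apply/hasP; exists m.
  apply: between_mem => //.
  - by move=> j /mem_rem /C1n.
  - by move=> j; rewrite inE => /orP[/eqP ->|/D1n //]; rewrite mem_iota.
  - by rewrite mset_rem // em -/x subsetUl.
  rewrite mset_consE // em -/x; move: (mset C1) (mset D1) dCD dQC dQD xC => A B dCD dQC dQD xC.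
  by clear - dCD dQC dQD xC; pt.
rewrite /mval em; suff -> : R :|: (mset C1 :\ x :|: Q :\ q) = ((R :|: mset C1) :\ x) :|: Q :\ q by [].
by move: (mset C1) => A; clear - xR; pt.
Qed.

Lemma star_hold (near : bool) ps :
  (forall C1 D1 C2 D2 u, wit E bs C1 D1 -> wit E bs C2 D2 -> u \in C1 -> u \in D2 ->
     C1 :&: C2 = set0 /\ D1 :&: D2 = set0) ->
  (near -> R :|: S0 != set0) ->
  all (star_ok near (mask_wits n k l)) ps -> all (holds mval) (star_clauses vs ps).
Proof.
move=> star nR /allP sps; apply/allP => c /mapP[[[C1 D1] [C2 D2]] /sps pP ->].
case/and4P: pP => /= w1 w2 m12 m3.
rewrite /holds /= implybF all_cat; apply/negP => /andP[/(mask_witP w1) W1 /(mask_witP w2) W2].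
have [vC1 vD1 _] := maskP w1; have [vC2 vD2 _] := maskP w2; rewrite /= in vC1 vD1 vC2 vD2.
have meet q q' A B : A \in subs q (iota 0 n) -> B \in subs q' (iota 0 n) -> meets A B ->
    exists x, x \in mset A /\ x \in mset B.
  move=> vA vB /hasP[i iA iB]; exists (nth x0 g i).
  by rewrite !mem_mset ?iA ?iB //; exact: subs_lt vA iA.
have [u [u1 u2]] := meet _ _ _ _ vC1 vD2 m12.
have [||/setP e1 /setP e2] := star _ _ _ _ u W1 W2; rewrite ?in_setU ?u1 ?u2 ?orbT //.
case/orP: m3 => [/orP[/nR/set0Pn[x]|/(meet _ _ _ _ vC1 vC2)[x [x1 x2]]]|/(meet _ _ _ _ vD1 vD2)[x [x1 x2]]].
- by rewrite in_setU; move: (e1 x) (e2 x); rewrite !in_setI !in_setU in_set0; case: (x \in R); case: (x \in S0).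
- by move: (e1 x); rewrite !in_setI !in_setU in_set0 x1 x2 !orbT.
- by move: (e2 x); rewrite !in_setI !in_setU in_set0 x1 x2 !orbT.
Qed.
End Masks.

(** * The refuted instances *)

(** Sets fixed by unit clauses are decided first, so that one of the two branches closes at once. *)
Definition order_vars (vs : seq (seq nat)) (cls : seq clause) :=
  let us := flatten [seq c.1 ++ c.2 | c <- cls & size (c.1 ++ c.2) == 1] in
  [seq m <- vs | m \in us] ++ [seq m <- vs | m \notin us].

Definition base_clauses n k l ps : seq clause :=
  let vs := subs k.+2 (iota 0 n) in
  exchange_clauses n vs ++ loop_clauses vs (mask_wits n k l) ++ star_clauses vs ps.

Definition contradictory n k l ps (extra : seq clause) : bool :=
  let vs := subs k.+2 (iota 0 n) in
  unsat (order_vars vs extra) (base_clauses n k l ps ++ extra).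

Definition pos (ms : seq (seq nat)) : seq clause := [seq ([::], [:: m]) | m <- ms].

Definition swaps n X xs ys := [seq swap n X i j | i <- xs, j <- ys].

Definition wit_masks n k C D := between (subs k.+2 (iota 0 n)) C D.

Definition all_star n k l near := star_pairs near (mask_wits n k l).

(** Position 0 is an element c of C, 1 an element d of D, and 2 to 5 form Q. The last clauses would
    make Q + d a U_{2,5} in M/C. *)
Lemma contradictory_line :
  contradictory 6 1 1 (all_star 6 1 1 true)
    (pos (wit_masks 6 1 [:: 0] [:: 1]) ++ pos [seq [:: 0; 1; q] | q <- iota 2 4]).
Proof. by vm_compute. Qed.

(** The six ways to divide Q, at positions 2 to 5, into P and Q - P. *)
Definition pairs4 := [:: ([:: 2; 3], [:: 4; 5]); ([:: 2; 4], [:: 3; 5]); ([:: 2; 5], [:: 3; 4]);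
  ([:: 3; 4], [:: 2; 5]); ([:: 3; 5], [:: 2; 4]); ([:: 4; 5], [:: 2; 3])].

(** The added clauses deny, for every choice of P, that all exchanges of an element of c + P for one
    of d + (Q - P) turn C + P into bases. *)
Lemma contradictory_local :
  contradictory 6 1 1 (all_star 6 1 1 true)
    (pos (wit_masks 6 1 [:: 0] [:: 1]) ++
     [seq (swaps 6 (0 :: p.1) (0 :: p.1) (1 :: p.2), [::]) | p <- pairs4]).
Proof. by vm_compute. Qed.

(** Positions: c0; d0, d1; P = {3, 4}; b = 5 and the fourth element of Q. Given local freeness at
    (c0, d0), the last three clauses say that b and d0 are parallel in M/C, that they are not so
    once c0 is released, and that local freeness fails at (c0, d1). *)
Lemma contradictory_del :
  contradictory 7 1 2 (all_star 7 1 2 false)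
    (pos (wit_masks 7 1 [:: 0] [:: 1; 2]) ++ pos (swaps 7 [:: 0; 3; 4] [:: 0; 3; 4] [:: 1; 5; 6]) ++
     [:: ([:: [:: 0; 1; 5]], [::]); ([::], [:: [:: 1; 3; 5]; [:: 1; 4; 5]; [:: 1; 5; 6]]);
         (swaps 7 [:: 0; 3; 4] [:: 0; 3; 4] [:: 2; 5; 6], [::])]).
Proof. by vm_compute. Qed.

(** As [contradictory_del], with a second contracted element c1 at position 1 in place of d1. *)
Lemma contradictory_con :
  contradictory 7 2 1 (all_star 7 2 1 false)
    (pos (wit_masks 7 2 [:: 0; 1] [:: 2]) ++ pos (swaps 7 [:: 0; 1; 3; 4] [:: 0; 3; 4] [:: 2; 5; 6]) ++
     [:: ([:: [:: 0; 1; 2; 5]], [::]);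
         ([::], [:: [:: 1; 2; 3; 5]; [:: 1; 2; 4; 5]; [:: 1; 2; 5; 6]]);
         (swaps 7 [:: 0; 1; 3; 4] [:: 1; 3; 4] [:: 2; 5; 6], [::])]).
Proof. by vm_compute. Qed.

(* The instances of the star condition needed by the search, found by computer. *)
Definition cross_stars : seq ((seq nat * seq nat) * (seq nat * seq nat)) :=
  [:: (([:: 0; 2], [:: 1; 6]), ([:: 0; 1], [:: 2; 3]));
      (([:: 0; 2], [:: 6; 7]), ([:: 0; 1], [:: 2; 3]));
      (([:: 0; 7], [:: 2; 4]), ([:: 1; 4], [:: 2; 7]));
      (([:: 0; 7], [:: 2; 5]), ([:: 1; 4], [:: 2; 7]));
      (([:: 0; 7], [:: 2; 6]), ([:: 1; 4], [:: 6; 7]));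
      (([:: 1; 4], [:: 3; 6]), ([:: 0; 5], [:: 4; 6]));
      (([:: 1; 5], [:: 3; 6]), ([:: 0; 4], [:: 5; 6]))].

(** Positions: c0, c1; d0, d1; P = {4, 5}; b = 6 and the fourth element of Q. Freeness at (c0, d0),
    (c0, d1) and (c1, d0) is given, and the only exchange left to refute is that of c1 for d1. *)
Lemma contradictory_cross :
  contradictory 8 2 2 cross_stars
    (pos (wit_masks 8 2 [:: 0; 1] [:: 2; 3]) ++
     pos (swaps 8 [:: 0; 1; 4; 5] [:: 0; 4; 5] [:: 2; 6; 7]) ++
     pos (swaps 8 [:: 0; 1; 4; 5] [:: 0; 4; 5] [:: 3; 6; 7]) ++
     pos (swaps 8 [:: 0; 1; 4; 5] [:: 1; 4; 5] [:: 2; 6; 7]) ++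
     [:: ([:: [:: 0; 1; 2; 6]], [::]);
         ([::], [:: [:: 1; 2; 4; 6]; [:: 1; 2; 5; 6]; [:: 1; 2; 6; 7]]);
         ([:: [:: 0; 3; 4; 5]], [::])]).
Proof. by vm_compute. Qed.

Definition star (T : finType) (E : {set T}) (bs : {set {set T}}) : Prop :=
  forall (C1 D1 C2 D2 : {set T}) u, wit E bs C1 D1 -> wit E bs C2 D2 -> u \in C1 -> u \in D2 ->
    C1 :&: C2 = set0 /\ D1 :&: D2 = set0.

Definition loopless (T : finType) (E : {set T}) (bs : {set {set T}}) : Prop :=
  (forall (C D : {set T}) d, wit E bs C D -> d \in D ->
     exists2 q, q \in E :\: (C :|: D) & C :|: [set d; q] \in bs) /\
  (forall (C D : {set T}) c, wit E bs C D -> c \in C ->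
     exists2 q, q \in E :\: (C :|: D) & (C :\ c) :|: (E :\: (C :|: D) :\ q) \in bs).

(** * From a refuted instance to a statement about a witness *)

Section MaskPrinciple.
Variables (T : finType) (E : {set T}) (bs : {set {set T}}) (r : nat).
Hypothesis bf : basefam E bs r.
Hypothesis LL : loopless E bs.
Variables (C D : {set T}) (cs ds qs : seq T) (x0 : T) (n k l : nat).
Hypothesis W : wit E bs C D.
Hypotheses (ucs : uniq cs) (uds : uniq ds) (uqs : uniq qs).
Hypotheses (scs : {subset cs <= C}) (sds : {subset ds <= D}) (eqs : E :\: (C :|: D) = [set x in qs]).
Hypotheses (kcs : size cs = k) (lds : size ds = l) (nkl : n = k + l + 4).

Local Notation R := (C :\: [set x in cs]).
Local Notation S0 := (D :\: [set x in ds]).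
Local Notation g := (cs ++ ds ++ qs).

Lemma mem_qs x : x \in qs = (x \in E :\: (C :|: D)). Proof. by rewrite eqs inE. Qed.

Lemma mp_sets : [/\ uniq g, size g = n, forall x, x \in g -> x \notin R,
  forall x, x \in g -> x \notin S0 & [disjoint R & S0]].
Proof.
have [dCD sCD cQ _] := W.
have dis x : x \in C -> x \in D -> False by have := disjz dCD x; case: (x \in C); case: (x \in D).
have cdis x : x \in cs -> x \in ds -> False by move=> /scs a /sds b; exact: dis a b.
have qC x : x \in qs -> x \notin C by rewrite mem_qs !inE negb_or => /andP[/andP[]].
have qD x : x \in qs -> x \notin D by rewrite mem_qs !inE negb_or => /andP[/andP[]].
split.
- rewrite !cat_uniq ucs uds uqs /= andbT; apply/andP; split; apply/hasPn => x.
    rewrite mem_cat => /orP[xd|xq] /=; first by apply/negP => /cdis; apply.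
    by apply/negP => /scs; apply/negP/qC.
  by move=> xq /=; apply/negP => /sds; apply/negP/qD.
- rewrite !size_cat kcs lds nkl -addnA; congr (_ + (_ + _)).
  by rewrite -cQ eqs cardsE (card_uniqP uqs).
- move=> x; rewrite !mem_cat !inE => /or3P[->|xd|xq] //=.
    by rewrite negb_and; apply/orP; right; apply/negP => /dis; apply; exact: sds.
  by rewrite negb_and (qC x xq) orbT.
- move=> x; rewrite !mem_cat !inE => /or3P[xc|->|xq] //=.
    by rewrite negb_and; apply/orP; right; apply/negP => xD; apply: (dis x) => //; exact: scs.
  by rewrite negb_and (qD x xq) orbT.
by clear - dCD; pt.
Qed.

Lemma mp_ground x : (x \in E) = [|| x \in R, x \in S0 | x \in g].
Proof.
have [dCD sCD _ _] := W; rewrite !mem_cat mem_qs !inE negb_or.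
have sCE : x \in C -> x \in E by move=> xC; apply: (subsetP sCD); rewrite inE xC.
have sDE : x \in D -> x \in E by move=> xD; apply: (subsetP sCD); rewrite inE xD orbT.
case: (boolP (x \in cs)) => [/scs xC|_] /=; first by rewrite sCE // orbT.
case: (boolP (x \in ds)) => [/sds xD|_] /=; first by rewrite sDE // !orbT.
case: (boolP (x \in C)) => [xC|_] /=; first by rewrite sCE.
by case: (boolP (x \in D)) => [xD|_] /=; first by rewrite sDE.
Qed.

Lemma mp_mset_cs : mset g (iota 0 k) = [set x in cs].
Proof.
apply/setP => x; rewrite !inE mem_iota add0n /= index_cat; case: (boolP (x \in cs)) => xc.
  by rewrite mem_cat xc -kcs index_mem xc.
by apply/negbTE; rewrite negb_and -kcs -leqNgt leq_addr orbT.
Qed.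

Lemma mp_mset_ds : mset g (iota k l) = [set x in ds].
Proof.
have [ug _ _ _ _] := mp_sets.
apply/setP => x; rewrite !inE mem_iota index_cat; case: (boolP (x \in cs)) => xc.
  have : index x cs < k by rewrite -kcs index_mem.
  move=> lt; rewrite leqNgt lt andbF; apply/esym/negP => xd.
  by move: ug; rewrite cat_uniq => /and3P[_ /hasPn/(_ x)]; rewrite mem_cat xd /= xc => /(_ isT).
rewrite mem_cat (negPf xc) mem_cat kcs leq_addr ltn_add2l /= index_cat.
case: (boolP (x \in ds)) => xd /=; first by rewrite -lds index_mem.
by apply/negbTE; rewrite negb_and -lds -leqNgt leq_addr orbT.
Qed.

Lemma mp_C : R :|: mset g (iota 0 k) = C.
Proof.
rewrite mp_mset_cs; apply/setP => x; rewrite !inE; case: (boolP (x \in cs)) => [/scs ->|_] /=; by rewrite ?orbF.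
Qed.

Lemma mp_D : S0 :|: mset g (iota k l) = D.
Proof.
rewrite mp_mset_ds; apply/setP => x; rewrite !inE; case: (boolP (x \in ds)) => [/sds ->|_] /=; by rewrite ?orbF.
Qed.

(** The window consists of [cs] from C, [ds] from D and all of Q. In it the positions [iota 0 k] and
    [iota k l] code (C, D) itself, so the clauses of this witness hold and the failing clause lies
    in [extra]. The alternative [ps = [::]] serves the six-element search, which uses no star
    clauses. *)
Lemma mask_principle (near : bool) ps extra : star E bs \/ ps = [::] -> (near -> R :|: S0 != set0) ->
  all (star_ok near (mask_wits n k l)) ps ->
  (iota 0 k, iota k l) \in mask_wits n k l ->
  contradictory n k l ps (pos (wit_masks n k (iota 0 k) (iota k l)) ++ extra) ->
  has (fun c => ~~ holds (mval bs R g) c) extra.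
Proof.
move=> st nr pok wm; have [ug sg gR gS dRS] := mp_sets.
move=> /unsat_sound -/(_ (mval bs R g)) H.
have : has (fun c => ~~ holds (mval bs R g) c) (pos (wit_masks n k (iota 0 k) (iota k l)) ++ extra).
  apply: H; rewrite !all_cat (exchange_hold bf x0 k ug sg gR) /=.
  rewrite (loop_hold x0 ug sg nkl gR gS dRS mp_ground LL.1 LL.2 (ws := mask_wits n k l)) //=.
  case: st => [st|->] //.
  exact: (star_hold x0 ug sg nkl gR gS dRS mp_ground st nr pok).
rewrite has_cat => /orP[|//] /hasP[c /mapP[m mb ->]].
have /(mask_witP bs x0 ug sg nkl gR gS dRS mp_ground) h := wm.
rewrite /holds /= orbF => /negP[].
have : wit E bs (R :|: mset g (iota 0 k)) (S0 :|: mset g (iota k l)) by rewrite mp_C mp_D.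
by move/h => /allP; apply.
Qed.

Lemma mp_swaps X xs ys : {subset xs <= iota 0 n} -> {subset ys <= iota 0 n} ->
  all (mval bs R g) (swaps n X xs ys) <->
  forall x y, x \in mset g xs -> y \in mset g ys -> y |: ((R :|: mset g X) :\ x) \in bs.
Proof.
have [ug sg gR _ _] := mp_sets.
move=> sx sy; split=> [/allP h x y|h].
  rewrite !inE => /andP[xg xx] /andP[yg yy].
  have := h (swap n X (index x g) (index y g)) (allpairs_f _ xx yy).
  by rewrite (mval_swap bs x0 ug sg gR) ?nth_index // -sg index_mem.
apply/allP => m /allpairsP[[i j] /= [ix jy ->]].
have := sx i ix; have := sy j jy; rewrite !mem_iota !add0n /= => lj li.
by rewrite (mval_swap bs x0 ug sg gR) //; apply: h; rewrite (mem_mset x0 ug sg).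
Qed.
End MaskPrinciple.

(** * Excluded minors with at least seven elements *)

(** Freeness of the base C + P as far as the window c + d + Q can see it. *)
Definition lf (T : finType) (E : {set T}) (bs : {set {set T}}) (C D : {set T}) c d (P : {set T}) : Prop :=
  forall x y, x \in c |: P -> y \in d |: ((E :\: (C :|: D)) :\: P) -> y |: ((C :|: P) :\ x) \in bs.

Lemma split_quad (T : finType) (Q P : {set T}) b : #|Q| = 4 -> P \subset Q -> #|P| = 2 -> b \in Q :\: P ->
  exists p0 p1 z, [/\ P = [set p0; p1], Q :\: P = [set b; z], Q = [set x in [:: p0; p1; b; z]] &
                      uniq [:: p0; p1; b; z]].
Proof.
move=> cQ PQ cP bQ; have /eqP/cards2P[p0 [p1 [p01 eP]]] := cP.
have cQP : #|Q :\: P| = 2 by rewrite cardsD (setIidPr PQ) cQ cP.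
have : #|(Q :\: P) :\ b| == 1 by have := cardsD1 b (Q :\: P); rewrite bQ cQP add1n => /eqP; rewrite eqSS eq_sym.
move/cards1P => [z ez].
have eQP : Q :\: P = [set b; z] by rewrite -(setD1K bQ) ez.
exists p0, p1, z; split=> //.
  apply/setP => x; rewrite -(setID Q P) eQP (setIidPr PQ) eP !inE.
  by case: (x == p0); case: (x == p1); case: (x == b); case: (x == z).
have : z \in (Q :\: P) :\ b by rewrite ez inE.
move: bQ; rewrite eP !inE !negb_or => /andP[/andP[b0 b1] _] /and3P[zb /andP[z0 z1] _].
by rewrite /= !inE !negb_or p01 (eq_sym p0 b) (eq_sym p0 z) (eq_sym p1 b) (eq_sym p1 z) (eq_sym b z) b0 b1 z0 z1 zb.
Qed.

(** * Local freeness around one witness *)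

Section Local.
Variables (T : finType) (E : {set T}) (bs : {set {set T}}) (r : nat).
Hypothesis bf : basefam E bs r.
Hypotheses (LL : loopless E bs) (ST : star E bs).
Variables (C D : {set T}).
Hypothesis W : wit E bs C D.
Local Notation Q := (E :\: (C :|: D)).

(** Provides the nonempty rest required by [near := true] in windows with one element of C and one
    of D. *)
Lemma card_ge3_rest c d : 2 < #|C| + #|D| -> (C :\: [set x in [:: c]]) :|: (D :\: [set x in [:: d]]) != set0.
Proof.
move=> ge; apply: contraTneq ge => /setP e.
have C1 : C \subset [set c].
  by apply/subsetP => x xC; have := e x; rewrite !inE xC; case: (x == c).
have D1 : D \subset [set d].
  by apply/subsetP => x xD; have := e x; rewrite !inE xD; case: (x == d) => //; rewrite orbT.
by have := subset_leq_card C1; have := subset_leq_card D1; rewrite !cards1; clear; lia.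
Qed.

Lemma enum_setE (A : {set T}) : A = [set x in enum A].
Proof. by apply/setP => x; rewrite inE mem_enum. Qed.

Lemma sub_seq1 x (A : {set T}) : x \in A -> {subset [:: x] <= A}.
Proof. by move=> xA y; rewrite inE => /eqP ->. Qed.

Lemma sub_seq2 x y (A : {set T}) : x \in A -> y \in A -> {subset [:: x; y] <= A}.
Proof. by move=> xA yA z; rewrite !inE => /orP[] /eqP ->. Qed.

(** Some q is parallel to d in M/C: otherwise Q + d would be a U_{2,5} there. *)
Lemma line_nonbase c d : 2 < #|C| + #|D| -> c \in C -> d \in D ->
  exists2 q, q \in Q & C :|: [set d; q] \notin bs.
Proof.
move=> ge cC dD; have [_ _ cQ _] := W.
have sc := sub_seq1 cC; have sd := sub_seq1 dD.
have nkl : 6 = 1 + 1 + 4 by [].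
have uc : uniq [:: c] by []. have ud : uniq [:: d] by [].
have uq : uniq (enum Q) := enum_uniq _.
have [ug sg gR gS dRS] := mp_sets W uc ud uq sc sd (enum_setE Q) erefl erefl nkl.
have := mask_principle bf LL c W uc ud uq sc sd (enum_setE Q) erefl erefl nkl (or_introl ST)
  (fun _ => card_ge3_rest c d ge) (star_pairs_ok true (mask_wits 6 1 1)) isT contradictory_line.
case/hasP => cl /mapP[m /mapP[i i4 ->] ->]; rewrite /holds /= orbF => nm.
move: i4; rewrite mem_iota => /andP[i2 i6].
exists (nth c ([:: c] ++ [:: d] ++ enum Q) i).
  rewrite -mem_enum -(subnK i2) addn2 /= mem_nth // -cardE cQ; move: i2 i6; clear; lia.
apply: contra nm; rewrite /mval.
rewrite !(mset_consE c ug sg) // mset_nil /= setU0.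
have -> : [set x in [:: c]] = [set c] by apply/setP => x; rewrite !inE.
move: (nth _ _ _) => q; congr (_ \in bs).
by clear - cC; pt.
Qed.

Lemma mask_lf (cs ds qs : seq T) (n k l : nat) c d P i j X ps zs :
  uniq cs -> uniq ds -> uniq qs -> {subset cs <= C} -> {subset ds <= D} -> Q = [set x in qs] ->
  size cs = k -> size ds = l -> n = k + l + 4 -> i < n -> j < n ->
  let g := cs ++ ds ++ qs in
  nth c g i = c -> nth c g j = d -> all (gtn n) ps -> all (gtn n) zs ->
  mset g ps = P -> mset g zs = Q :\: P -> (C :\: [set x in cs]) :|: mset g X = C :|: P ->
  all (mval bs (C :\: [set x in cs]) g) (swaps n X (i :: ps) (j :: zs)) <-> lf E bs C D c d P.
Proof.
move=> uc ud uq sc sd eQ kc ld nkl li lj g ec ed /allP lps /allP lzs eP ezs eX.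
have [ug sg gR gS dRS] := mp_sets W uc ud uq sc sd eQ kc ld nkl.
rewrite (mp_swaps c W uc ud uq sc sd eQ kc ld nkl); first last.
- by move=> u; rewrite inE mem_iota add0n => /orP[/eqP ->|/lzs].
- by move=> u; rewrite inE mem_iota add0n => /orP[/eqP ->|/lps].
by rewrite -/g !(mset_consE c ug sg) // eP ezs eX ec ed.
Qed.

Lemma lf_ex c d : 2 < #|C| + #|D| -> c \in C -> d \in D ->
  exists P : {set T}, [/\ P \subset Q, #|P| = 2 & lf E bs C D c d P].
Proof.
move=> ge cC dD; have [dCD _ cQ _] := W.
have sc := sub_seq1 cC; have sd := sub_seq1 dD.
have nkl : 6 = 1 + 1 + 4 by [].
have uc : uniq [:: c] by []. have ud : uniq [:: d] by [].
have uq : uniq (enum Q) := enum_uniq _.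
have [ug sg gR gS dRS] := mp_sets W uc ud uq sc sd (enum_setE Q) erefl erefl nkl.
have := mask_principle bf LL c W uc ud uq sc sd (enum_setE Q) erefl erefl nkl (or_introl ST)
  (fun _ => card_ge3_rest c d ge) (star_pairs_ok true (mask_wits 6 1 1)) isT contradictory_local.
case/hasP => cl /mapP[p pp ->]; rewrite /holds /= implybF negbK => hall.
set g := [:: c] ++ [:: d] ++ enum Q in ug sg gR gS.
have /and5P[a1 a2 a3 a4 /andP[a5 a6]] : [&& all (fun i => 1 < i < 6) p.1, all (fun i => 1 < i < 6) p.2,
    all (fun i => (i \in p.1) (+) (i \in p.2)) (iota 2 4), size p.1 == 2,
    subseq p.1 (iota 0 6) & all (gtn 6) p.1 && all (gtn 6) p.2].
  by move: p pp {hall}; apply/allP; vm_compute.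
have iQ x : x \in g -> (x \in Q) = (1 < index x g).
  move=> xg; rewrite -mem_enum /g /=; move: ug; rewrite /g /= inE negb_or => /and3P[/andP[cd cq] dq _].
  case: (eqVneq c x) => [<-|cx]; first by rewrite (negPf cq).
  case: (eqVneq d x) => [<-|dx]; first by rewrite (negPf dq).
  by move: xg; rewrite /g !inE (eq_sym x c) (negPf cx) (eq_sym x d) (negPf dx) /= => ->.
have lt6 x : x \in g -> index x g < 6 by move=> xg; rewrite -sg index_mem.
exists (mset g p.1); split.
- apply/subsetP => x; rewrite /mset in_set => /andP[xg xp].
  by rewrite iQ //; have /andP[] := allP a1 _ xp.
- by rewrite (card_mset c ug sg) //; exact/eqP.
apply/(mask_lf (c := c) (i := 0) (j := 1) (X := 0 :: p.1) (zs := p.2) uc ud uq sc sd (enum_setE Q) erefl erefl nkl) => //.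
- by case/andP: a6.
- by case/andP: a6.
- rewrite -/g; apply/setP => x; rewrite in_setD; case: (boolP (x \in g)) => xg; last first.
    have -> : (x \in Q) = false.
      by apply: contraNF xg => xQ; rewrite /g !inE mem_enum xQ !orbT.
    by rewrite /mset in_set (negPf xg) andbF.
  have me m : (x \in mset g m) = (index x g \in m) by rewrite /mset in_set xg.
  rewrite iQ // !me; case: (ltnP 1 (index x g)) => lt; last first.
    rewrite andbF; apply/negP => /(allP a2) /andP[]; by rewrite ltnNge lt.
  have : index x g \in iota 2 4 by rewrite mem_iota lt lt6.
  by move/(allP a3); rewrite andbT; case: (_ \in _); case: (_ \in _).
rewrite (mset_consE c ug sg) //= -/g.
have -> : [set x in [:: c]] = [set c] by apply/setP => x; rewrite !inE.
by rewrite setUA [_ :|: [set c]]setUC setD1K.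
Qed.

(** * Transfer of local freeness from (c0, d0) to other pairs *)

Section ThreeLemmas.
Variables (c0 d0 : T) (P : {set T}) (b q : T).
Hypotheses (c0C : c0 \in C) (d0D : d0 \in D) (PQ : P \subset Q) (cP : #|P| = 2).
Hypotheses (bQ : b \in Q :\: P) (qQ : q \in Q) (qb : q != b).
Hypotheses (nb : C :|: [set d0; b] \notin bs) (yb : (C :\ c0) :|: [set d0; b; q] \in bs).
Hypothesis lf0 : lf E bs C D c0 d0 P.

Let seq_cs1 : C :\: [set x in [:: c0]] = C :\ c0.
Proof. by apply/setP => x; rewrite !inE. Qed.

(** Of the three possible failing clauses of [contradictory_del], the first contradicts [nb], the
    second contradicts [yb], and the third is the claim. The element q of [yb] is one of the three
    elements of Q other than b, hence the disjunction in the second clause. *)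
Lemma lf_del d1 : d1 \in D -> d0 != d1 -> lf E bs C D c0 d1 P.
Proof.
move=> d1D d01; have [_ _ cQ _] := W.
have [p0 [p1 [z [eP eZ eQ uq]]]] := split_quad cQ PQ cP bQ.
have sc := sub_seq1 c0C; have sd := sub_seq2 d0D d1D.
have nkl : 7 = 1 + 2 + 4 by [].
have uc : uniq [:: c0] by []. have ud : uniq [:: d0; d1] by rewrite /= inE d01.
have [ug sg gR gS dRS] := mp_sets W uc ud uq sc sd eQ erefl erefl nkl.
have := mask_principle bf LL c0 W uc ud uq sc sd eQ erefl erefl nkl (or_introl ST) _
  (star_pairs_ok false (mask_wits 7 1 2)) isT contradictory_del => /(_ (fun f => False_ind _ (notF f))).
set g := [:: c0] ++ [:: d0; d1] ++ [:: p0; p1; b; z] in ug sg gR gS *.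
have M0 : mset g [::] = set0 := mset_nil g.
have MC i s : i < 7 -> mset g (i :: s) = nth c0 g i |: mset g s by exact: (mset_consE c0 ug sg).
have LFd j d (lj : j < 7) (ed : nth c0 g j = d) := @mask_lf _ _ _ _ _ _ c0 d P 0 j [:: 0; 3; 4] [:: 3; 4] [:: 5; 6]
  uc ud uq sc sd eQ erefl erefl nkl isT lj erefl ed isT isT.
have h1 : mset g [:: 3; 4] = P by rewrite !MC // M0 setU0 /= eP.
have h2 : mset g [:: 5; 6] = Q :\: P by rewrite !MC // M0 setU0 /= eZ.
have h3 : (C :\: [set x in [:: c0]]) :|: mset g [:: 0; 3; 4] = C :|: P.
  by rewrite MC // h1 /= seq_cs1 setUA [_ :|: [set c0]]setUC setD1K.
have L0 := LFd 1 d0 isT erefl h1 h2 h3; have L1 := LFd 2 d1 isT erefl h1 h2 h3.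
rewrite has_cat => /orP[/hasP[cl /mapP[m ms ->]]|].
  by rewrite /holds /= orbF => /negP[]; move: ms; apply/allP/L0.
have qe : q \in [:: p0; p1; z].
  by move: qQ; rewrite eQ !inE (negPf qb).
rewrite /= orbF => /or3P[].
- rewrite /holds /= andbT implybF negbK /mval !MC // M0 /= seq_cs1 => h; case/negP: nb.
  have <- : C :\ c0 :|: (c0 |: (d0 |: (b |: set0))) = C :|: [set d0; b] by have hc := c0C; clear - hc; pt.
  by [].
- rewrite /holds /= orbF => /norP[n1 /norP[n2 n3]].
  move: n1 n2 n3 yb; rewrite /mval !MC // M0 /= seq_cs1 !setU0.
  have e u : d0 |: (b |: [set u]) = [set d0; b; u] by clear; pt.
  have e' u : d0 |: (u |: [set b]) = [set d0; b; u] by clear; pt.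
  by rewrite e !e'; move: qe; rewrite !inE => /or3P[] /eqP -> n1 n2 n3 y;
    [rewrite y in n1 | rewrite y in n2 | rewrite y in n3].
- by rewrite /holds implybF negbK => /L1.
Qed.

Lemma lf_con c1 : c1 \in C -> c0 != c1 -> lf E bs C D c1 d0 P.
Proof.
move=> c1C c01; have [_ _ cQ _] := W.
have [p0 [p1 [z [eP eZ eQ uq]]]] := split_quad cQ PQ cP bQ.
have sc := sub_seq2 c0C c1C; have sd := sub_seq1 d0D.
have nkl : 7 = 2 + 1 + 4 by [].
have ud : uniq [:: d0] by []. have uc : uniq [:: c0; c1] by rewrite /= inE c01.
have [ug sg gR gS dRS] := mp_sets W uc ud uq sc sd eQ erefl erefl nkl.
have := mask_principle bf LL c0 W uc ud uq sc sd eQ erefl erefl nkl (or_introl ST) _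
  (star_pairs_ok false (mask_wits 7 2 1)) isT contradictory_con => /(_ (fun f => False_ind _ (notF f))).
set g := [:: c0; c1] ++ [:: d0] ++ [:: p0; p1; b; z] in ug sg gR gS *.
have M0 : mset g [::] = set0 := mset_nil g.
have MC i s : i < 7 -> mset g (i :: s) = nth c0 g i |: mset g s by exact: (mset_consE c0 ug sg).
have MC1 i s : i < 7 -> mset g (i :: s) = nth c1 g i |: mset g s by exact: (mset_consE c1 ug sg).
have h1 : mset g [:: 3; 4] = P by rewrite !MC // M0 setU0 /= eP.
have h2 : mset g [:: 5; 6] = Q :\: P by rewrite !MC // M0 setU0 /= eZ.
have eR : C :\: [set x in [:: c0; c1]] = C :\ c0 :\ c1 by apply/setP => x; rewrite !inE negb_or andbA [(x != c1) && _]andbC.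
have h3 : (C :\: [set x in [:: c0; c1]]) :|: mset g [:: 0; 1; 3; 4] = C :|: P.
  by rewrite !MC // eR; move: h1; rewrite !MC // => -> /=; have hc := c0C; clear - hc c1C; pt.
have L0 := @mask_lf _ _ _ _ _ _ c0 d0 P 0 2 [:: 0; 1; 3; 4] [:: 3; 4] [:: 5; 6]
  uc ud uq sc sd eQ erefl erefl nkl isT isT erefl erefl isT isT h1 h2 h3.
have L1 := @mask_lf _ _ _ _ _ _ c1 d0 P 1 2 [:: 0; 1; 3; 4] [:: 3; 4] [:: 5; 6]
  uc ud uq sc sd eQ erefl erefl nkl isT isT erefl erefl isT isT h1 h2 h3.
rewrite has_cat => /orP[/hasP[cl /mapP[m ms ->]]|].
  by rewrite /holds /= orbF => /negP[]; move: ms; apply/allP/L0.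
have qe : q \in [:: p0; p1; z].
  by move: qQ; rewrite eQ !inE (negPf qb).
rewrite /= orbF => /or3P[].
- rewrite /holds /= andbT implybF negbK /mval !MC // M0 /= eR => h; case/negP: nb.
  have <- : C :\ c0 :\ c1 :|: (c0 |: (c1 |: (d0 |: (b |: set0)))) = C :|: [set d0; b].
    by have hc := c0C; clear - hc c1C; pt.
  by [].
- rewrite /holds /= orbF => /norP[n1 /norP[n2 n3]].
  move: n1 n2 n3 yb; rewrite /mval !MC // M0 /= eR !setU0.
  have e u : C :\ c0 :\ c1 :|: (c1 |: (d0 |: (b |: [set u]))) = C :\ c0 :|: [set d0; b; u].
    by clear - c1C c01; pt.
  have e' u : C :\ c0 :\ c1 :|: (c1 |: (d0 |: (u |: [set b]))) = C :\ c0 :|: [set d0; b; u].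
    by clear - c1C c01; pt.
  by rewrite e !e'; move: qe; rewrite !inE => /or3P[] /eqP -> n1 n2 n3 y;
    [rewrite y in n1 | rewrite y in n2 | rewrite y in n3].
- by rewrite /holds implybF negbK => /L1.
Qed.

(** Only the exchange of c1 for d1 is at stake; every other exchange for (c1, d1) already occurs for
    (c0, d1) or (c1, d0). *)
Lemma lf_cross c1 d1 : c1 \in C -> d1 \in D -> c0 != c1 -> d0 != d1 ->
  lf E bs C D c0 d1 P -> lf E bs C D c1 d0 P -> d1 |: ((C :|: P) :\ c1) \in bs.
Proof.
move=> c1C d1D c01 d01 lf01 lf10; have [_ _ cQ _] := W.
have [p0 [p1 [z [eP eZ eQ uq]]]] := split_quad cQ PQ cP bQ.
have sc := sub_seq2 c0C c1C; have sd := sub_seq2 d0D d1D.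
have nkl : 8 = 2 + 2 + 4 by [].
have ud : uniq [:: d0; d1] by rewrite /= inE d01. have uc : uniq [:: c0; c1] by rewrite /= inE c01.
have [ug sg gR gS dRS] := mp_sets W uc ud uq sc sd eQ erefl erefl nkl.
have ok : all (star_ok false (mask_wits 8 2 2)) cross_stars by vm_compute.
have := mask_principle bf LL c0 W uc ud uq sc sd eQ erefl erefl nkl (or_introl ST) _
  ok isT contradictory_cross => /(_ (fun f => False_ind _ (notF f))).
set g := [:: c0; c1] ++ [:: d0; d1] ++ [:: p0; p1; b; z] in ug sg gR gS *.
have M0 : mset g [::] = set0 := mset_nil g.
have MC i s : i < 8 -> mset g (i :: s) = nth c0 g i |: mset g s by exact: (mset_consE c0 ug sg).
have h1 : mset g [:: 4; 5] = P by rewrite !MC // M0 setU0 /= eP.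
have h2 : mset g [:: 6; 7] = Q :\: P by rewrite !MC // M0 setU0 /= eZ.
have eR : C :\: [set x in [:: c0; c1]] = C :\ c0 :\ c1 by apply/setP => x; rewrite !inE negb_or andbA [(x != c1) && _]andbC.
have h3 : (C :\: [set x in [:: c0; c1]]) :|: mset g [:: 0; 1; 4; 5] = C :|: P.
  by rewrite !MC // eR; move: h1; rewrite !MC // => -> /=; have hc := c0C; clear - hc c1C; pt.
have L c d i j (li : i < 8) (lj : j < 8) (ec : nth c g i = c) (ed : nth c g j = d) :=
  @mask_lf _ _ _ _ _ _ c d P i j [:: 0; 1; 4; 5] [:: 4; 5] [:: 6; 7]
  uc ud uq sc sd eQ erefl erefl nkl li lj ec ed isT isT h1 h2 h3.
have L00 := L c0 d0 0 2 isT isT erefl erefl.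
have L01 := L c0 d1 0 3 isT isT erefl erefl.
have L10 := L c1 d0 1 2 isT isT erefl erefl.
rewrite !has_cat => /or4P[/hasP[cl /mapP[m ms ->]]|/hasP[cl /mapP[m ms ->]]|/hasP[cl /mapP[m ms ->]]|].
- by rewrite /holds /= orbF => /negP[]; move: ms; apply/allP/L00.
- by rewrite /holds /= orbF => /negP[]; move: ms; apply/allP/L01.
- by rewrite /holds /= orbF => /negP[]; move: ms; apply/allP/L10.
have qe : q \in [:: p0; p1; z].
  by move: qQ; rewrite eQ !inE (negPf qb).
rewrite /= orbF => /or3P[].
- rewrite /holds /= andbT implybF negbK /mval !MC // M0 /= eR => h; case/negP: nb.
  have <- : C :\ c0 :\ c1 :|: (c0 |: (c1 |: (d0 |: (b |: set0)))) = C :|: [set d0; b].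
    by have hc := c0C; clear - hc c1C; pt.
  by [].
- rewrite /holds /= orbF => /norP[n1 /norP[n2 n3]].
  move: n1 n2 n3 yb; rewrite /mval !MC // M0 /= eR !setU0.
  have e u : C :\ c0 :\ c1 :|: (c1 |: (d0 |: (b |: [set u]))) = C :\ c0 :|: [set d0; b; u].
    by clear - c1C c01; pt.
  have e' u : C :\ c0 :\ c1 :|: (c1 |: (d0 |: (u |: [set b]))) = C :\ c0 :|: [set d0; b; u].
    by clear - c1C c01; pt.
  by rewrite e !e'; move: qe; rewrite !inE => /or3P[] /eqP -> n1 n2 n3 y;
    [rewrite y in n1 | rewrite y in n2 | rewrite y in n3].
- rewrite /holds /= andbT implybF negbK /mval !MC // M0 /= eR setU0 => h.
  have c1P : c1 \notin P.
    by apply/negP => /(subsetP PQ); rewrite !inE c1C.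
  have <- : C :\ c0 :\ c1 :|: (c0 |: (d1 |: (p0 |: [set p1]))) = d1 |: (C :|: P) :\ c1.
    by rewrite eP in c1P *; have hc := c0C; clear - hc c1C c01 c1P; pt.
  by [].
Qed.
End ThreeLemmas.
End Local.

(* Self-dual summary of an excluded minor with at least seven elements. *)
Definition good (T : finType) (E : {set T}) (bs : {set {set T}}) (r : nat) : Prop :=
  [/\ basefam E bs r, loopless E bs, star E bs,
      (forall C D : {set T}, wit E bs C D -> [/\ 0 < #|C|, 0 < #|D| & 2 < #|C| + #|D|]) &
      exists (C1 D1 C2 D2 : {set T}) (e : T),
        [/\ wit E bs C1 D1, wit E bs C2 D2, e \in C1 & e \in D2]].

(** The complement of D + x + y is C together with the other two elements of Q. *)
Lemma wit_dual (T : finType) (E : {set T}) bs (C D : {set T}) :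
  wit E bs C D -> wit E (dual_bs E bs) D C.
Proof.
move=> [dCD sCD cQ pair]; split.
- by rewrite disjoint_sym.
- by rewrite setUC.
- by rewrite setUC.
rewrite [D :|: C]setUC => x y xQ yQ xy.
have sxy : [set x; y] \subset E :\: (C :|: D) by rewrite subUset !sub1set xQ.
have /cards2P[u [v [uv e]]] : #|(E :\: (C :|: D)) :\: [set x; y]| == 2.
  by rewrite cardsD (setIidPr sxy) cQ cards2 xy.
have uQ : u \in (E :\: (C :|: D)) :\: [set x; y] by rewrite e !inE eqxx.
have vQ : v \in (E :\: (C :|: D)) :\: [set x; y] by rewrite e !inE eqxx orbT.
have DE : D :|: [set x; y] \subset E by clear - sCD sxy; pt.
rewrite dual_bsP //.
have -> : E :\: (D :|: [set x; y]) = C :|: [set u; v] by rewrite -e; clear - dCD sCD sxy; pt.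
apply: pair => //; [move: uQ | move: vQ]; by rewrite inE => /andP[].
Qed.

Lemma dual_dual (T : finType) (E : {set T}) bs r : basefam E bs r -> dual_bs E (dual_bs E bs) = bs.
Proof.
move=> bf; apply/setP => B; rewrite !inE subsetDl /= setDDr setDv set0U.
case: (boolP (B \in bs)) => bB; first by rewrite (bf_ground bf bB) (setIidPr (bf_ground bf bB)).
by apply/negP => /andP[/setIidPr -> b]; rewrite b in bB.
Qed.

Lemma good_dual (T : finType) (E : {set T}) bs r : good E bs r -> good E (dual_bs E bs) (#|E| - r).
Proof.
move=> [bf [L1 L2] ST SZ [C1 [D1 [C2 [D2 [e [w1 w2 e1 e2]]]]]]].
have wd C D : wit E (dual_bs E bs) C D -> wit E bs D C.
  by move/wit_dual; rewrite (dual_dual bf).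
have dual_complement (X Y : {set T}) : E :\: X = Y -> X \subset E -> Y \in bs -> X \in dual_bs E bs.
  by move=> eX XE bY; rewrite dual_bsP // eX.
split.
- exact: basefam_dual.
- split=> C D x /wd w xin.
    have [q qQ b] := L2 D C x w xin; exists q; first by rewrite setUC.
    move: qQ b; have [dCD sCD _ _] := w => qQ b.
    apply: dual_complement b; last by clear - sCD qQ xin; pt.
    clear - dCD sCD qQ xin; pt.
  have [q qQ b] := L1 D C x w xin; exists q; first by rewrite setUC.
  move: qQ b; have [dCD sCD _ _] := w => qQ b.
  apply: dual_complement b; last by clear - sCD qQ xin; pt.
  by clear - dCD sCD qQ xin; pt.
- move=> C1' D1' C2' D2' u /wd w1' /wd w2' u1 u2.
  have := ST _ _ _ _ u w2' w1' u2 u1.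
  by rewrite setIC [C2' :&: _]setIC => -[].
- by move=> C D /wd /SZ[? ? ?]; split=> //; rewrite addnC.
exists D2, C2, D1, C1, e; split=> //; exact: wit_dual.
Qed.

Lemma freebase_dual (T : finType) (E : {set T}) bs r (X : {set T}) : basefam E bs r ->
  freebase E bs X -> freebase E (dual_bs E bs) (E :\: X).
Proof.
move=> bf [bX fX]; have XE := bf_ground bf bX; split.
  by rewrite dual_bsP ?subsetDl // setDDr setDv set0U (setIidPr XE).
move=> y x; rewrite !inE negb_and negbK => /andP[yX yE] xE; rewrite xE orbF => xX.
rewrite subUset sub1set xE (subset_trans (subsetDl _ _)) ?subsetDl //=.
have -> : E :\: (x |: ((E :\: X) :\ y)) = y |: (X :\ x) by clear - XE yX yE xX; pt.
exact: fX.
Qed.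

(** For a free basis X and y1, y2 outside it, such an X - x1 - x2 + y1 + y2 in [bs] is all that a
    witness around X needs ([sep_wit]). For fixed y1, y2, not being separated is transitive in x
    ([sep_trans]). *)
Definition sep (T : finType) (bs : {set {set T}}) (X : {set T}) x1 x2 y1 y2 :=
  X :\ x1 :\ x2 :|: [set y1; y2] \in bs.

Lemma sepCx (T : finType) (bs : {set {set T}}) X x1 x2 y1 y2 : sep bs X x1 x2 y1 y2 = sep bs X x2 x1 y1 y2.
Proof. by rewrite /sep; congr (_ :|: _ \in bs); apply/setP => z; rewrite !inE andbCA. Qed.

Section Separation.
Variables (T : finType) (E : {set T}) (bs : {set {set T}}) (r : nat) (X : {set T}).
Hypotheses (bf : basefam E bs r) (fX : freebase E bs X).
Local Notation Y := (E :\: X).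
Local Notation sep := (sep bs).

(** Of the six pairs in {x1, x2, y1, y2}, one gives X, four give exchanges of X, and the last is the
    hypothesis. *)
Lemma sep_wit x1 x2 y1 y2 : x1 \in X -> x2 \in X -> x1 != x2 -> y1 \in Y -> y2 \in Y -> y1 != y2 ->
  sep X x1 x2 y1 y2 -> wit E bs (X :\ x1 :\ x2) (Y :\ y1 :\ y2).
Proof.
move=> x1X x2X x12 y1Y y2Y y12 s; have [bX fr] := fX; have XE := bf_ground bf bX.
have nX y : y \in Y -> y \notin X /\ y \in E by rewrite inE => /andP[].
have [n1 e1] := nX _ y1Y; have [n2 e2] := nX _ y2Y.
have eQ : E :\: ((X :\ x1 :\ x2) :|: (Y :\ y1 :\ y2)) = [set x1; x2; y1; y2].
  by clear - x1X x2X XE n1 e1 n2 e2; pt.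
have ne x y : x \in X -> y \notin X -> x != y by move=> xX; apply: contraNneq => <-.
split.
- by clear; pt.
- by clear - XE; pt.
- rewrite eQ -!setUA !cardsU1 cards1 !inE !negb_or x12 y12.
  by rewrite !(ne _ _ x1X) // !(ne _ _ x2X).
rewrite eQ.
have bxx : (X :\ x1 :\ x2) :|: [set x1; x2] \in bs.
  by have -> : (X :\ x1 :\ x2) :|: [set x1; x2] = X by clear - x1X x2X; pt.
have b1 y : y \in Y -> (X :\ x1 :\ x2) :|: [set x1; y] \in bs.
  move=> yY; have [ny ey] := nX _ yY.
  have -> : (X :\ x1 :\ x2) :|: [set x1; y] = y |: (X :\ x2) by clear - x1X x12; pt.
  exact: fr.
have b2 y : y \in Y -> (X :\ x1 :\ x2) :|: [set x2; y] \in bs.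
  move=> yY; have [ny ey] := nX _ yY.
  have -> : (X :\ x1 :\ x2) :|: [set x2; y] = y |: (X :\ x1) by clear - x2X x12; pt.
  exact: fr.
have cs (u v : T) : [set u; v] = [set v; u] by rewrite setUC.
move=> x y; rewrite !inE -!orbA => /or4P[] /eqP -> /or4P[] /eqP -> //; rewrite ?eqxx // => _;
  first [exact: bxx | exact: s | exact: b1 | exact: b2 | by rewrite cs; first [exact: bxx | exact: s | exact: b1 | exact: b2]].
Qed.

(** Extend {y1, y2} to a base inside X + y1 + y2; it misses exactly two elements of X. *)
Lemma sep_base y1 y2 B : y1 \in Y -> y2 \in Y -> y1 != y2 -> B \in bs -> y1 \in B -> y2 \in B ->
  exists x1 x2, [/\ x1 \in X, x2 \in X, x1 != x2 & sep X x1 x2 y1 y2].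
Proof.
move=> y1Y y2Y y12 bB y1B y2B; have [bX fr] := fX.
have [n1 e1] : y1 \notin X /\ y1 \in E by move: y1Y; rewrite inE => /andP[].
have [n2 e2] : y2 \notin X /\ y2 \in E by move: y2Y; rewrite inE => /andP[].
have [|B2 [b2 s2 sB]] := bf_extend bf bB bX (I := [set y1; y2]); first by rewrite subUset !sub1set y1B.
have /cards2P[x1 [x2 [x12 ex]]] : #|X :\: B2| == 2.
  have e : B2 :\: X = [set y1; y2] by clear - s2 sB n1 n2; pt.
  have := cardsID X B2; have := cardsID B2 X; rewrite (setIC B2) e cards2 y12 (bf_card bf bX) (bf_card bf b2).
  by clear; lia.
have x1m : x1 \in X :\: B2 by rewrite ex !inE eqxx.
have x2m : x2 \in X :\: B2 by rewrite ex !inE eqxx orbT.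
exists x1, x2; split=> //; [by move: x1m; rewrite inE => /andP[] | by move: x2m; rewrite inE => /andP[] |].
rewrite /sep; suff -> : X :\ x1 :\ x2 :|: [set y1; y2] = B2 by [].
by clear - ex s2 sB; pt.
Qed.

End Separation.

(** * No parallel pairs, and a free basis around every witness *)

Section Good.
Variables (T : finType) (E : {set T}) (bs : {set {set T}}) (r : nat).
Hypothesis Gd : good E bs r.
Implicit Types (B C D X P : {set T}).

Let bf : basefam E bs r. Proof. by case: Gd. Qed.
Let LL : loopless E bs. Proof. by case: Gd. Qed.
Let ST : star E bs. Proof. by case: Gd. Qed.

Lemma good_covered x : x \in E -> exists2 B, B \in bs & x \in B.
Proof.
move=> xE; have [_ _ _ _ [C [D [_ [_ [_ [w _ _ _]]]]]]] := Gd.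
have [_ _ _ pair] := w.
case: (boolP (x \in D)) => xD.
  have [q _ b] := LL.1 C D x w xD; exists (C :|: [set x; q]) => //; by rewrite !inE eqxx orbT.
have [y yQ xy] := wit_pairs w x; have [z zQ yz] := wit_pairs w y.
case: (boolP (x \in C)) => xC.
  by exists (C :|: [set y; z]); [exact: pair | rewrite inE xC].
exists (C :|: [set x; y]); last by rewrite !inE eqxx orbT.
by apply: pair => //; rewrite !inE negb_or xC xD.
Qed.

Section Parallel.
Variables (d q : T).
Hypotheses (dq : d != q) (dE : d \in E).
Hypothesis no : forall B, B \in bs -> d \in B -> q \in B -> False.

Lemma parallel_swap B : B \in bs -> q \in B -> d |: (B :\ q) \in bs.
Proof.
move=> bB qB; have [B' b' dB'] := good_covered dE.
have dB : d \notin B by apply/negP => dB; exact: no bB dB qB.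
have [|B2 [b2 s2 sB]] := bf_extend bf b' bB (I := [set d]); first by rewrite sub1set.
have [|x xd eB] := subset_card_pred sB.
  by rewrite cardsU1 dB (bf_card bf bB) (bf_card bf b2).
rewrite sub1set in s2.
have xq : x = q.
  apply/eqP/negPn/negP => xq; apply: (no b2 s2).
  by rewrite eB !inE qB eq_sym xq orbT.
suff <- : B2 = d |: (B :\ q) by [].
by rewrite eB xq; have hdq := dq; clear - hdq; pt.
Qed.

(** If q is in C, its parallel element d is a loop of M/C and lies in D. Interchanging the two gives
    a second witness that deletes q; the star condition then leaves C = {q} and D = {d}, which is
    too small. *)
Lemma parallel_notin_con C D : wit E bs C D -> q \notin C.
Proof.
move=> w; apply/negP => qC; have [dCD sCD cQ pair] := w.
have dn : d \notin C :|: (E :\: (C :|: D)).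
  apply/negP => dCQ; have [y yQ dy] := wit_pairs w d; have [z zQ yz] := wit_pairs w y.
  case: (boolP (d \in C)) => dC.
    by apply: (no (pair y z yQ zQ yz)); rewrite inE ?dC ?qC.
  have dQ : d \in E :\: (C :|: D) by move: dCQ; rewrite inE (negPf dC).
  by apply: (no (pair d y dQ yQ dy)); rewrite !inE ?eqxx ?qC ?orbT.
have dD : d \in D by move: dn; rewrite !inE dE; case: (d \in C); case: (d \in D).
have [hdq hqC] := (dq, qC).
have eQ : E :\: ((d |: (C :\ q)) :|: (q |: (D :\ d))) = E :\: (C :|: D).
  by clear - hqC dD; pt.
have w' : wit E bs (d |: (C :\ q)) (q |: (D :\ d)).
  split; rewrite ?eQ //.
  - by clear - hdq dCD hqC dD; pt.
  - by clear - sCD dD hqC; pt.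
  move=> x y xQ yQ xy.
  have -> : (d |: (C :\ q)) :|: [set x; y] = d |: ((C :|: [set x; y]) :\ q).
    by clear - xQ yQ hqC; pt.
  by apply: parallel_swap; [exact: pair | rewrite inE qC].
have [||e1 e2] := ST w w' (u := q); rewrite ?inE ?eqxx //.
have [_ _ SZ] : [/\ 0 < #|C|, 0 < #|D| & 2 < #|C| + #|D|] by case: Gd => _ _ _ sz _; exact: sz w.
have C1 : C \subset [set q] by clear - e1; pt.
have D1 : D \subset [set d] by clear - e2; pt.
by have := subset_leq_card C1; have := subset_leq_card D1; rewrite !cards1; move: SZ; clear; lia.
Qed.
End Parallel.

(** The second witness does not touch d, so q can be replaced by d in D2. Then e still lies in C1
    and in the new deleted set, while d is deleted by both witnesses, against the star condition. *)
Lemma parallel_contra d q C1 D1 C2 D2 e : d != q -> d \in E -> q \in E ->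
  (forall B, B \in bs -> d \in B -> q \in B -> False) ->
  wit E bs C1 D1 -> wit E bs C2 D2 -> e \in C1 -> e \in D2 -> d \in D1 -> q \in D2 -> False.
Proof.
move=> dq dE qE no w1 w2 e1 e2 d1 q2.
have qd : q != d by rewrite eq_sym.
have no' B : B \in bs -> q \in B -> d \in B -> False by move=> bB ? ?; exact: (no B).
have [_ D12] := ST w1 w2 e1 e2.
have d2 : d \notin D2 by apply/negP => h; move/setP/(_ d): D12; rewrite !inE d1 h.
have dC2 := parallel_notin_con qd qE no' w2.
have qC1 := parallel_notin_con dq dE no w1.
have eq : e != q by apply: contraTneq e1 => ->.
have [dCD sCD cQ pair] := w2.
have w' : wit E bs C2 (d |: (D2 :\ q)).
  have qC2 := parallel_notin_con dq dE no w2.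
  have eQ : E :\: (C2 :|: (d |: (D2 :\ q))) = q |: ((E :\: (C2 :|: D2)) :\ d).
    by clear - dq dE qE q2 d2 dC2 qC2; pt.
  have dQ : d \in E :\: (C2 :|: D2) by rewrite !inE negb_or dC2 d2.
  have qQ : q \notin (E :\: (C2 :|: D2)) :\ d by rewrite !inE q2 !orbT andbF.
  split.
  - by clear - dCD dC2; pt.
  - by clear - sCD dE; pt.
  - by rewrite eQ cardsU1 qQ; have := cardsD1 d (E :\: (C2 :|: D2)); rewrite dQ cQ.
  rewrite eQ; have half x : x \in (E :\: (C2 :|: D2)) :\ d -> C2 :|: [set q; x] \in bs.
    move=> xQ; have -> : C2 :|: [set q; x] = q |: ((C2 :|: [set d; x]) :\ d).
      by move: xQ; rewrite !inE => /andP[xd _]; clear - xd dC2; pt.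
    apply: (parallel_swap qd qE no'); last by rewrite !inE eqxx orbT.
    by move: xQ; rewrite in_setD1 => /andP[xd xQ]; apply: pair => //; rewrite eq_sym.
  move=> x y; rewrite !in_setU1 => /orP[/eqP ->|xQ] /orP[/eqP ->|yQ].
  - by rewrite eqxx.
  - by move=> _; exact: half.
  - by move=> _; rewrite [[set x; q]]setUC; exact: half.
  by move: xQ yQ; rewrite !in_setD1 => /andP[_ xQ] /andP[_ yQ]; exact: pair.
have [||_ D12'] := ST w1 w' (u := e); rewrite ?inE ?eq ?e2 ?orbT //.
by move/setP/(_ d): D12'; rewrite !inE d1 eqxx.
Qed.

(** If d and q were parallel, every witness would have to delete one of them. The two given
    witnesses have disjoint deleted sets, so one deletes d and the other q. *)
Lemma good_simple d q : d != q -> d \in E -> q \in E -> exists B, [/\ B \in bs, d \in B & q \in B].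
Proof.
move=> dq dE qE.
case: (boolP [exists B in bs, (d \in B) && (q \in B)]) => [/exists_inP[B bB /andP[dB qB]]|/exists_inPn h].
  by exists B.
have no B : B \in bs -> d \in B -> q \in B -> False by move=> /h + dB qB; rewrite dB qB.
have no' B : B \in bs -> q \in B -> d \in B -> False by move=> bB ? ?; exact: (no B).
have qd : q != d by rewrite eq_sym.
have [_ _ _ _ [C1 [D1 [C2 [D2 [e [w1 w2 e1 e2]]]]]]] := Gd.
have in_D C D : wit E bs C D -> (d \in D) || (q \in D).
  move=> w; have dC := parallel_notin_con qd qE no' w; have qC := parallel_notin_con dq dE no w.
  have [_ _ _ pair] := w; apply/negPn/negP; rewrite negb_or => /andP[dD qD].
  have dQ : d \in E :\: (C :|: D) by rewrite !inE negb_or dC dD.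
  have qQ : q \in E :\: (C :|: D) by rewrite !inE negb_or qC qD.
  by apply: (no _ (pair d q dQ qQ dq)); rewrite !inE eqxx ?orbT.
have [_ D12] := ST w1 w2 e1 e2.
have nD x : x \in D1 -> x \notin D2 by move=> x1; apply/negP => x2; move/setP/(_ x): D12; rewrite !inE x1 x2.
case/orP: (in_D _ _ w1) => h1; have := in_D _ _ w2; rewrite (negPf (nD _ h1)) ?orbF /= => h2.
  by case: (parallel_contra dq dE qE no w1 w2 e1 e2 h1 h2).
by case: (parallel_contra qd qE dE no' w1 w2 e1 e2 h1 h2).
Qed.

Lemma wit_size C D : wit E bs C D -> [/\ 0 < #|C|, 0 < #|D| & 2 < #|C| + #|D|].
Proof. by case: Gd => _ _ _ + _; apply. Qed.

Lemma lf_global C D : wit E bs C D ->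
  exists P, [/\ P \subset E :\: (C :|: D), #|P| = 2 &
    forall c d, c \in C -> d \in D -> lf E bs C D c d P].
Proof.
move=> w; have [/card_gt0P[c cC] /card_gt0P[d0 d0D] ge] := wit_size w.
have [dCD sCD cQ pair] := w.
have [b bQ nb] := line_nonbase bf LL ST w ge cC d0D.
have d0E : d0 \in E by apply: (subsetP sCD); rewrite inE d0D orbT.
have bE : b \in E by move: bQ; rewrite inE => /andP[].
have d0b : d0 != b by apply: contraTneq bQ => <-; rewrite !inE d0D orbT.
have [B [bB dB bB']] := good_simple d0b d0E bE.
have [q qQ bq] := wit_pairs w b.
have [|B2 [b2 s2 sB]] := bf_extend bf bB (pair b q bQ qQ bq) (I := [set d0; b]).
  by rewrite subUset !sub1set dB.
have nCD x : x \in E :\: (C :|: D) -> x \notin C by rewrite !inE negb_or => /andP[/andP[]].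
have d0C : d0 \notin C by have := disjz dCD d0; rewrite d0D andbT.
have sB2 : B2 \subset d0 |: (C :|: [set b; q]) by clear - sB; pt.
have d0n : d0 \notin C :|: [set b; q].
  rewrite !inE !negb_or d0C d0b; apply: contraTneq qQ => <-; by rewrite !inE d0D orbT.
have [|z zB eB] := subset_card_pred sB2.
  by rewrite cardsU1 d0n (bf_card bf b2) (bf_card bf (pair b q bQ qQ bq)).
(* d0 and b lie in a common base, so in one inside C + d0 + b + q, which misses a single element. It
   is neither d0 nor b, nor q because of [nb]; so it lies in C. *)
have [c0 c0C yb] : exists2 c0, c0 \in C & C :\ c0 :|: [set d0; b; q] \in bs.
  have zd : z != d0 by apply: contraTneq s2 => <-; rewrite eB subUset sub1set !inE eqxx.
  have zb : z != b by apply: contraTneq s2 => <-; rewrite eB subUset !sub1set !inE !eqxx /= andbF.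
  case: (eqVneq z q) => zq.
    case/negP: nb; suff <- : B2 = C :|: [set d0; b] by [].
    have nqC := nCD q qQ.
    by rewrite eB zq; rewrite zq in zd zb; clear - nqC zd zb; pt.
  have zC : z \in C.
    by move: zB; rewrite !inE (negPf zd) (negPf zb) (negPf zq) /= orbF => /andP[].
  exists z => //; suff <- : B2 = C :\ z :|: [set d0; b; q] by [].
  by rewrite eB; clear - zd zb zq; pt.
have [P [PQ cP lf0]] := lf_ex bf LL ST w ge c0C d0D.
(* Otherwise exchanging the other element of P for d0 would make C + d0 + b a base. *)
have bP : b \notin P.
  apply/negP => bP; have := cardsD1 b P; rewrite bP cP add1n => -[/esym/eqP/cards1P[b' eb']].
  have b'P : b' \in P :\ b by rewrite eb' inE.
  case/negP: nb; have := lf0 b' d0; rewrite !inE eqxx (_ : b' \in P); last by move: b'P; rewrite inE => /andP[].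
  rewrite orbT => /(_ isT isT).
  have b'C : b' \notin C by apply: nCD; apply: (subsetP PQ); move: b'P; rewrite inE => /andP[].
  have -> // : d0 |: ((C :|: P) :\ b') = C :|: [set d0; b].
  by clear - eb' bP b'C; pt.
have bQP : b \in (E :\: (C :|: D)) :\: P by rewrite inE bP.
have qb : q != b by rewrite eq_sym.
have lfd d : d \in D -> lf E bs C D c0 d P.
  move=> dD; case: (eqVneq d0 d) => [<- //|dd].
  exact: (lf_del bf LL ST w c0C d0D PQ cP bQP qQ qb nb yb lf0).
have lfc c1 : c1 \in C -> lf E bs C D c1 d0 P.
  move=> c1C; case: (eqVneq c0 c1) => [<- //|cc].
  exact: (lf_con bf LL ST w c0C d0D PQ cP bQP qQ qb nb yb lf0).
exists P; split=> // c1 d1 c1C d1D.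
case: (eqVneq c0 c1) => [<-|cc]; first exact: lfd.
case: (eqVneq d0 d1) => [<-|dd]; first exact: lfc.
move=> x y; rewrite !in_setU1 => /orP[/eqP ->|xP] /orP[/eqP ->|yQ].
- exact: (lf_cross bf LL ST w c0C d0D PQ cP bQP qQ qb nb yb lf0 c1C d1D cc dd (lfd _ d1D) (lfc _ c1C)).
- by apply: (lfc _ c1C); rewrite in_setU1 ?eqxx ?yQ ?orbT.
- by apply: (lfd _ d1D); rewrite in_setU1 ?eqxx ?xP ?orbT.
by apply: (lfd _ d1D); rewrite in_setU1 ?yQ ?xP ?orbT.
Qed.

Lemma wit_free C D : wit E bs C D ->
  exists X, [/\ freebase E bs X, C \subset X & [disjoint X & D]].
Proof.
move=> w; have [P [PQ cP lfP]] := lf_global w.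
have [/card_gt0P[c cC] /card_gt0P[d dD] _] := wit_size w.
have [dCD sCD cQ pair] := w.
exists (C :|: P); split; [|exact: subsetUl|]; last by clear - dCD PQ; pt.
have /eqP/cards2P[p0 [p1 [p01 eP]]] := cP.
split.
  by rewrite eP; apply: pair => //; apply: (subsetP PQ); rewrite eP !inE eqxx ?orbT.
move=> x y xX yE yX.
have [c' c'C xc'] : exists2 c', c' \in C & x \in c' |: P.
  case: (boolP (x \in C)) xX => [xC _|xC]; first by exists x; rewrite // !inE eqxx.
  by rewrite inE (negPf xC) /= => xP; exists c; rewrite // inE xP orbT.
have [d' d'D yd'] : exists2 d', d' \in D & y \in d' |: ((E :\: (C :|: D)) :\: P).
  case: (boolP (y \in D)) => yD; first by exists y; rewrite // !inE eqxx.
  exists d => //; move: yX; rewrite !inE !negb_or yE yD => /andP[-> ->]; by rewrite orbT.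
exact: (lfP c' d' c'C d'D x y xc' yd').
Qed.

Local Notation sep := (sep bs).

(** * Witnesses around a free basis *)

Section AroundFree.
Variable X : {set T}.
Hypothesis fX : freebase E bs X.
Local Notation Y := (E :\: X).

(** In the witness obtained from y1 and y2, the deleted y3 would form a base with C and any element
    of Q, against [line_nonbase]. *)
Lemma no3sep x1 x2 y1 y2 y3 : x1 \in X -> x2 \in X -> x1 != x2 ->
  y1 \in Y -> y2 \in Y -> y3 \in Y -> y1 != y2 -> y1 != y3 -> y2 != y3 ->
  sep X x1 x2 y1 y2 -> sep X x1 x2 y1 y3 -> sep X x1 x2 y2 y3 -> False.
Proof.
move=> x1X x2X x12 y1Y y2Y y3Y y12 y13 y23 s12 s13 s23.
have w := sep_wit bf fX x1X x2X x12 y1Y y2Y y12 s12.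
have [/card_gt0P[c cC] _ ge] := wit_size w.
have y3D : y3 \in Y :\ y1 :\ y2 by rewrite !in_setD1 (eq_sym y3 y2) (eq_sym y3 y1) y13 y23.
have [q qQ /negP[]] := line_nonbase bf LL ST w ge cC y3D.
have [bX fr] := fX; have XE := bf_ground bf bX.
have [n3 e3] : y3 \notin X /\ y3 \in E by move: y3Y; rewrite inE => /andP[].
have : q \in [set x1; x2; y1; y2].
  move: qQ; clear - x1X x2X XE => qQ; pt_at q.
rewrite !inE -!orbA => /or4P[] /eqP ->.
- have -> : (X :\ x1 :\ x2) :|: [set y3; x1] = y3 |: (X :\ x2) by clear - x1X x12; pt.
  exact: fr.
- have -> : (X :\ x1 :\ x2) :|: [set y3; x2] = y3 |: (X :\ x1) by clear - x2X x12; pt.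
  exact: fr.
- by rewrite setUC [[set y3; y1]]setUC setUC.
by rewrite setUC [[set y3; y2]]setUC setUC.
Qed.

(** Exchange x2 out of X - x1 - x3 + y1 + y2 against the base X - x2 + y1; the element coming in is
    x1 or x3. *)
Lemma sep_trans x1 x2 x3 y1 y2 : x1 \in X -> x2 \in X -> x3 \in X -> x1 != x2 -> x2 != x3 ->
  x1 != x3 -> y1 \in Y -> y2 \in Y -> sep X x1 x3 y1 y2 -> sep X x1 x2 y1 y2 || sep X x2 x3 y1 y2.
Proof.
move=> x1X x2X x3X x12 x23 x13 y1Y y2Y s; have [bX fr] := fX.
have [n1 e1] : y1 \notin X /\ y1 \in E by move: y1Y; rewrite inE => /andP[].
have [n2 e2] : y2 \notin X /\ y2 \in E by move: y2Y; rewrite inE => /andP[].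
have ne x y : x \in X -> y \notin X -> x != y by move=> xX; apply: contraNneq => <-.
have b2 : y1 |: (X :\ x2) \in bs by exact: fr.
have [||u [u2 u1 bB]] := bf_exchange bf s b2 (x := x2).
- by rewrite !inE x2X x23 (eq_sym x2) x12.
- by rewrite !inE eqxx orbF ne.
have [[h12 h13] h23] := (x12, x13, x23).
have : (u == x1) || (u == x3).
  by clear - u2 u1; pt_at u.
case/orP => /eqP eu; rewrite /sep.
  rewrite eu in bB; apply/orP; right.
  have <- // : x1 |: ((X :\ x1 :\ x3 :|: [set y1; y2]) :\ x2) = X :\ x2 :\ x3 :|: [set y1; y2].
  have [a1 a2] := (ne _ _ x2X n1, ne _ _ x2X n2); clear - x1X h12 h13 h23 a1 a2; pt.
rewrite eu in bB; apply/orP; left.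
have <- // : x3 |: ((X :\ x1 :\ x3 :|: [set y1; y2]) :\ x2) = X :\ x1 :\ x2 :|: [set y1; y2].
have [a1 a2] := (ne _ _ x2X n1, ne _ _ x2X n2); clear - x3X h12 h13 h23 a1 a2; pt.
Qed.

Lemma sep_ex y1 y2 : y1 \in Y -> y2 \in Y -> y1 != y2 ->
  exists x1 x2, [/\ x1 \in X, x2 \in X, x1 != x2 & sep X x1 x2 y1 y2].
Proof.
move=> y1Y y2Y y12.
have [e1 e2] : y1 \in E /\ y2 \in E by move: y1Y y2Y; rewrite !inE => /andP[_ ->] /andP[_ ->].
by have [B [bB y1B y2B]] := good_simple y12 e1 e2; exact: (sep_base bf fX y1Y y2Y y12 bB).
Qed.

Hypotheses (cX : 2 < #|X|) (cY : 3 < #|Y|).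

Lemma card_gt_ex (A : {set T}) n : n < #|A| -> forall s : seq T, size s <= n -> exists2 x, x \in A & x \notin s.
Proof.
move=> lt s ss; have /card_gt0P[x] : 0 < #|A :\: [set x in s]|.
  have : #|A :&: [set x in s]| <= size s.
    by apply: leq_trans (subset_leq_card (subsetIr _ _)) _; rewrite cardsE; exact: card_size.
  by have := cardsID [set x in s] A; move: lt ss; clear; lia.
by rewrite !inE => /andP[xs xA]; exists x.
Qed.

(** If there is no such witness, every separation by a pair of Y - u involves a, and by [sep_trans]
    each such pair separates a from every other x. Three elements of Y - u then contradict [no3sep];
    this is why Y needs four elements. *)
Lemma wit_around a u : a \in X -> u \in Y -> exists C D, [/\ wit E bs C D, a \in C & u \in D].
Proof.
move=> aX uY.
pose ok := [exists x1 in X :\ a, exists x2 in X :\ a, exists y1 in Y :\ u, exists y2 in Y :\ u,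
  [&& x1 != x2, y1 != y2 & sep X x1 x2 y1 y2]].
have okP x1 x2 y1 y2 : x1 \in X -> x2 \in X -> x1 != x2 -> x1 != a -> x2 != a ->
    y1 \in Y -> y2 \in Y -> y1 != y2 -> y1 != u -> y2 != u -> sep X x1 x2 y1 y2 -> ok.
  move=> x1X x2X x12 x1a x2a y1Y y2Y y12 y1u y2u s.
  apply/exists_inP; exists x1; first by rewrite in_setD1 x1a.
  apply/exists_inP; exists x2; first by rewrite in_setD1 x2a.
  apply/exists_inP; exists y1; first by rewrite in_setD1 y1u.
  apply/exists_inP; exists y2; first by rewrite in_setD1 y2u.
  by rewrite x12 y12.
suff : ok.
  case/exists_inP => x1; rewrite in_setD1 => /andP[x1a x1X] /exists_inP[x2].
  rewrite in_setD1 => /andP[x2a x2X] /exists_inP[y1]; rewrite in_setD1 => /andP[y1u y1Y].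
  case/exists_inP => y2; rewrite in_setD1 => /andP[y2u y2Y] /and3P[x12 y12 s].
  exists (X :\ x1 :\ x2), (Y :\ y1 :\ y2); split; first exact: (sep_wit bf fX).
    by rewrite !in_setD1 !(eq_sym a) x1a x2a.
  by rewrite !in_setD1 !(eq_sym u) y1u y2u.
case: (boolP ok) => // nok; exfalso.
have sepa x y1 y2 : x \in X -> x != a -> y1 \in Y -> y2 \in Y -> y1 != y2 -> y1 != u -> y2 != u ->
    sep X a x y1 y2.
  move=> xX xa y1Y y2Y y12 y1u y2u.
  have one z : z \in X -> z != a -> sep X a z y1 y2 -> sep X a x y1 y2.
    move=> zX za s; case: (eqVneq x z) => [-> //|xz].
    have az : a != z by rewrite eq_sym. have ax : a != x by rewrite eq_sym.
    case/orP: (sep_trans aX xX zX ax xz az y1Y y2Y s) => // s'.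
    by case/negP: nok; exact: (okP x z y1 y2).
  have [x1 [x2 [x1X x2X x12 s]]] := sep_ex y1Y y2Y y12.
  case: (eqVneq x1 a) => [e|x1a].
    by apply: (one x2) => //; [rewrite -e eq_sym | rewrite -e].
  case: (eqVneq x2 a) => [e|x2a].
    by apply: (one x1) => //; rewrite sepCx -e.
  by case/negP: nok; exact: (okP x1 x2 y1 y2).
have [x xX xa] : exists2 x, x \in X & x \notin [:: a] by apply: (card_gt_ex (n := 1)) => //; exact: ltnW.
have [y1 y1Y n1] := card_gt_ex cY (s := [:: u]) isT.
have [y2 y2Y n2] := card_gt_ex cY (s := [:: u; y1]) isT.
have [y3 y3Y n3] := card_gt_ex cY (s := [:: u; y1; y2]) isT.
move: xa n1 n2 n3; rewrite !inE !negb_or => xa n1 /andP[n2 n21] /and3P[n3 n31 n32].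
have ax : a != x by rewrite eq_sym.
by apply: (no3sep aX xX ax y1Y y2Y y3Y); rewrite 1?eq_sym //; apply: sepa => //; rewrite eq_sym.
Qed.

Lemma wit_deleting b v : b \in Y -> v \in Y -> exists C D, [/\ wit E bs C D, b \in D & v \in D].
Proof.
move=> bY vY.
have [y1 y1Y n1] := card_gt_ex cY (s := [:: b; v]) isT.
have [y2 y2Y n2] := card_gt_ex cY (s := [:: b; v; y1]) isT.
move: n1 n2; rewrite !inE !negb_or => /andP[n1b n1v] /and3P[n2b n2v n21].
have y12 : y1 != y2 by rewrite eq_sym.
have [x1 [x2 [x1X x2X x12 s]]] := sep_ex y1Y y2Y y12.
exists (X :\ x1 :\ x2), (Y :\ y1 :\ y2); split; first exact: (sep_wit bf fX).
  by rewrite !in_setD1 !(eq_sym b) n1b n2b.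
by rewrite !in_setD1 !(eq_sym v) n1v n2v.
Qed.
End AroundFree.

(** Let v be in X2 - X1. A witness around X1 deletes b and v, and one around X2 contracts v and
    deletes b; sharing b violates the star condition. *)
Lemma free_meet_del X1 X2 b : freebase E bs X1 -> freebase E bs X2 -> 2 < #|X1| -> 3 < #|E :\: X1| ->
  b \in E -> b \notin X1 -> b \notin X2 -> X1 = X2.
Proof.
move=> f1 f2 c1 cY bE b1 b2; have [bX1 _] := f1; have [bX2 _] := f2.
apply/eqP; rewrite eq_sym eqEcard (bf_card bf bX1) (bf_card bf bX2) leqnn andbT.
apply/subsetP => v v2; apply/negPn/negP => v1.
have vE := subsetP (bf_ground bf bX2) v v2.
have b1Y : b \in E :\: X1 by rewrite inE b1. have v1Y : v \in E :\: X1 by rewrite inE v1.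
have b2Y : b \in E :\: X2 by rewrite inE b2.
have cY2 : 3 < #|E :\: X2|.
  move: cY; rewrite !cardsD !(setIidPr _) ?(bf_ground bf bX1) ?(bf_ground bf bX2) //.
  by rewrite (bf_card bf bX1) (bf_card bf bX2).
have c2 : 2 < #|X2| by rewrite (bf_card bf bX2) -(bf_card bf bX1).
have [C1 [D1 [w1 bD1 vD1]]] := wit_deleting f1 cY b1Y v1Y.
have [C2 [D2 [w2 vC2 bD2]]] := wit_around f2 c2 cY2 v2 b2Y.
have [_ /setP/(_ b)] := ST w2 w1 vC2 vD1.
by rewrite !inE bD1 bD2.
Qed.
End Good.

Lemma freebase_unique (T : finType) (E : {set T}) bs r (X1 X2 : {set T}) : good E bs r ->
  freebase E bs X1 -> freebase E bs X2 -> X1 = X2 \/ X2 = E :\: X1.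
Proof.
move=> Gd f1 f2; have [bf _ _ SZ [C [D [_ [_ [_ [w _ _ _]]]]]]] := Gd.
have [C0 D0 CD] := SZ _ _ w.
have [bX1 _] := f1; have [bX2 _] := f2.
have XE1 := bf_ground bf bX1; have XE2 := bf_ground bf bX2.
have [cr cE] := wit_cards bf w; rewrite addn2 in cr.
have cX1 := bf_card bf bX1; have cX2 := bf_card bf bX2.
have cY1 : #|E :\: X1| = #|D|.+2 by rewrite cardsD (setIidPr XE1) cX1 cr cE; clear; lia.
have cY2 : #|E :\: X2| = #|D|.+2 by rewrite cardsD (setIidPr XE2) cX2 cr cE; clear; lia.
have beta b : 1 < #|D| -> b \in (E :\: X1) :&: (E :\: X2) -> X1 = X2.
  move=> l2; rewrite !inE => /andP[/andP[b1 bE] /andP[b2 _]].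
  apply: (free_meet_del Gd f1 f2 _ _ bE b1 b2); rewrite ?cX1 ?cY1 ?cr //; lia.
have alpha a : 1 < #|C| -> a \in X1 :&: X2 -> X1 = X2.
  move=> k2; rewrite inE => /andP[a1 a2].
  have aE := subsetP XE1 a a1.
  have e12 : E :\: X1 = E :\: X2.
    apply: (free_meet_del (good_dual Gd) (freebase_dual bf f1) (freebase_dual bf f2) _ _ aE).
    - by rewrite cY1; lia.
    - by rewrite setDDr setDv set0U (setIidPr XE1) cX1 cr; lia.
    - by rewrite inE a1.
    - by rewrite inE a2.
  by rewrite -(setIidPr XE1) -(setIidPr XE2) -[in LHS](set0U (E :&: X1)) -(setDv E) -setDDr e12 setDDr setDv set0U.
case: (eqVneq X1 X2) => [|ne]; first by left.
right; apply/eqP; rewrite eqEcard cY1 cX2 cr.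
(* Links the common elements of the two bases to those of the complements: when only one of [alpha]
   and [beta] is available, a common element on one side yields one on the other. *)
have cI : #|X1 :&: X2| + #|D| = #|(E :\: X1) :&: (E :\: X2)| + #|C|.
  have -> : (E :\: X1) :&: (E :\: X2) = E :\: (X1 :|: X2) by rewrite setDUr.
  have sU : X1 :|: X2 \subset E by rewrite subUset XE1.
  rewrite cardsD (setIidPr sU) cardsU cX1 cX2 cr cE.
  have := subset_leq_card (subsetIl X1 X2); have := subset_leq_card sU; rewrite cardsU cX1 cX2 cr cE.
  by clear; lia.
have nI : #|X1 :&: X2| = 0.
  apply/eqP/negPn/negP; rewrite -lt0n => gt; have /card_gt0P[a aI] := gt.
  case: (ltnP 1 #|C|) => k2; first by case/eqP: ne; exact: alpha aI.
  have /card_gt0P[b bI] : 0 < #|(E :\: X1) :&: (E :\: X2)| by lia.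
  by case/eqP: ne; apply: beta bI; lia.
have nJ : #|(E :\: X1) :&: (E :\: X2)| = 0.
  apply/eqP/negPn/negP; rewrite -lt0n => gt; have /card_gt0P[b bI] := gt.
  case: (ltnP 1 #|D|) => l2; first by case/eqP: ne; exact: beta bI.
  by move: cI; rewrite nI; lia.
move/eqP: nI; rewrite cards_eq0 => /eqP nI.
have -> : #|D|.+2 <= #|C|.+2 by move: cI; rewrite nJ nI cards0; lia.
by rewrite andbT; clear - nI XE2; pt.
Qed.

Theorem good_structure (T : finType) (E : {set T}) bs r : good E bs r ->
  exists X : {set T}, [/\ freebase E bs X, freebase E bs (E :\: X) &
    forall C D, wit E bs C D -> (C \subset X) && [disjoint X & D] \/
                               (C \subset E :\: X) && [disjoint E :\: X & D]].
Proof.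
move=> Gd; have [bf _ _ _ [C1 [D1 [C2 [D2 [e [w1 w2 e1 e2]]]]]]] := Gd.
have [X [fX CX dX]] := wit_free Gd w1; have [X2 [fX2 CX2 dX2]] := wit_free Gd w2.
have eX2 : X2 = E :\: X.
  case: (freebase_unique Gd fX fX2) => // eX.
  (* The two free bases differ because e is in C1, hence in X, while X2 avoids D2, which contains
     e. *)
  by have := disjz dX2 e; rewrite -eX (subsetP CX) // e2.
exists X; split=> //; first by rewrite -eX2.
move=> C D /(wit_free Gd)[X3 [fX3 CX3 dX3]].
by case: (freebase_unique Gd fX fX3) => e3; [left; rewrite e3 CX3 | right; rewrite -e3 CX3].
Qed.

(** * Undoing the two relaxations *)

Lemma fundamental_circuit (T : finType) (M : mat T) (B : {set T}) x y : is_matroid M ->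
  B \in bases M -> y \in ground M -> y \notin B -> x \in B -> y |: (B :\ x) \in indep M ->
  exists C : {set T}, circuit M C /\ x \in C /\ y \in C.
Proof.
move=> Mm /basesP[BI cB] yE yB xB bI.
pose dep (C : {set T}) := (C \subset y |: B) && (C \notin indep M).
have dep0 : dep (y |: B).
  rewrite /dep subxx; apply/negP => i.
  by have := rk_ub i (indep_ground Mm i); rewrite -cB cardsU1 yB ltnn.
have [C /minsetP[/andP[CS CI] min] _] := minset_exists dep0.
exists C; split; [apply/and3P; split=> // | split].
- by apply: subset_trans CS _; rewrite subUset sub1set yE (indep_ground Mm BI).
- apply/forall_inP => z zC; apply/negPn/negP => h.
  have : C :\ z = C by apply: min; rewrite ?subsetDl // /dep h (subset_trans (subsetDl _ _) CS).
  by move/setP/(_ z); rewrite !inE eqxx zC.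
- apply/negPn/negP => xC; case/negP: CI; apply: indepS bI => //.
  by clear - CS xC; pt.
apply/negPn/negP => yC; case/negP: CI; apply: indepS BI => //.
by clear - CS yC; pt.
Qed.

Section CircuitHyperplane.
Variables (T : finType) (E : {set T}) (bs : {set {set T}}) (r : nat) (X : {set T}).
Hypothesis bf : basefam E bs r.
Hypotheses (XE : X \subset E) (cX : #|X| = r) (nX : X \notin bs) (X0 : X != set0) (XnE : E :\: X != set0).
Hypothesis fr : forall x y, x \in X -> y \in E -> y \notin X -> y |: (X :\ x) \in bs.
Local Notation M := (mat_of_bases E bs).

(** An exchange with an outside element shows that each X - x is independent and that X + e has full
    rank; X itself is no base, so its rank is r - 1. *)
Lemma circuit_hyperplane_of_free : circuit_hyperplane M X.
Proof.
have [x0 x0X] := set0Pn _ X0; have [y0] := set0Pn _ XnE; rewrite inE => /andP[y0X y0E].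
have Mm := mat_of_bases_matroid bf.
have Xdep : X \notin indep M.
  apply/mat_of_basesP => -[B bB XB]; case/negP: nX.
  by have /eqP -> : X == B by rewrite eqEcard XB cX (bf_card bf bB) leqnn.
have XxI x : x \in X -> X :\ x \in indep M.
  by move=> xX; apply/mat_of_basesP; exists (y0 |: (X :\ x)); [exact: fr | exact: subsetUr].
apply/andP; split; apply/and3P; split=> //.
- by apply/forall_inP => x xX; exact: XxI.
- rewrite (mat_of_bases_rk bf) addn1 eqn_leq; apply/andP; split.
    have [Z [ZI ZX <-]] := rk_ex Mm X; rewrite -cX proper_card // properEneq ZX andbT.
    by apply: contraNneq Xdep => <-.
  rewrite -cX (cardsD1 x0 X) x0X add1n ltnS.
  by apply: rk_ub; [exact: XxI | exact: subsetDl].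
apply/forall_inP => e; rewrite inE => /andP[eX eE]; rewrite (mat_of_bases_rk bf) eqn_leq.
have bE := fr x0X eE eX; apply/andP; split.
  have [Z [/mat_of_basesP[B bB ZB] _ <-]] := rk_ex Mm (e |: X).
  by rewrite -(bf_card bf bB) subset_leq_card.
rewrite -(bf_card bf bE); apply: rk_ub; last by clear; pt.
by apply/mat_of_basesP; exists (e |: (X :\ x0)).
Qed.
End CircuitHyperplane.

Lemma good_inD (T : finType) (M : mat T) : is_matroid M ->
  good (ground M) (bases M) (rk M (ground M)) -> inD M.
Proof.
move=> Mm Gd; set E := ground M in Gd *; set r := rk M E in Gd *.
have [bs ebs] : exists bs, bs = bases M by exists (bases M).
rewrite -ebs in Gd.
have bf : basefam E bs r by case: Gd.
have indep_bs Z : (Z \in indep M) <-> exists2 B : {set T}, B \in bs & Z \subset B by rewrite ebs; exact: indep_base.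
have [X [fX fY near]] := good_structure Gd.
have [Y eY] : exists Y, Y = E :\: X by exists (E :\: X).
rewrite -eY in fY near.
have [bX frX] := fX; have [bY frY] := fY.
have XE := bf_ground bf bX; have YE := bf_ground bf bY.
have cX := bf_card bf bX; have cY := bf_card bf bY.
have r3 : 2 < r.
  have [_ _ _ SZ [C [D [_ [_ [_ [w _ _ _]]]]]]] := Gd.
  have [C0 _ _] := SZ _ _ w; have [-> _] := wit_cards bf w; by move: C0; clear; lia.
have inY y : (y \in Y) = (y \notin X) && (y \in E) by rewrite eY inE.
have dXY : [disjoint X & Y] by rewrite eY; clear; pt.
have EXY : X :|: Y = E by rewrite eY; clear - XE; pt.
pose bs2 := bs :\ X :\ Y.
have notXY (B : {set T}) x y : x \in X -> y \in Y -> x \in B -> y \in B -> B \in bs -> B \in bs2.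
  move=> xX yY xB yB bB; rewrite !in_setD1 bB andbT; apply/andP; split.
    by apply: contraTneq xX => e; rewrite e inY in xB; case/andP: xB.
  by apply: contraTneq yB => ->; move: yY; rewrite inY => /andP[].
have other (A : {set T}) x : #|A| = r -> exists2 x', x' \in A & x' != x.
  move=> cA; have := card_gt_ex (_ : 1 < #|A|) (s := [:: x]); rewrite cA.
  by case=> [||x' ? ]; [exact: ltnW | | rewrite inE; exists x'].
have frX2 x y : x \in X -> y \in E -> y \notin X -> y |: (X :\ x) \in bs2.
  move=> xX yE yX; have [x' x'X x'x] := other X x cX.
  by apply: (notXY _ x' y) (frX x y xX yE yX); rewrite ?inY ?inE ?yX ?yE ?x'x ?x'X ?eqxx ?orbT.
have frY2 x y : x \in Y -> y \in E -> y \notin Y -> y |: (Y :\ x) \in bs2.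
  move=> xY yE yY; have [x' x'Y x'x] := other Y x cY.
  have yX : y \in X by move: yY; rewrite inY yE andbT negbK.
  apply: (notXY _ y x') (frY x y xY yE yY) => //; rewrite in_setU1 ?eqxx //.
  by rewrite in_setD1 x'x x'Y orbT.
have [x0 x0X] : exists x, x \in X by have /card_gt0P[x xX] : 0 < #|X| by [rewrite cX; lia]; exists x.
have [y0 y0Y] : exists x, x \in Y by have /card_gt0P[x xX] : 0 < #|Y| by [rewrite cY; lia]; exists x.
have y0E := subsetP YE y0 y0Y; have x0E := subsetP XE x0 x0X.
have y0X : y0 \notin X by move: y0Y; rewrite inY => /andP[].
have x0Y : x0 \notin Y by rewrite inY x0X.
have XY : X != Y by apply: contraNneq x0Y => <-.
have bf1 : basefam E (bs :\ X) r.
  by apply: basefam_remove_free => //; exists Y; rewrite // eq_sym.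
have fY1 : freebase E (bs :\ X) Y.
  split; first by rewrite !inE eq_sym XY.
  by move=> x y xY yE yY; have := frY2 x y xY yE yY; rewrite in_setD1 => /andP[].
have bf2 : basefam E bs2 r.
  apply: basefam_remove_free => //; exists (y0 |: (X :\ x0)).
    by have := frX2 x0 y0 x0X y0E y0X; rewrite in_setD1 => /andP[].
  by have := frX2 x0 y0 x0X y0E y0X; rewrite in_setD1 => /andP[].
set N := mat_of_bases E bs2.
have Nm : is_matroid N := mat_of_bases_matroid bf2.
have bN : bases N = bs2 := bases_mat_of_bases bf2.
have nX2 : X \notin bs2 by rewrite !inE eqxx andbF.
have nY2 : Y \notin bs2 by rewrite !inE eqxx.
have X0 : X != set0 by apply/set0Pn; exists x0.
have Y0 : Y != set0 by apply/set0Pn; exists y0.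
have hX : circuit_hyperplane N X by apply: (circuit_hyperplane_of_free bf2) => //; rewrite -eY.
have hY : circuit_hyperplane N Y.
  apply: (circuit_hyperplane_of_free bf2) => //; rewrite eY setDDr setDv set0U (setIidPr XE) //.
(* The circuit is the fundamental one of y in X - x' + y', where x' is separated from x by y and y'.
   Exchanging x for y gives X - x - x' + y + y', which still contains some x'' of X as r > 2, so it
   was not removed as Y. *)
have cross x y : x \in X -> y \in Y -> exists C : {set T}, circuit N C /\ x \in C /\ y \in C.
  move=> xX yY; have [y' y'Y y'y] := other Y y cY.
  have [yE y'E] := (subsetP YE y yY, subsetP YE y' y'Y).
  have yX : y \notin X by move: yY; rewrite inY => /andP[].
  have y'X : y' \notin X by move: y'Y; rewrite inY => /andP[].
  have yy' : y != y' by rewrite eq_sym.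
  have [x' [x'X xx' s]] : exists x', [/\ x' \in X, x != x' & sep bs X x x' y y'].
    have [yZ y'Z] : y \in E :\: X /\ y' \in E :\: X by rewrite -eY.
    have [x1 [x2 [x1X x2X x12 s]]] := sep_ex Gd fX yZ y'Z yy'.
    case: (eqVneq x x1) => [->|x1x]; first by exists x2.
    case: (eqVneq x x2) => [->|x2x]; first by exists x1; rewrite sepCx eq_sym.
    have x1x' : x1 != x by rewrite eq_sym.
    case/orP: (sep_trans Gd fX x1X xX x2X x1x' x2x x12 yZ y'Z s) => s'; last by exists x2.
    by exists x1; rewrite sepCx.
  have xx'' : x' != x by rewrite eq_sym.
  have bB : y' |: (X :\ x') \in bases N by rewrite bN; apply: frX2.
  apply: (fundamental_circuit Nm bB yE).
  - by rewrite !inE (negPf yy') (negPf yX) andbF.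
  - by rewrite !inE xx' xX orbT.
  apply/(indep_base Nm); exists (y |: ((y' |: (X :\ x')) :\ x)) => //; rewrite bN.
  have ltX : 2 < #|X| by rewrite cX.
  have [x'' x''X nx] := card_gt_ex ltX (s := [:: x; x']) isT.
  have /andP[n1 n2] : (x'' != x) && (x'' != x') by move: nx; rewrite !inE negb_or.
  apply: (notXY _ x'' y) => //; rewrite ?in_setU1 ?eqxx //.
    by rewrite !inE n1 n2 x''X !orbT.
  have -> // : y |: ((y' |: (X :\ x')) :\ x) = X :\ x :\ x' :|: [set y; y'].
  have xy' : x != y' by apply: contraNneq y'X => <-.
  by clear - xy'; pt.
have [cirX _] := andP hX; have [cirY _] := andP hY.
exists N, X, Y; split.
- split=> // x y xE yE xy.
  have side z : z \in E -> (z \in X) || (z \in Y) by rewrite -EXY inE.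
  case/orP: (side x xE) => hx; case/orP: (side y yE) => hy.
  + by exists X.
  + exact: cross.
  + by have [C [cC [h1 h2]]] := cross y x hy hx; exists C.
  by exists Y.
(* A witness of the smaller family is one of [bs], so it lies around X or Y. Then X or Y would be C
   plus a pair of Q, hence a base of N. *)
- have [B bB] := base_ex Nm; apply: (binary_of_no_wit Nm bB) => C D; rewrite bN => w.
  have w' : wit E bs C D.
    case: w => [dCD sCD cQ pair]; split=> // x y xQ yQ xy.
    by have := pair x y xQ yQ xy; rewrite !in_setD1 => /and3P[].
  have [dCD sCD cQ pair] := w.
  have notv (Z : {set T}) : Z \subset E -> #|Z| = r -> C \subset Z -> [disjoint Z & D] -> Z \in bs2.
    move=> ZE cZ CZ dZ.
    have [cC _] := wit_cards bf w'.
    have /cards2P[a [b [ab eab]]] : #|Z :\: C| == 2 by rewrite cardsD (setIidPr CZ) cZ cC; apply/eqP; clear; lia.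
    have aZ : a \in Z :\: C by rewrite eab !inE eqxx.
    have bZ : b \in Z :\: C by rewrite eab !inE eqxx orbT.
    have -> : Z = C :|: [set a; b] by rewrite -eab; clear - CZ; pt.
    apply: pair => //; [clear - ZE aZ dZ; pt_at a | clear - ZE bZ dZ; pt_at b].
  case: (near C D w') => /andP[CZ dZ].
    by case/negP: nX2; exact: notv.
  by case/negP: nY2; exact: notv.
- by split.
- by split.
apply: mat_eq => //=; apply/setP => Z; rewrite bN.
have -> : bs2 :|: [set X; Y] = bs.
  apply/setP => B; rewrite !inE; case: (eqVneq B X) => [->|]; first by rewrite bX orbT.
  by case: (eqVneq B Y) => [->|]; rewrite ?bY ?orbT ?orbF.
rewrite inE; apply/idP/exists_inP => [/indep_bs[B bB ZB]|[B bB ZB]]; first by exists B.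
by apply/indep_bs; exists B.
Qed.

(** * Excluded minors with six elements *)

Definition triples6 := subs 3 (iota 0 6).

Definition triangle_lists : seq (seq (seq nat)) :=
  [::] :: [seq [:: m] | m <- triples6] ++
  [seq [:: p.1; p.2] | p <- [seq (m1, m2) | m1 <- triples6, m2 <- triples6] &
     size [seq i <- p.1 | i \in p.2] <= 1].

(** The clause for t fails exactly when t lists the non-bases, so a refutation shows that the
    non-bases form one of the listed configurations. *)
Definition not_triangles : seq clause :=
  [seq ([seq m <- triples6 | m \notin t], t) | t <- triangle_lists].

(** Position 0 is the element e contracted by one witness and deleted by the other. Here the second
    witness contracts the element deleted by the first; [contradictory_six] treats the case that it
    contracts an element of Q. *)
Lemma contradictory_six_opposite :
  contradictory 6 1 1 [::]
    (pos (wit_masks 6 1 [:: 0] [:: 1]) ++ pos (wit_masks 6 1 [:: 1] [:: 0]) ++ not_triangles).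
Proof. by vm_compute. Qed.

Lemma contradictory_six :
  contradictory 6 1 1 [::]
    (pos (wit_masks 6 1 [:: 0] [:: 1]) ++ pos (wit_masks 6 1 [:: 2] [:: 0]) ++ not_triangles).
Proof. by vm_compute. Qed.

Definition sparse (T : finType) (tri : seq {set T}) : Prop :=
  size tri <= 2 /\ forall t, t \in tri -> #|t| = 3.

(** Pigeonhole: three distinct candidates cannot all be among two triangles. *)
Lemma sparse_avoid (T : finType) (tri : seq {set T}) (A : {set T}) (F : T -> {set T}) : sparse tri ->
  {in A &, injective F} -> 2 < #|A| -> exists2 z, z \in A & F z \notin tri.
Proof.
move=> [st _] inj cA.
case: (boolP [exists z in A, F z \notin tri]) => [/exists_inP[z zA zt]|/exists_inPn h]; first by exists z.
have ui : uniq [seq F z | z <- enum A].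
  rewrite map_inj_in_uniq ?enum_uniq // => z w; rewrite !mem_enum; exact: inj.
have := uniq_leq_size ui (s2 := tri); rewrite size_map -cardE => H.
have : #|A| <= size tri.
  apply: H => t /mapP[z]; rewrite mem_enum => zA ->; by have := h z zA; rewrite negbK.
by move: st cA; clear; lia.
Qed.

Definition iso_rank3 (T : finType) (M : mat T) (tri : seq {set T}) :=
  forall X : {set T}, X \subset ground M -> (X \in indep M) = (#|X| <= 3) && (X \notin tri).

(** A set of at most two elements extends to a pair, and the pair to four different triples, of
    which at most two are triangles. *)
Lemma rank3_of_bases (T : finType) (M : mat T) (tri : seq {set T}) : is_matroid M ->
  #|ground M| = 6 -> sparse tri -> rk M (ground M) = 3 ->
  (forall X : {set T}, X \subset ground M -> #|X| = 3 -> (X \in bases M) = (X \notin tri)) ->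
  iso_rank3 M tri.
Proof.
move=> Mm cE sp r3 hb X XE; apply/idP/andP => [/(indep_base Mm)[B bB XB]|[]].
  have [BI cB] := (basesP M B).1 bB; rewrite r3 in cB.
  have c3 : #|X| <= 3 by rewrite -cB subset_leq_card.
  split=> //; apply/negP => Xt; have cX := sp.2 X Xt.
  have /eqP e : X == B by rewrite eqEcard XB cX cB.
  by move: (hb X XE cX); rewrite Xt e bB.
rewrite leq_eqVlt => /orP[/eqP c3 nt|lt _].
  by have /basesP[] : X \in bases M by rewrite hb.
have big (Y : {set T}) : Y \subset ground M -> #|Y| <= 2 -> exists P : {set T}, [/\ Y \subset P, P \subset ground M & #|P| = 2].
  have [n] := ubnP (2 - #|Y|); elim: n Y => // n IH Y le YE c2.
  case: (ltnP #|Y| 2) => [lt2|]; last by exists Y; split=> //; apply/eqP; rewrite eqn_leq c2.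
  have /card_gt0P[z] : 0 < #|ground M :\: Y| by rewrite cardsD (setIidPr YE) cE; move: lt2; clear; lia.
  rewrite inE => /andP[zY zE].
  have c : #|z |: Y| = #|Y|.+1 by rewrite cardsU1 zY.
  case: (IH (z |: Y)); rewrite ?c //; [by move: le lt2; clear; lia | by rewrite subUset sub1set zE |].
  by move=> P [/subUsetP[_ YP] PE cP]; exists P.
have [P [XP PE cP]] := big X XE lt.
have [||z] := sparse_avoid (A := ground M :\: P) (F := fun z => z |: P) sp.
- move=> z w; rewrite !in_setD => /andP[zP _] _ /= /setP/(_ z).
  by rewrite !in_setU1 eqxx (negPf zP) !orbF => /esym/eqP.
- by rewrite cardsD (setIidPr PE) cE cP.
rewrite inE => /andP[zP zE] nt; apply/(indep_base Mm); exists (z |: P); last first.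
  by apply: subset_trans XP _; exact: subsetUr.
by rewrite hb // ?subUset ?sub1set ?zE // cardsU1 zP cP.
Qed.

Section IsoRank3.
Variables (T : finType) (M : mat T) (s : seq T) (tri : seq {set T}).
Hypotheses (us : uniq s) (ss : size s = 6) (eE : ground M = [set x in s]) (hM : iso_rank3 M tri).
Hypothesis triE : forall t, t \in tri -> t \subset ground M.
Let f (x : T) : 'I_6 := i6 (index x s).

Lemma i6_inj i j : i < 6 -> j < 6 -> (i6 i == i6 j) = (i == j).
Proof. by move=> li lj; rewrite -val_eqE /= !inordK. Qed.

Lemma idx_inj : {in ground M &, injective f}.
Proof.
move=> x y; rewrite eE !inE => xs ys /eqP.
rewrite i6_inj -?ss ?index_mem // => /eqP e.
by rewrite -(nth_index x xs) e nth_index.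
Qed.

Lemma iso_of_seq : iso M (rank3_6 [seq f @: t | t : {set T} <- tri]).
Proof.
exists f; split; first exact: idx_inj.
  apply/setP => j; rewrite inE; apply/imsetP.
  have lj : j < size s by rewrite ss.
  have [x0 _] : exists x : T, x \in s by case: s ss => // x l _; exists x; rewrite mem_head.
  exists (nth x0 s j); first by rewrite eE inE mem_nth.
  by rewrite /f index_uniq //; apply/val_inj; rewrite /= inordK // -ss.
move=> X XE; rewrite hM // inE card_in_imset; last by move=> x y /(subsetP XE) xE /(subsetP XE) yE; exact: idx_inj.
congr (_ && ~~ _); apply/idP/mapP => [Xt|[t tt e]]; first by exists X.
suff -> : X = t by [].
apply/setP => x; apply/idP/idP => xin.
  have : f x \in f @: t by rewrite -e imset_f.
  by case/imsetP => y yt /idx_inj -> //; [exact: (subsetP XE) | exact: (subsetP (triE tt))].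
have : f x \in f @: X by rewrite e imset_f.
by case/imsetP => y yt /idx_inj -> //; [exact: (subsetP (triE tt)) | exact: (subsetP XE)].
Qed.
End IsoRank3.

Lemma U36_rank3 : U 3 6 = rank3_6 [::].
Proof. by apply: mat_eq => //; apply/setP => X; rewrite !inE andbT. Qed.

Lemma imset_set3 (aT rT : finType) (f : aT -> rT) a b c :
  f @: [set a; b; c] = [set f a; f b; f c].
Proof. by rewrite !imsetU !imset_set1. Qed.

Definition six_list (T : finType) (M : mat T) : Prop :=
  [\/ iso M Q6, iso M P6, iso M (U 3 6) | iso M R6].

Lemma set_of_seq3 (T : finType) (a b c : T) : [set x in [:: a; b; c]] = [set a; b; c].
Proof. by apply/setP => x; rewrite !inE orbA. Qed.

Lemma set3P (T : finType) (A : {set T}) : #|A| = 3 -> exists a b c, A = [set a; b; c] /\ uniq [:: a; b; c].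
Proof.
rewrite cardE; case e : (enum A) => [|a [|b [|c []]]] //= _; exists a, b, c; split.
  by apply/setP => z; rewrite -mem_enum e !inE orbA.
by have := enum_uniq (mem A); rewrite e.
Qed.

Lemma six_list_of_triangles (T : finType) (M : mat T) (tri : seq {set T}) : is_matroid M ->
  #|ground M| = 6 -> iso_rank3 M tri -> (forall t, t \in tri -> #|t| = 3 /\ t \subset ground M) ->
  [\/ tri = [::], exists t, tri = [:: t] | exists t1 t2, tri = [:: t1; t2] /\ #|t1 :&: t2| <= 1] ->
  six_list M.
Proof.
move=> Mm cE hM tE; have tE' t : t \in tri -> t \subset ground M by case/tE.
have rest (A : {set T}) n : A \subset ground M -> #|A| + n = 6 ->
    exists l : seq T, [/\ uniq l, size l = n & forall x, (x \in l) = (x \in ground M) && (x \notin A)].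
  move=> AE cA; exists (enum (ground M :\: A)); split; first exact: enum_uniq.
    by rewrite -cardE cardsD (setIidPr AE) cE; move: cA; clear; lia.
  by move=> x; rewrite mem_enum inE andbC.
have grd (l1 l2 : seq T) (A : {set T}) : A \subset ground M -> A = [set x in l1] ->
    (forall x, (x \in l2) = (x \in ground M) && (x \notin A)) -> ground M = [set x in l1 ++ l2].
  move=> AE eA h; apply/setP => x; rewrite inE mem_cat h eA inE.
  have := subsetP AE x; rewrite eA inE; case: (x \in l1) => //= [-> //|_]; by rewrite andbT.
have ucat (l1 l2 : seq T) (A : {set T}) : uniq l1 -> uniq l2 -> A = [set x in l1] ->
    (forall x, (x \in l2) = (x \in ground M) && (x \notin A)) -> uniq (l1 ++ l2).
  move=> u1 u2 eA h; rewrite cat_uniq u1 u2 andbT; apply/hasPn => x; rewrite h eA inE.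
  by case/andP.
case=> [e|[t e]|[t1 [t2 [e c12]]]].
- apply: Or43; rewrite U36_rank3.
  have := @iso_of_seq T M (enum (ground M)) tri; rewrite e /=; apply=> //.
  + exact: enum_uniq.
  + by rewrite -cardE.
  + by apply/setP => x; rewrite inE mem_enum.
  by rewrite -e.
- apply: Or42; have tin : t \in tri by rewrite e mem_head.
  have [c3 ts] := tE t tin; have [a [b [c [et ut]]]] := set3P c3.
  have [|l [ul sl hl]] := rest t 3 ts; first by rewrite c3.
  have et' : t = [set x in [:: a; b; c]] by rewrite set_of_seq3.
  have ss : size ([:: a; b; c] ++ l) = 6 by rewrite /= sl.
  have us := ucat _ _ _ ut ul et' hl.
  have G := grd _ _ _ ts et' hl; set g := [:: a; b; c] ++ l in ss us G.
  have ix i : i < 6 -> index (nth a g i) g = i by move=> li; rewrite index_uniq // ss.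
  have := (ix 0 isT, ix 1 isT, ix 2 isT); rewrite [nth a g 0]/= [nth a g 1]/= [nth a g 2]/=.
  have := iso_of_seq us ss G hM tE'; move: {us ss G ix} g => g iM [[i0 i1] i2].
  by move: iM; rewrite e /= et imset_set3 i0 i1 i2.
have [t1in t2in] : t1 \in tri /\ t2 \in tri by rewrite e !inE !eqxx orbT.
have [c1 s1] := tE _ t1in; have [c2 s2] := tE _ t2in.
have sU : t1 :|: t2 \subset ground M by rewrite subUset s1.
case: (posnP #|t1 :&: t2|) => [c0|gt].
  apply: Or44; have [a1 [b1 [d1 [et1 u1]]]] := set3P c1; have [a2 [b2 [d2 [et2 u2]]]] := set3P c2.
  have e0 : t1 :&: t2 = set0 by apply/eqP; rewrite -cards_eq0 c0.
  have et1' : t1 = [set x in [:: a1; b1; d1]] by rewrite set_of_seq3.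
  have et2' : t2 = [set x in [:: a2; b2; d2]] by rewrite set_of_seq3.
  have h2 x : (x \in [:: a2; b2; d2]) = (x \in ground M) && (x \notin t1).
    have eU : t1 :|: t2 = ground M by apply/eqP; rewrite eqEcard sU cE cardsU c1 c2 e0 cards0.
    have -> : (x \in [:: a2; b2; d2]) = (x \in t2) by rewrite et2' in_set.
    by rewrite -eU in_setU; move/setP/(_ x): e0; rewrite in_setI in_set0; case: (x \in t1) => /= [->|_] //; rewrite ?andbT ?andbF.
  have ss : size ([:: a1; b1; d1] ++ [:: a2; b2; d2]) = 6 by [].
  have us := ucat _ _ _ u1 u2 et1' h2.
  have G := grd _ _ _ s1 et1' h2; set g := [:: a1; b1; d1] ++ [:: a2; b2; d2] in ss us G.
  have ix i : i < 6 -> index (nth a1 g i) g = i by move=> li; rewrite index_uniq.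
  have := (ix 0 isT, ix 1 isT, ix 2 isT, ix 3 isT, ix 4 isT, ix 5 isT).
  rewrite [nth a1 g 0]/= [nth a1 g 1]/= [nth a1 g 2]/= [nth a1 g 3]/= [nth a1 g 4]/= [nth a1 g 5]/=.
  have := iso_of_seq us ss G hM tE'; move: {us ss G ix} g => g iM [[[[[i0 i1] i2] i3] i4] i5].
  by move: iM; rewrite e /= et1 et2 !imset_set3 i0 i1 i2 i3 i4 i5.
apply: Or41; have /cards1P[z ez] : #|t1 :&: t2| == 1 by rewrite eqn_leq c12.
have [z1 z2] : z \in t1 /\ z \in t2.
  by have : z \in t1 :&: t2 by [rewrite ez inE]; rewrite inE => /andP[].
have two (t : {set T}) : #|t| = 3 -> z \in t -> exists a b, [/\ t = [set a; b; z], a != b, a != z & b != z].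
  move=> ct zt; have : #|t :\ z| == 2 by have := cardsD1 z t; rewrite zt ct add1n => -[->].
  case/cards2P => a [b [ab eab]]; exists a, b.
  have : a \in t :\ z by rewrite eab !inE eqxx.
  have : b \in t :\ z by rewrite eab !inE eqxx orbT.
  rewrite !in_setD1 => /andP[bz _] /andP[az _]; split=> //.
  by rewrite -(setD1K zt) eab setUC.
have [a [b [et1 ab az bz]]] := two _ c1 z1; have [d [q [et2 dq dz qz]]] := two _ c2 z2.
have no x : x \in [set a; b] -> x \in [set d; q] -> False.
  rewrite !inE => xab xdq; have : x \in t1 :&: t2.
    by rewrite et1 et2 !inE; case/orP: xab => ->; case/orP: xdq => ->; rewrite ?orbT.
  rewrite ez inE => /eqP ex; case/orP: xab => /eqP xe; rewrite -xe ex eqxx in az bz *.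
    by [].
  by [].
have [|l [ul sl hl]] := rest (t1 :|: t2) 1 sU; first by rewrite cardsU c1 c2 ez cards1.
have eU : t1 :|: t2 = [set x in [:: a; b; z; d; q]].
  by apply/setP => x; rewrite et1 et2 !inE; case: (x == a); case: (x == b); case: (x == z); case: (x == d); case: (x == q).
have nd x y : x \in [set a; b] -> y \in [set d; q] -> x != y.
  by move=> xab ydq; apply/eqP => exy; apply: (no x) => //; rewrite exy.
have uz : uniq [:: a; b; z; d; q].
  rewrite /= !inE !negb_or ab az bz dq (eq_sym z) dz (eq_sym z) qz.
  by rewrite !nd // !inE eqxx ?orbT.
have ss : size ([:: a; b; z; d; q] ++ l) = 6 by rewrite /= sl.
have us := ucat _ _ _ uz ul eU hl.
(* The elements are listed so that the common element z has position 2, which gives the triangles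
   {0, 1, 2} and {2, 3, 4} of [Q6]. *)
have G := grd _ _ _ sU eU hl; set g := [:: a; b; z; d; q] ++ l in ss us G.
have ix i : i < 6 -> index (nth a g i) g = i by move=> li; rewrite index_uniq // ss.
have := (ix 0 isT, ix 1 isT, ix 2 isT, ix 3 isT, ix 4 isT).
rewrite [nth a g 0]/= [nth a g 1]/= [nth a g 2]/= [nth a g 3]/= [nth a g 4]/=.
have := iso_of_seq us ss G hM tE'; move: {us ss G ix} g => g iM [[[[i0 i1] i2] i3] i4].
move: iM; rewrite e /= et1 et2 !imset_set3 i0 i1 i2 i3 i4 /Q6.
have -> // : [set i6 3; i6 4; i6 2] = [set i6 2; i6 3; i6 4].
by apply/setP => x; rewrite !inE orbC orbA.
Qed.

(** * Every excluded minor is in the list *)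

(** With C0 independent and D0 avoided by a base, a U_{2,4}-minor of M/C0\D0 grows to a witness of M
    by [u24_wit]. *)
Lemma minor_binary_or_wit (T : finType) (M : mat T) (C0 D0 B0 : {set T}) : is_matroid M ->
  C0 \in indep M -> D0 \subset ground M -> [disjoint C0 & D0] ->
  B0 \in bases M -> [disjoint B0 & D0] ->
  binary (minor M C0 D0) \/
  exists C D : {set T}, [/\ wit (ground M) (bases M) C D, C0 \subset C & D0 \subset D].
Proof.
move=> Mm C0I D0E d0 bB0 dB0.
case: (binary_or_u24 (minor_matroid Mm C0 D0)) => [b|[C [Q /(minor_u24 Mm)[I [II IC cI u sub]]]]].
  by left.
have /eqP eI : I == C0 by rewrite eqEcard IC cI rk_indep /=.
have [|C' [D' [w sC sD]]] := u24_wit Mm u _ bB0 dB0; first by rewrite eI; clear - sub d0; pt.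
right; exists C', D'; split=> //; last by rewrite -(setIidPr D0E).
by apply: subset_trans sC; rewrite eI subsetUr.
Qed.

(** [binary] is a proposition, so an element e is extracted through the boolean test [nb] for a
    U_{2,4}-minor. *)
Lemma not_classZ (T : finType) (M : mat T) : is_matroid M -> ~ classZ M ->
  exists e, [/\ e \in ground M, ~ binary (del M e) & ~ binary (con M e)].
Proof.
move=> Mm nZ; pose nb (N : mat T) := [exists C, [exists Q, u24 (indep N) C Q]].
have nbP N : is_matroid N -> (nb N) = false <-> binary N.
  move=> Nm; split=> [/negbT/existsPn no|/(binaryP Nm) no].
    apply/(binaryP Nm) => C Q; apply/negP => u; have := no C.
    by move/existsPn/(_ Q); rewrite u.
  by apply/negbTE/existsPn => C; apply/existsPn => Q; exact: no.
have md e : is_matroid (del M e) := minor_matroid Mm _ _.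
have mc e : is_matroid (con M e) := minor_matroid Mm _ _.
case: (boolP [exists e in ground M, nb (del M e) && nb (con M e)]) => [/exists_inP[e eE /andP[n1 n2]]|/exists_inPn h].
  by exists e; split=> [//|/(nbP _ (md e))|/(nbP _ (mc e))]; rewrite ?n1 ?n2.
case: nZ => e eE; have := h e eE; rewrite negb_and.
by case/orP => /negPf b; [left; apply/(nbP _ (md e)) | right; apply/(nbP _ (mc e))].
Qed.

(** * U_{2,4} with a loop or a coloop *)

Section U24Plus.
Variables (T : finType) (M : mat T) (Q : {set T}) (e : T) (k : nat).
Hypotheses (cQ : #|Q| = 4) (eQ : e \notin Q).

(** Describes the direct sum inside M itself: e is a loop for k = 0 and a coloop for k = 1. *)
Definition u24_plus := ground M = e |: Q /\
  forall X : {set T}, X \subset e |: Q ->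
    (X \in indep M) = (#|X :&: Q| <= 2) && ((e \in X) <= k).

Lemma dsum_u24_indep (f : T -> ('I_4 + 'I_1)%type) (X : {set T}) : {in e |: Q &, injective f} ->
  (forall x, x \in Q -> exists j, f x = inl j) -> f e = inr ord0 -> X \subset e |: Q ->
  (f @: X \in indep (dsum (U 2 4) (U k 1))) = (#|X :&: Q| <= 2) && ((e \in X) <= k).
Proof.
move=> finj fQ fe XE; rewrite in_set.
have -> : f @: X \subset inl @: [set: 'I_4] :|: inr @: [set: 'I_1].
  apply/subsetP => -[] j _; rewrite in_setU; apply/orP; [left|right]; apply/imsetP; exists j; by rewrite ?inE.
rewrite /= !in_set; congr (_ && _).
  congr (_ <= 2); rewrite -(card_in_imset (f := f) (D := X :&: Q)); last first.
    by move=> x y /setIP[xX _] /setIP[yX _]; apply: finj; exact: (subsetP XE).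
  have <- : [set inl j | j in inl @^-1: (f @: X)] = f @: (X :&: Q).
    apply/setP => u; apply/imsetP/imsetP => [[j]|[x /setIP[xX xQ] ->]].
      rewrite inE => /imsetP[x xX ex] ->; exists x => //; rewrite inE xX /=.
      by have := subsetP XE x xX; rewrite !inE => /orP[/eqP xe|//]; rewrite xe fe in ex.
    by have [j ej] := fQ x xQ; exists j; rewrite // inE -ej imset_f.
  by rewrite card_imset // => x y [].
congr (_ <= k); have -> : inr @^-1: (f @: X) = if e \in X then [set: 'I_1] else set0.
  apply/setP => j; rewrite inE (ord1 j); case: ifP => eX; rewrite inE.
    by apply/imsetP; exists e.
  apply/negP => /imsetP[x xX]; have := subsetP XE x xX; rewrite !inE => /orP[/eqP xe|/fQ[i ->] //].
  by rewrite -xe xX in eX.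
by case: ifP; rewrite ?cards0 // cardsT card_ord.
Qed.

Lemma iso_u24_plus : u24_plus -> iso M (dsum (U 2 4) (U k 1)).
Proof.
move=> [gE hX].
pose f x : ('I_4 + 'I_1)%type := if x \in Q then inl (inord (index x (enum Q))) else inr ord0.
have fQ x : x \in Q -> f x = inl (inord (index x (enum Q))) by rewrite /f => ->.
have fe : f e = inr ord0 by rewrite /f (negPf eQ).
have ix x : x \in Q -> index x (enum Q) < 4 by move=> xQ; rewrite -cQ cardE index_mem mem_enum.
have finj : {in ground M &, injective f}.
  move=> x y; rewrite gE !in_setU1; case: (eqVneq x e) => [->|xe]; case: (eqVneq y e) => [->|ye] //= h1 h2.
  - by rewrite fe fQ.
  - by rewrite fe fQ.
  rewrite !fQ // => -[/(congr1 val)]; rewrite /= !inordK ?ix // => eq.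
  by rewrite -(nth_index x (_ : x \in enum Q)) ?mem_enum // eq nth_index // mem_enum.
have allS : inl @: [set: 'I_4] :|: inr @: [set: 'I_1] = [set: ('I_4 + 'I_1)%type].
  apply/setP => -[] j; rewrite in_setU in_setT; apply/orP; [left|right]; apply/imsetP; exists j; by rewrite ?inE.
exists f; split=> //.
  rewrite /= allS; apply/setP => u; rewrite in_setT; apply/imsetP; case: u => j.
    have lj : j < size (enum Q) by rewrite -cardE cQ.
    have [x0 _] : exists x, x \in Q by apply/card_gt0P; rewrite cQ.
    have xQ : nth x0 (enum Q) j \in Q by rewrite -mem_enum mem_nth.
    exists (nth x0 (enum Q) j); first by rewrite gE in_setU1 xQ orbT.
    rewrite fQ // index_uniq ?enum_uniq //; congr inl; apply/val_inj; rewrite /= inordK //.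
  exists e; first by rewrite gE in_setU1 eqxx.
  by rewrite fe (ord1 j).
move=> X; rewrite gE => XE; rewrite hX // (dsum_u24_indep (f := f)) // -?gE //.
by move=> x xQ; exists (inord (index x (enum Q))); exact: fQ.
Qed.
End U24Plus.

Lemma card_le2_pair (T : finType) (Q X : {set T}) : 1 < #|Q| -> X \subset Q -> #|X| <= 2 ->
  exists x y, [/\ x \in Q, y \in Q, x != y & X \subset [set x; y]].
Proof.
move=> cQ XQ; rewrite leq_eqVlt => /orP[/cards2P[x [y [xy e]]]|lt].
  by exists x, y; move: XQ; rewrite e subUset !sub1set => /andP[].
have [x XS xQ] : exists2 x, X \subset [set x] & x \in Q.
  case: (posnP #|X|) => [/eqP|gt].
    rewrite cards_eq0 => /eqP ->; have /card_gt0P[x xQ] : 0 < #|Q| by apply: ltnW.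
    by exists x; rewrite ?sub0set.
  have /cards1P[x ex] : #|X| == 1 by rewrite eqn_leq gt -ltnS lt.
  by exists x; [rewrite ex | rewrite -sub1set -ex].
have [y yQ yx] := card_gt_ex cQ (s := [:: x]) isT.
exists x, y; split=> //; first by move: yx; rewrite inE eq_sym.
by apply: subset_trans XS _; rewrite subsetUl.
Qed.

Lemma wit_loop_u24_plus (T : finType) (M : mat T) e : is_matroid M ->
  wit (ground M) (bases M) set0 [set e] -> [set e] \notin indep M ->
  u24_plus M (ground M :\ e) e 0.
Proof.
move=> Mm w loop; have r2 : rk M (ground M) = 2 by rewrite (wit_cards (basefam_bases Mm) w).1 cards0.
move: w => [_ sE cQ pair]; rewrite set0U in sE cQ pair.
have eE : e \in ground M by rewrite -sub1set.
split; first by rewrite setD1K.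
move=> X; rewrite setD1K // => XE; rewrite leqn0 eqb0.
apply/idP/andP => [XI|[c2 eX]].
  have eX : e \notin X by apply: contra loop => eX; apply: (indepS Mm) XI; rewrite sub1set.
  split=> //; rewrite -r2; apply: leq_trans (rk_ub XI XE).
  by apply: subset_leq_card; exact: subsetIl.
have [] := card_le2_pair _ (subsetIr _ _) c2; first by rewrite cQ.
move=> u [v [uQ vQ uv sX]]; have /basesP[pI _] := pair u v uQ vQ uv.
apply: indepS pI => //; rewrite set0U; apply: subset_trans sX.
by clear - XE eX; pt.
Qed.

Lemma wit_coloop_u24_plus (T : finType) (M : mat T) e : is_matroid M ->
  wit (ground M) (bases M) [set e] set0 -> (forall B, B \in bases M -> e \in B) ->
  u24_plus M (ground M :\ e) e 1.
Proof.
move=> Mm w col; have r3 : rk M (ground M) = 3 by rewrite (wit_cards (basefam_bases Mm) w).1 cards1.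
move: w => [_ sE cQ pair]; rewrite setU0 in sE cQ pair.
have eE : e \in ground M by rewrite -sub1set.
split; first by rewrite setD1K.
move=> X; rewrite setD1K // => XE; rewrite leq_b1 andbT.
apply/idP/idP => [/(indep_base Mm)[B bB XB]|c2].
  have [BI cB] := (basesP M B).1 bB.
  have -> : 2 = #|B :\ e| by have := cardsD1 e B; rewrite cB r3 (col B bB) => -[].
  by apply: subset_leq_card; clear - XB; pt.
have [] := card_le2_pair _ (subsetIr _ _) c2; first by rewrite cQ.
move=> u [v [uQ vQ uv sX]]; have /basesP[pI _] := pair u v uQ vQ uv.
apply: indepS pI => //; apply: subset_trans (_ : e |: (X :&: (ground M :\ e)) \subset _).
  by clear - XE; pt.
exact: setUS.
Qed.

Lemma six_list_of_masks (T : finType) (M : mat T) (g : seq T) : is_matroid M ->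
  uniq g -> size g = 6 -> ground M = [set x in g] -> rk M (ground M) = 3 ->
  has (fun c => ~~ holds (mval (bases M) set0 g) c) not_triangles -> six_list M.
Proof.
move=> Mm ug sg eg r3 /hasP[c].
case/mapP => t tL ->.
rewrite /holds negb_imply => /andP[].
rewrite [X in all _ X]/fst [X in has _ X]/snd.
move=> /allP ins /hasPn outs.

have [x0 _] : exists x0, x0 \in g by case: (g) sg => // x0 g' _; exists x0; rewrite inE eqxx.
have /and3P[t3 st shape] : [&& all (mem triples6) t, size t <= 2 &
   if t is [:: m1; m2] then size [seq i <- m1 | i \in m2] <= 1 else true].
  by move: t tL {ins outs}; apply/allP; vm_compute.
pose tri := [seq mset g m | m <- t].
have c6 : #|ground M| = 6 by rewrite eg cardsE (card_uniqP ug).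
have triP X : X \in tri -> #|X| = 3 /\ X \subset ground M.
  move=> /mapP[m mt ->]; split; last by rewrite eg mset_sub.
  by apply: (card_subs x0 ug sg); apply: (allP t3).
have sp : sparse tri by split; [rewrite size_map | move=> X /triP[]].
apply: (six_list_of_triangles Mm c6 (tri := tri)) => //.
  apply: (rank3_of_bases Mm c6 sp r3) => X XE cX.
  have Xg : X \subset [set x in g] by rewrite -eg.
  have [m m3 em] := mset_of x0 ug sg Xg cX; rewrite -em.

  have -> : (mset g m \in bases M) = mval (bases M) set0 g m by rewrite /mval set0U.
  case: (boolP (m \in t)) => mt.
    by rewrite (negPf (outs m mt)) map_f.
  rewrite ins ?mem_filter ?mt //; apply/esym/mapP => -[m' m't e].
  have := outs m' m't; rewrite /mval -e.
  by have := ins m; rewrite /mval mem_filter mt => ->.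
case: t t3 st shape @tri triP sp {tL ins outs} => [|m1 [|m2 [|//]]] t3 _ shape tri _ _.
- by constructor 1.
- by constructor 2; exists (mset g m1).
constructor 3; exists (mset g m1), (mset g m2); split=> //.
have m13 : m1 \in triples6 by apply: (allP t3); rewrite inE eqxx.
apply: leq_trans shape.
have -> : mset g m1 :&: mset g m2 = mset g [seq i <- m1 | i \in m2].
  by apply/setP => x; rewrite /mset in_setI !in_set mem_filter; case: (x \in g) => //=; rewrite andbC.
rewrite (card_mset x0 ug sg) //; apply: subseq_trans (filter_subseq _ _) _.
by move: m13; rewrite mem_subs ?iota_uniq // => /andP[].
Qed.

Lemma six_list_of_wits (T : finType) (M : mat T) (e : T) (C1 D1 C2 D2 : {set T}) : is_matroid M ->
  loopless (ground M) (bases M) ->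
  wit (ground M) (bases M) C1 D1 -> wit (ground M) (bases M) C2 D2 -> e \in D1 -> e \in C2 ->
  #|C1| = 1 -> #|D1| = 1 -> #|C2| = 1 -> #|D2| = 1 -> six_list M.
Proof.
move=> Mm LL w1 w2 eD1 eC2 /eqP/cards1P[x e1] /eqP/cards1P[e' eD] /eqP/cards1P[e'' eC] /eqP/cards1P[d e2].
have ? : e' = e by move: eD1; rewrite eD inE => /eqP. subst e'.
have ? : e'' = e by move: eC2; rewrite eC inE => /eqP. subst e''.
subst C1 D1 C2 D2; clear eD1 eC2.
have bf := basefam_bases Mm.
have r3 : rk M (ground M) = 3 by rewrite (wit_cards bf w2).1 cards1.
pose Q := ground M :\: ([set e] :|: [set d]).
have key i qs : uniq qs -> Q = [set x in qs] -> nth e ([:: e; d] ++ qs) i = x ->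
    i < 6 -> ([:: i], [:: 0]) \in mask_wits 6 1 1 ->
    contradictory 6 1 1 [::] (pos (wit_masks 6 1 [:: 0] [:: 1]) ++
      pos (wit_masks 6 1 [:: i] [:: 0]) ++ not_triangles) -> six_list M.
  move=> uq eQ ix i6 iw con.
  have se : {subset [:: e] <= [set e]} by move=> z; rewrite !inE.
  have sd : {subset [:: d] <= [set d]} by move=> z; rewrite !inE.
  have nkl : 6 = 1 + 1 + 4 by [].
  have [ug sg gR gS dRS] := mp_sets w2 (isT : uniq [:: e]) (isT : uniq [:: d]) uq se sd eQ erefl erefl nkl.
  have R0 : [set e] :\: [set x in [:: e]] = set0 by apply/setP => z; rewrite !inE andNb.
  have S0 : [set d] :\: [set x in [:: d]] = set0 by apply/setP => z; rewrite !inE andNb.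
  have gE z := mp_ground w2 se sd eQ z.
  have := mask_principle bf LL e w2 (isT : uniq [:: e]) (isT : uniq [:: d]) uq se sd eQ erefl erefl
     nkl (near := false) (ps := [::]) (or_intror erefl) (fun h => False_ind _ (notF h)) isT isT con.
  rewrite R0 has_cat => /orP[/hasP[c /mapP[m mx ->]]|].
    have /(mask_witP (bases M) e ug sg nkl gR gS dRS gE) h := iw.
    rewrite /holds /= orbF -R0 => /negP[]; move: m mx; apply/allP/h.
    by rewrite R0 S0 !set0U !(mset_consE e ug sg) // !mset_nil !setU0 ix.
  apply: six_list_of_masks => //.
  by apply/setP => z; rewrite gE R0 S0 !inE.
have xe : x != e by case: w1 => /disjz/(_ e); rewrite !inE eqxx andbT eq_sym.
have xE : x \in ground M by case: w1 => _ + _ _; rewrite subUset sub1set => /andP[].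
(* x is different from e, so it is either d, at position 1, or an element of Q, which is then listed
   first and gets position 2. *)
case: (eqVneq x d) => [xd|xd].
  exact: (key 1 (enum Q) (enum_uniq _) (enum_setE Q) (esym xd) isT isT contradictory_six_opposite).
apply: (key 2 (x :: enum (Q :\ x)) _ _ erefl isT isT contradictory_six).
  by rewrite /= enum_uniq mem_enum !inE eqxx.
apply/setP => z; rewrite in_set in_cons mem_enum in_setD1.
by case: (eqVneq z x) => [->|//]; rewrite /Q !inE negb_or xe xd.
Qed.

(** * Case distinction for an excluded minor *)

Section Excluded.
Variables (T : finType) (M : mat T).
Hypotheses (Mm : is_matroid M) (Mex : excluded_minor_Z M).
Local Notation E := (ground M).
Local Notation bs := (bases M).

Lemma excluded_wit : exists C D : {set T}, wit E bs C D.
Proof.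
have [_ nZ _] := Mex; have [e [eE nd _]] := not_classZ Mm nZ.
have [B0 bB0] := base_ex Mm.
case: (binary_or_u24 Mm) => [/(binary_minor Mm set0 [set e]) /nd//|[C [Q u]]].
have dis (X : {set T}) : [disjoint X & set0] by rewrite -setI_eq0 setI0.
by have [C' [D' [w _ _]]] := u24_wit Mm u (dis _) bB0 (dis _); exists C', D'.
Qed.

Lemma excluded_with_loop e : e \in E -> [set e] \notin indep M -> iso M (dsum (U 2 4) (U 0 1)).
Proof.
move=> eE loop; have [C [D w]] := excluded_wit.
have ne B : B \in indep M -> e \notin B.
  by move=> BI; apply: contra loop => eB; apply: (indepS Mm) BI; rewrite sub1set.
have eC := ne C (wit_indep Mm w).
have eD : e \in D.
  apply: contraT => eD; have eQ : e \in E :\: (C :|: D) by rewrite inE in_setU negb_or eC eD.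
  have [y yQ ey] := wit_pairs w e; have [_ _ _ /(_ e y eQ yQ ey)/basesP[/ne]] := w.
  by rewrite !inE eqxx orbT.
have [|eC0 eD0] := excluded_loop Mm Mex w eD; first by apply/negP => /ne; rewrite setU11.
subst C D; apply: (@iso_u24_plus _ _ (E :\ e) e 0); last exact: wit_loop_u24_plus.
  by have [_ _ <- _] := w; rewrite set0U.
by rewrite setD11.
Qed.

Lemma excluded_with_coloop e : (forall B, B \in bs -> e \in B) -> iso M (dsum (U 2 4) (U 1 1)).
Proof.
move=> col; have [C [D w]] := excluded_wit; have [dCD sE cQ pair] := w.
have c2 : 2 < #|E :\: (C :|: D)| by rewrite cQ.
have [x xQ xs] := card_gt_ex c2 (isT : size [:: e] <= 2).
have [y yQ ys] := card_gt_ex c2 (isT : size [:: e; x] <= 2).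
move: xs ys; rewrite !inE negb_or ![_ == e]eq_sym => ex /andP[ey]; rewrite eq_sym => xy.
have eC : e \in C by have := col _ (pair x y xQ yQ xy); rewrite !inE (negPf ex) (negPf ey) !orbF.
have [|eC0 eD0] := excluded_coloop Mm Mex w eC.
  move=> q qQ; apply/negP => /col; rewrite !inE eqxx eC /=; by rewrite andbF.
subst C D; apply: (@iso_u24_plus _ _ (E :\ e) e 1); last exact: wit_coloop_u24_plus.
  by have [_ _ <- _] := w; rewrite setU0.
by rewrite setD11.
Qed.

(** A violation would force an empty C or an empty D by [excluded_loop] and [excluded_coloop]. *)
Lemma excluded_loopless : (forall C D, wit E bs C D -> 0 < #|C| /\ 0 < #|D|) -> loopless E bs.
Proof.
move=> pos; split=> C D a w aX; have [dCD sE cQ pair] := w; last first.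
  have [/exists_inP[q]|/exists_inPn h] := boolP [exists q in E :\: (C :|: D), (C :\ a) :|: (E :\: (C :|: D) :\ q) \in bs].
    by exists q.
  have [] := excluded_coloop Mm Mex w aX h; have [_] := pos _ _ w.
  by case: (set_0Vmem D) => [->|[z zD]]; [rewrite cards0 | move=> _ _ D0; rewrite D0 in_set0 in zD].
have [aI|dep] := boolP (a |: C \in indep M); last first.
  have [C0 _] := excluded_loop Mm Mex w aX dep; have [] := pos _ _ w; by rewrite C0 cards0.
have /card_gt0P[x xQ] : 0 < #|E :\: (C :|: D)| by rewrite cQ.
have [y yQ xy] := wit_pairs w x.
have [B [bB sB Bs]] := base_extend Mm aI (pair x y xQ yQ xy).
have aC : a \notin C by apply/negP => aC; have := disjz dCD a; rewrite aX aC.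
have [BI cB] := (basesP M B).1 bB.
have [|q qB eB] := subset_card_succ sB.
  by rewrite cB (wit_cards (basefam_bases Mm) w).1 addn2 cardsU1 aC.
exists q; last by rewrite (_ : _ :|: _ = B) // eB; clear; pt.
have : q \in [set x; y].
  by clear - Bs qB; move: qB; rewrite inE => /andP[h /(subsetP Bs)]; move: h; rewrite !inE negb_or => /andP[/negPf-> /negPf->].
by rewrite !inE => /orP[]/eqP->; move: xQ yQ; rewrite !inE.
Qed.

Lemma excluded_minor_list : six_list M \/
  [\/ iso M (dsum (U 2 4) (U 1 1)), iso M (dsum (U 2 4) (U 0 1)) | inD M].
Proof.
have [_ nZ _] := Mex; have [e [eE nd nc]] := not_classZ Mm nZ.
have [B0 bB0] := base_ex Mm.
have [eI|loop] := boolP ([set e] \in indep M); last first.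
  by right; constructor 2; exact: excluded_with_loop loop.
have [/exists_inP[B1 bB1 eB1]|/exists_inPn h] := boolP [exists B in bs, e \notin B]; last first.
  by right; constructor 1; apply: (excluded_with_coloop (e := e)) => B /h; rewrite negbK.
have sE : [set e] \subset E by rewrite sub1set.
have dis0 (X : {set T}) : [disjoint X & set0] by rewrite -setI_eq0 setI0.
have d0e : [disjoint set0 & [set e]] by rewrite disjoint_sym.
have dB1 : [disjoint B1 & [set e]] by rewrite disjoint_sym disjoints1.
case: (minor_binary_or_wit Mm (indep0 Mm) sE d0e bB1 dB1) => [/nd//|[C1 [D1 [w1 _]]]].
rewrite sub1set => eD1.
case: (minor_binary_or_wit Mm eI (sub0set E) (dis0 _) bB0 (dis0 _)) => [/nc//|[C2 [D2 [w2 + _]]]].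
rewrite sub1set => eC2.
have bf := basefam_bases Mm.
have [r1 n1] := wit_cards bf w1; have [r2 n2] := wit_cards bf w2.
have gC2 : 0 < #|C2| by apply/card_gt0P; exists e.
have gD1 : 0 < #|D1| by apply/card_gt0P; exists e.
(* The sizes depend only on the rank and on the number of elements, so they can be read off from the
   two witnesses at hand. *)
have eqs C D : wit E bs C D -> #|C| = #|C2| /\ #|D| = #|D1|.
  by move=> w; have [r n] := wit_cards bf w; clear - r n r1 n1 r2 n2; lia.
have LL : loopless E bs by apply: excluded_loopless => C D /eqs[-> ->].
have [/eqP k1|k1] := boolP (#|C2| + #|D1| == 2); last first.
  right; constructor 3; apply: good_inD => //; split.
  - by [].
  - by [].
  - exact: excluded_star.
  - by move=> C D /eqs[-> ->]; split=> //; clear - gC2 gD1 k1; lia.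
  by exists C2, D2, C1, D1, e.
left; have [cC1 _] := eqs _ _ w1; have [_ cD2] := eqs _ _ w2.
by apply: (six_list_of_wits Mm LL w1 w2 eD1 eC2); clear - k1 gC2 gD1 cC1 cD2; lia.
Qed.
End Excluded.

(** * Every matroid in the list is an excluded minor *)

Lemma u24_plus_of_iso (T : finType) (M : mat T) (k : nat) : iso M (dsum (U 2 4) (U k 1)) ->
  exists (Q : {set T}) (e : T), [/\ #|Q| = 4, e \notin Q & u24_plus M Q e k].
Proof.
move=> [f [finj fE hI]].
have onto u : u \in f @: ground M.
  by rewrite fE in_setU; apply/orP; case: u => j; [left|right]; apply/imsetP; exists j; rewrite ?inE.
have /imsetP[e eE /esym fe] := onto (inr ord0).
pose Q := [set x in ground M | if f x is inl _ then true else false].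
have eQ : e \notin Q by rewrite inE fe andbF.
have gE : ground M = e |: Q.
  apply/setP => x; rewrite !inE; case: (eqVneq x e) => [->|xe] /=; first by rewrite eE.
  case: (boolP (x \in ground M)) => //= xE; case ex: (f x) => [//|j].
  case/negP: xe; apply/eqP; apply: finj => //; by rewrite ex fe (ord1 j).
have fQ x : x \in Q -> exists j, f x = inl j.
  by rewrite inE => /andP[_]; case: (f x) => [j _|//]; exists j.
have finj' : {in e |: Q &, injective f} by rewrite -gE.
exists Q, e; split=> //.
  rewrite -(card_in_imset (f := f) (D := Q)); last first.
    by move=> x y xQ yQ; apply: finj'; rewrite in_setU1 ?xQ ?yQ orbT.
  have -> : f @: Q = [set inl j | j in [set: 'I_4]].
    apply/setP => u; apply/imsetP/imsetP => [[x xQ ->]|[j _ ->]].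
      by have [j ->] := fQ x xQ; exists j.
    have /imsetP[x xE ex] := onto (inl j); exists x => //.
    by rewrite inE xE -ex.
  by rewrite card_imset ?cardsT ?card_ord // => x y [].
split=> // X XE; rewrite hI ?gE //; exact: dsum_u24_indep.
Qed.

Lemma binary_card_le3 (T : finType) (M : mat T) : is_matroid M -> #|ground M| <= 3 -> binary M.
Proof.
move=> Mm c3; apply/(binaryP Mm) => C Q; apply/negP => u.
have [_ cQ _ _] := u24P _ _ _ u.
have := subset_leq_card (u24_ground Mm u).
by have := subset_leq_card (subsetUr C Q); rewrite cQ; clear - c3; lia.
Qed.

(** Deleting any element leaves at most three, too few for U_{2,4}. *)
Lemma classZ_card_le4 (T : finType) (M : mat T) : is_matroid M -> #|ground M| <= 4 -> classZ M.
Proof.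
move=> Mm c4 e eE; left; apply: binary_card_le3; first exact: minor_matroid.
rewrite /= set0U -ltnS; apply: leq_trans c4; rewrite [X in _ < X](cardsD1 e) eE; exact: leqnn.
Qed.

(** Deleting e and contracting e both leave U_{2,4}, while minors by any single element have four
    elements and lie in Z. *)
Lemma u24_plus_excluded (T : finType) (M : mat T) (Q : {set T}) e k : is_matroid M ->
  #|Q| = 4 -> e \notin Q -> u24_plus M Q e k -> excluded_minor_Z M.
Proof.
move=> Mm cQ eQ [gE hI].
have nonbin C0 D0 : C0 :|: D0 = [set e] -> ~ binary (minor M C0 D0).
  move=> eCD /(binaryP (minor_matroid Mm C0 D0))/(_ set0 Q)/negP; apply.
  have [I [II IC cI]] := rk_ex Mm C0.
  have sI : I \subset [set e] by rewrite -eCD (subset_trans IC) // subsetUl.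
  have key (Y : {set T}) : Y \subset Q -> (set0 :|: Y \in indep (minor M C0 D0)) = (#|Y| <= 2).
    move=> YQ; rewrite set0U (minor_indep Mm II IC cI) ?gE ?eCD ?setU1K // hI; last first.
      by apply: subset_trans (_ : Q :|: [set e] \subset _); [exact: setUSS | rewrite setUC].
    have -> : (Y :|: I) :&: Q = Y by clear - YQ sI eQ; pt.
    have eY : e \notin Y by apply: contra eQ; exact: (subsetP YQ).
    rewrite in_setU (negPf eY) /=; have := II; rewrite hI => [/andP[_ ->]|]; first by rewrite andbT.
    by rewrite (subset_trans sI) // subsetUl.
  apply/u24P; split=> //.
  - by rewrite -setI_eq0 set0I.
  - by move=> x y xQ yQ xy; rewrite key ?cards2 ?xy // subUset !sub1set xQ.
  move=> x y z xQ yQ zQ xy xz yz; rewrite key ?subUset ?sub1set ?xQ ?yQ //.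
  by rewrite setUC cardsU1 cards2 !inE negb_or eq_sym xz eq_sym yz xy.
apply: excluded_of_single => //.
  move=> /(_ e); rewrite gE setU11 => /(_ isT)[]; apply: nonbin; by rewrite ?set0U ?setU0.
have c5 : #|ground M| = 5 by rewrite gE cardsU1 eQ cQ.
have sm (C0 D0 : {set T}) f : f \in ground M -> C0 :|: D0 = [set f] -> classZ (minor M C0 D0).
  move=> fE e0; apply: classZ_card_le4; first exact: minor_matroid.
  by rewrite /= e0 -ltnS; have := cardsD1 f (ground M); rewrite fE c5 => ->.
by move=> f fE; split; apply: (sm _ _ f fE); rewrite ?set0U ?setU0.
Qed.

(** * The rank-3 matroids on six elements *)

Section SixElements.
Variables (T : finType) (M : mat T) (tri : seq {set T}).
Hypotheses (Mm : is_matroid M) (c6 : #|ground M| = 6) (sp : sparse tri) (hM : iso_rank3 M tri).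

Lemma pair_indep (X : {set T}) : X \subset ground M -> #|X| <= 2 -> X \in indep M.
Proof.
move=> XE c2; rewrite hM // (leq_trans c2) //=.
by apply: contraL c2 => /sp.2 ->.
Qed.

(** A U_{2,4} on the four remaining elements would make all four of their triples dependent, but at
    most two are triangles. *)
Lemma six_del2 f g : f \in ground M -> g \in ground M -> f != g -> binary (minor M set0 [set f; g]).
Proof.
move=> fE gE fg; apply/(binaryP (minor_matroid Mm _ _)) => C Q; apply/negP.
move=> /(minor_u24 Mm)[I [_ I0 _ u sub]].
have [dCQ cQ _ triple] := u24P _ _ _ u.
have c4 : #|ground M :\: (set0 :|: [set f; g])| = 4.
  by rewrite set0U cardsD (setIidPr _) ?subUset ?sub1set ?fE // c6 cards2 fg.
have /eqP eQ : Q == ground M :\: (set0 :|: [set f; g]).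
  by rewrite eqEcard c4 cQ (subset_trans _ sub) ?subsetUr.
have C0 : C :|: I = set0.
  rewrite subset0 in I0; rewrite (eqP I0) setU0 in dCQ *.
  apply/eqP; rewrite -subset0; move: sub; rewrite -eQ; clear - dCQ => sub; pt.
have cQ2 : 2 < #|Q| by rewrite cQ.
have [|z zQ nt] := sparse_avoid sp (F := fun z => Q :\ z) _ cQ2.
  by move=> z w zQ _ /= /setP/(_ z); rewrite !inE eqxx zQ andbT /=; case: eqVneq.
have c3 : #|Q :\ z| = 3 by have := cardsD1 z Q; rewrite zQ cQ => -[].
have [a [b [c [e]]]] := set3P c3; rewrite /= !inE negb_or andbT => /andP[/andP[ab ac] bc].
have sQ x : x \in [set a; b; c] -> x \in Q by rewrite -e inE => /andP[].
have := triple a b c (sQ _ _) (sQ _ _) (sQ _ _) ab ac bc.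
rewrite !inE !eqxx !orbT => /(_ isT isT isT); rewrite C0 set0U -e hM ?c3 ?nt //.
by apply: subset_trans (subsetDl _ _) _; rewrite eQ subsetDl.
Qed.

(** Pairs are independent, so contracting one leaves rank 1, less than that of U_{2,4}. *)
Lemma six_con2 f g : f \in ground M -> g \in ground M -> f != g -> binary (minor M [set f; g] set0).
Proof.
move=> fE gE fg; apply/(binaryP (minor_matroid Mm _ _)) => C Q; apply/negP.
move=> /(minor_u24 Mm)[I [_ _ cI u _]].
have [dCQ cQ pair _] := u24P _ _ _ u.
have c2 : #|I| = 2 by rewrite cI rk_indep ?cards2 ?fg // pair_indep ?cards2 ?fg // subUset !sub1set fE.
have [a [b [c [d [[eQ ab _ _] _]]]]] := uniq4P cQ.
have [aQ bQ] : a \in Q /\ b \in Q by rewrite eQ !inE !eqxx !orbT.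
have PI := pair a b aQ bQ ab; have := PI; rewrite hM ?(indep_ground Mm PI) // => /andP[c3 _].
have : #|[set a; b] :|: I| <= 3.
  apply: leq_trans c3; apply: subset_leq_card; rewrite setUC; apply: setSU; exact: subsetUr.
rewrite cardsU cards2 ab c2.
have -> : [set a; b] :&: I = set0 by clear - dCQ aQ bQ; pt.
by rewrite cards0.
Qed.

(** No triangle contains exactly one of a and b, so both M\a/b and M/a\b are U_{2,4} on the other
    four elements. After deleting f, every g can be deleted to reach a binary matroid; after
    contracting f, every g can be contracted. *)
Lemma six_excluded a b : a \in ground M -> b \in ground M -> a != b ->
  (forall t, t \in tri -> (a \in t) = (b \in t)) -> excluded_minor_Z M.
Proof.
move=> aE bE ab same; apply: excluded_of_single => //.
  move=> /(_ a aE).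
  pose Q := ground M :\ a :\ b.
  have cQ : #|Q| = 4.
    by have := cardsD1 a (ground M); have := cardsD1 b (ground M :\ a); rewrite !inE eq_sym ab bE aE c6 /= /Q; clear; lia.
  have aQ : a \notin Q by rewrite !inE eqxx andbF.
  have bQ : b \notin Q by rewrite !inE eqxx.
  have QE : Q \subset ground M by rewrite /Q; clear; pt.
  have inQ x : x \in Q -> [/\ x != a, x != b & x \in ground M] by rewrite !inE => /and3P[].
  have p3 z x y : z \in [set a; b] -> x \in Q -> y \in Q -> [set x; y] :|: [set z] \in indep M.
    move=> zab xQ yQ; have [xa xb xE] := inQ x xQ; have [ya yb yE] := inQ y yQ.
    have zE : z \in ground M by move: zab; rewrite !inE => /orP[]/eqP->.
    rewrite hM ?subUset ?sub1set ?xE ?yE ?zE //; apply/andP; split.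
      by rewrite setUC cardsU1 cards2; case: (_ \notin _) (x != y) => -[].
    apply/negP => /same; rewrite !inE ![a == _]eq_sym ![b == _]eq_sym (negPf xa) (negPf xb) (negPf ya) (negPf yb) /=.
    move: zab; rewrite !inE => /orP[]/eqP->; rewrite eqxx; first by rewrite (negPf ab).
    by rewrite eq_sym (negPf ab).
  have n4 z x y w : z \in [set a; b] -> x \in Q -> y \in Q -> w \in Q -> x != y -> x != w -> y != w ->
      [set x; y; w] :|: [set z] \notin indep M.
    move=> zab xQ yQ wQ xy xw yw; apply/negP => PI; have := PI.
    rewrite hM ?(indep_ground Mm PI) // => /andP[+ _].
    have nz v : v \in Q -> v != z by move=> /inQ[va vb _]; move: zab; rewrite !inE => /orP[]/eqP->.
    rewrite setUC cardsU1 [[set x; y] :|: _]setUC cardsU1 cards2 !inE xy !negb_or.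
    by rewrite (eq_sym z w) (eq_sym z x) (eq_sym z y) (eq_sym w x) (eq_sym w y) !nz // xw yw.
  case.
    move=> /(binaryP (minor_matroid Mm _ _))/(_ [set b] Q)/negP; apply.
    have key (Y : {set T}) : Y \subset Q -> ([set b] :|: Y \in indep (del M a)) = (Y :|: [set b] \in indep M).
      move=> YQ; rewrite (minor_indep Mm (indep0 Mm) (sub0set _)) ?cards0 ?rk_indep ?cards0 ?indep0 //.
        by rewrite setU0 setUC.
      by rewrite set0U; clear - YQ bE ab; rewrite /Q in YQ; pt.
    apply/u24P; split=> //.
    - by rewrite disjoints1.
    - by move=> x y xQ yQ xy; rewrite key ?p3 ?subUset ?sub1set ?xQ // !inE eqxx orbT.
    by move=> x y z xQ yQ zQ xy xz yz; rewrite key ?n4 ?subUset ?sub1set ?xQ ?yQ // !inE eqxx orbT.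
  move=> /(binaryP (minor_matroid Mm _ _))/(_ set0 Q)/negP; apply.
  have aI : [set a] \in indep M by rewrite pair_indep ?sub1set ?cards1.
  have key (Y : {set T}) : Y \subset Q -> (set0 :|: Y \in indep (con M a)) = (Y :|: [set a] \in indep M).
    move=> YQ; rewrite set0U (minor_indep Mm aI (subxx _)) ?rk_indep //.
    by rewrite setU0; clear - YQ; rewrite /Q in YQ; pt.
  apply/u24P; split=> //.
  - by rewrite -setI_eq0 set0I.
  - by move=> x y xQ yQ xy; rewrite key ?p3 ?subUset ?sub1set ?xQ // !inE eqxx.
  by move=> x y z xQ yQ zQ xy xz yz; rewrite key ?n4 ?subUset ?sub1set ?xQ ?yQ // !inE eqxx.
move=> f fE; split=> g; rewrite /= ?set0U ?setU0 !inE => /andP[gf gE].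
  left; rewrite /del minor_minor ?sub0set // setU0; apply: six_del2 => //; by rewrite eq_sym.
right; rewrite /con minor_minor ?setU0 ?sub1set ?inE ?gf //; apply: six_con2 => //; by rewrite eq_sym.
Qed.
End SixElements.

Lemma excluded_of_rank3_6 (T : finType) (M : mat T) (tri : seq {set 'I_6}) (i j : 'I_6) : is_matroid M ->
  iso M (rank3_6 tri) -> sparse tri -> i != j -> (forall t, t \in tri -> (i \in t) = (j \in t)) ->
  excluded_minor_Z M.
Proof.
move=> Mm [f [finj fE hI]] [st ct] ij same.
have onto (t : {set 'I_6}) : f @: (ground M :&: f @^-1: t) = t.
  apply/setP => u; apply/imsetP/idP => [[x]|ut]; first by rewrite !inE => /andP[_ xt] ->.
  have /imsetP[x xE ex] : u \in f @: ground M by rewrite fE inE.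
  by exists x; rewrite // !inE xE -ex.
have pre (X : {set T}) : X \subset ground M -> ground M :&: f @^-1: (f @: X) = X.
  move=> XE; apply/setP => x; rewrite !inE; apply/andP/idP => [[xE /imsetP[y yX /finj e]]|xX].
    by rewrite e // (subsetP XE).
  by rewrite imset_f // (subsetP XE).
have ci (X : {set T}) : X \subset ground M -> #|f @: X| = #|X|.
  by move=> XE; apply: card_in_imset => x y xX yX; apply: finj; exact: (subsetP XE).
have /imsetP[a aE ea] : i \in f @: ground M by rewrite fE inE.
have /imsetP[b bE eb] : j \in f @: ground M by rewrite fE inE.
pose tri' := [seq ground M :&: f @^-1: t | t : {set 'I_6} <- tri].
apply: (@six_excluded _ M tri' Mm _ _ _ a b) => //.
- by rewrite -ci // fE cardsT card_ord.
- split; first by rewrite size_map.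
  by move=> t /mapP[t' t't ->]; have := ct _ t't; by rewrite -{1}(onto t') ci // subsetIl.
- move=> X XE; rewrite hI // inE ci //; congr (_ && ~~ _).
  apply/idP/mapP => [h|[t tt e]]; first by exists (f @: X); rewrite ?pre.
  by rewrite e onto.
- by apply: contra ij => /eqP e; rewrite ea eb e.
move=> t /mapP[t' t't ->]; rewrite !inE aE bE /= -ea -eb; exact: same.
Qed.

Lemma six_list_excluded (T : finType) (M : mat T) : is_matroid M -> six_list M -> excluded_minor_Z M.
Proof.
(* In each of the four matroids the elements 0 and 1 lie in the same triangles. *)
move=> Mm; have i01 : i6 0 != i6 1 by rewrite i6_inj.
have c3 a b c : a < 6 -> b < 6 -> c < 6 -> uniq [:: a; b; c] -> #|[set i6 a; i6 b; i6 c]| = 3.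
  move=> la lb lc; rewrite /= !inE negb_or andbT => /andP[/andP[ab ac] bc].
  by rewrite setUC cardsU1 cards2 !inE !i6_inj // negb_or ab eq_sym ac eq_sym bc.
case=> h; [| | rewrite U36_rank3 in h |]; apply: (excluded_of_rank3_6 Mm h _ i01).
- by split=> // t; rewrite !inE => /orP[]/eqP->; apply: c3.
- by move=> t; rewrite !inE => /orP[]/eqP->; rewrite !inE !i6_inj.
- by split=> // t; rewrite !inE => /eqP->; apply: c3.
- by move=> t; rewrite !inE => /eqP->; rewrite !inE !i6_inj.
- by [].
- by [].
- by split=> // t; rewrite !inE => /orP[]/eqP->; apply: c3.
by move=> t; rewrite !inE => /orP[]/eqP->; rewrite !inE !i6_inj.
Qed.

(** * Matroids with two complementary free bases *)

Section TwoFree.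
Variables (T : finType) (N : mat T) (X Y : {set T}).
Local Notation E := (ground N).
Local Notation bs := (bases N).
Hypotheses (Nm : is_matroid N) (fX : freebase E bs X) (fY : freebase E bs Y).
Hypotheses (dXY : [disjoint X & Y]) (eXY : X :|: Y = E).
Hypotheses (cX : 2 < #|X|) (cY : 2 < #|Y|).
Hypothesis Hw : forall C D, wit E bs C D ->
  C \subset X /\ D \subset Y \/ C \subset Y /\ D \subset X.

Lemma two_free_base a b : a \in X -> b \in Y ->
  exists2 B, B \in bs & [/\ a \in B, b \in B & exists a' b', [/\ a' \in X, b' \in Y, a' \notin B & b' \notin B]].
Proof.
move=> aX bY; have [x xX xa] := card_gt_ex cX (isT : size [:: a] <= 2).
have [y yY yb] := card_gt_ex cY (isT : size [:: b] <= 2).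
rewrite inE in xa; rewrite inE in yb.
have nX z : z \in Y -> z \notin X by have h := dXY; clear - h => zY; have := disjz h z; rewrite zY andbT.
exists (b |: (X :\ x)).
  by apply: fX.2; rewrite ?nX // -eXY in_setU bY orbT.
split; [by rewrite !inE (eq_sym a x) xa aX orbT | by rewrite setU11 | exists x, y].
split=> //; last by rewrite in_setU1 in_setD1 (negPf yb) (negPf (nX y yY)) andbF.
by rewrite in_setU1 in_setD1 eqxx orbF; apply: contraNneq (nX b bY) => <-.
Qed.

Lemma two_free_nonbinary e : e \in Y -> ~ binary (del N e) /\ ~ binary (con N e).
Proof.
move=> eY; have bf := basefam_bases Nm.
have dE : E :\: X = Y by rewrite -eXY; have h := dXY; clear - h; pt.
have dE' : E :\: Y = X by rewrite -eXY; have h := dXY; clear - h; pt.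
have [y1 y1Y y1e] := card_gt_ex cY (isT : size [:: e] <= 2).
have [y2 y2Y] := card_gt_ex cY (isT : size [:: e; y1] <= 2).
rewrite !inE negb_or => /andP[y2e y21]; rewrite inE in y1e.
have y12 : y1 != y2 by rewrite eq_sym.
have eD : e \in Y :\ y1 :\ y2 by rewrite !inE eY !(eq_sym e) y1e y2e.
split.
  have [y1Z y2Z] : y1 \in E :\: X /\ y2 \in E :\: X by rewrite dE.
  have [x1 [x2 [x1X x2X x12 s]]] := sep_base bf fX y1Z y2Z y12 fY.1 y1Y y2Y.
  have w := sep_wit bf fX x1X x2X x12 y1Z y2Z y12 s.
  by apply: (wit_minor_nonbinary Nm w); rewrite ?sub0set // sub1set dE.
(* In the dual, X is again free, and a witness around X there becomes a witness of N that contracts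
   e. *)
pose ds := dual_bs E bs; have bd : basefam E ds _ := basefam_dual bf.
have fXd : freebase E ds X by rewrite -dE'; exact: (freebase_dual bf fY).
have fYd : freebase E ds Y by rewrite -dE; exact: (freebase_dual bf fX).
have [y1Z y2Z] : y1 \in E :\: X /\ y2 \in E :\: X by rewrite dE.
have [x1 [x2 [x1X x2X x12 s]]] := sep_base bd fXd y1Z y2Z y12 fYd.1 y1Y y2Y.
have := wit_dual (sep_wit bd fXd x1X x2X x12 y1Z y2Z y12 s).
rewrite (dual_dual bf) dE => w.
by apply: (wit_minor_nonbinary Nm w); rewrite ?sub0set // sub1set.
Qed.

(** A witness deletes only elements of one side, so it cannot delete both f and g; the base X - f +
    y shows that {f, g} is coindependent. *)
Lemma two_free_del2 f g : f \in X -> g \in Y -> binary (minor N set0 [set f; g]).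
Proof.
move=> fXx gY.
have [x xX xf] := card_gt_ex cX (isT : size [:: f] <= 2).
have [y yY yg] := card_gt_ex cY (isT : size [:: g] <= 2).
have nX z : z \in Y -> z \notin X by have h := dXY; clear - h => zY; have := disjz h z; rewrite zY andbT.
rewrite inE in yg.
have bB : y |: (X :\ f) \in bs by apply: fX.2; rewrite ?nX // -eXY in_setU yY orbT.
have sE : [set f; g] \subset E by rewrite subUset !sub1set -eXY !in_setU fXx gY orbT.
have d0 : [disjoint set0 & [set f; g]] by rewrite -setI_eq0 set0I.
have dB : [disjoint y |: (X :\ f) & [set f; g]].
  have [nf ng] : y != f /\ g \notin X by split; [apply: contraNneq (nX y yY) => -> | exact: nX].
  by clear - nf ng yg; pt.
case: (minor_binary_or_wit Nm (indep0 Nm) sE d0 bB dB) => // -[C [D [w _]]].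
rewrite subUset !sub1set => /andP[fD gD].
have h := dXY; case: (Hw w) => -[_ sD]; have := disjz h f; have := disjz h g.
  by rewrite (subsetP sD f fD) fXx.
by rewrite (subsetP sD g gD) gY.
Qed.

Lemma two_free_con2 f g : f \in X -> g \in Y -> binary (minor N [set f; g] set0).
Proof.
move=> fXx gY; have [B bB [fB gB _]] := two_free_base fXx gY.
have fgI : [set f; g] \in indep N by apply/(indep_base Nm); exists B; rewrite // subUset !sub1set fB.
have d0 (A : {set T}) : [disjoint A & set0] by rewrite -setI_eq0 setI0.
case: (minor_binary_or_wit Nm fgI (sub0set E) (d0 _) bB (d0 _)) => // -[C [D [w + _]]].
rewrite subUset !sub1set => /andP[fC gC].
have h := dXY; case: (Hw w) => -[sC _]; have := disjz h f; have := disjz h g.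
  by rewrite (subsetP sC g gC) gY.
by rewrite (subsetP sC f fC) fXx.
Qed.

(** A witness contracts and deletes on opposite sides, so it cannot contract f and delete g when
    both lie in X. *)
Lemma two_free_mixed f g : f \in X -> g \in X -> f != g -> binary (minor N [set f] [set g]).
Proof.
move=> fXx gX fg.
have fI : [set f] \in indep N by apply/(indep_base Nm); exists X; rewrite ?sub1set //; case: fX.
have gE : [set g] \subset E by rewrite sub1set -eXY inE gX.
have d1 : [disjoint [set f] & [set g]] by rewrite disjoints1 inE.
have d2 : [disjoint Y & [set g]] by rewrite disjoint_sym disjoints1; have := disjz dXY g; rewrite gX.
case: (minor_binary_or_wit Nm fI gE d1 fY.1 d2) => // -[C [D [w]]].
rewrite !sub1set => fC gD.
have h := dXY; case: (Hw w) => -[sC sD]; have := disjz h f; have := disjz h g.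
  by rewrite (subsetP sD g gD) gX.
by rewrite (subsetP sC f fC) fXx andbT.
Qed.

Lemma two_free_single f : f \in X -> classZ (del N f) /\ classZ (con N f).
Proof.
move=> fXx; split=> g; rewrite /= ?set0U ?setU0 !inE => /andP[gf gE].
  move: (gE); rewrite -eXY in_setU => /orP[gX|gY].
    right; rewrite /del /con minor_minor ?set0U ?setU0 //; first exact: two_free_mixed.
    by rewrite sub1set !inE gf gE.
  by left; rewrite /del minor_minor ?sub0set // set0U; exact: two_free_del2.
move: (gE); rewrite -eXY in_setU => /orP[gX|gY].
  left; rewrite /del /con minor_minor ?sub0set // set0U setU0.
  by apply: two_free_mixed; rewrite // eq_sym.
right; rewrite /con minor_minor ?setU0 ?sub1set ?inE ?gf //; exact: two_free_con2.
Qed.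
End TwoFree.

Lemma two_free_excluded (T : finType) (N : mat T) (X Y : {set T}) : is_matroid N ->
  freebase (ground N) (bases N) X -> freebase (ground N) (bases N) Y ->
  [disjoint X & Y] -> X :|: Y = ground N -> 2 < #|X| -> 2 < #|Y| ->
  (forall C D, wit (ground N) (bases N) C D ->
     C \subset X /\ D \subset Y \/ C \subset Y /\ D \subset X) -> excluded_minor_Z N.
Proof.
move=> Nm fX fY dXY eXY cX cY Hw; apply: excluded_of_single => //.
  have /card_gt0P[e eY] : 0 < #|Y| by apply: leq_trans cY.
  have [nd nc] := two_free_nonbinary Nm fX fY dXY eXY cY eY.
  by move=> /(_ e); rewrite -eXY in_setU eY orbT => /(_ isT)[/nd|/nc].
move=> f; rewrite -eXY in_setU => /orP[fXx|fYy].
  exact: (two_free_single Nm fX fY dXY eXY cX cY Hw).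
apply: (two_free_single Nm fY fX _ _ cY cX _ fYy); first by rewrite disjoint_sym.
  by rewrite setUC.
by move=> C D /Hw[]; [right|left].
Qed.

(** * Relaxing two circuit-hyperplanes *)

Section CircuitHyperplanes.
Variables (T : finType) (M : mat T) (H : {set T}).
Hypotheses (Mm : is_matroid M) (chH : circuit_hyperplane M H).
Local Notation E := (ground M).
Local Notation bs := (bases M).

Lemma ch_ground : H \subset E. Proof. by case/andP: chH => /and3P[]. Qed.
Lemma ch_dep : H \notin indep M. Proof. by case/andP: chH => /and3P[]. Qed.
Lemma ch_circuit x : x \in H -> H :\ x \in indep M.
Proof. by case/andP: chH => /and3P[_ _ /forall_inP h] _; exact: h. Qed.

Lemma ch_ex : exists x, x \in H.
Proof. by apply/set0Pn; apply: contraNneq ch_dep => ->; exact: indep0. Qed.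

Lemma ch_card : #|H| = rk M E.
Proof.
have [x xH] := ch_ex; case/andP: chH => _ /and3P[_ /eqP <- _].
have c : #|H| = #|H :\ x|.+1 by rewrite (cardsD1 x) xH.
suff -> : rk M H = #|H :\ x| by rewrite addn1.
apply/eqP; rewrite eqn_leq (rk_ub (ch_circuit xH)) ?subsetDl // andbT.
have [Z [ZI ZH <-]] := rk_ex Mm H.
rewrite -ltnS -c ltn_neqAle subset_leq_card // andbT; apply: contraNneq ch_dep => e.
by have /eqP <- : Z == H by rewrite eqEcard ZH e /=.
Qed.

Lemma ch_free x y : x \in H -> y \in E -> y \notin H -> y |: (H :\ x) \in bs.
Proof.
move=> xH yE yH; have xI := ch_circuit xH.
have c : #|H| = #|H :\ x|.+1 by rewrite (cardsD1 x) xH.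
case/andP: chH => _ /and3P[_ _ /forall_inP/(_ y)]; rewrite inE yH yE => /(_ isT)/eqP r.
have [Z0 [Z0I Z0S cZ0]] := rk_ex Mm (y |: H).
have [|Z [ZI XZ ZS cZ]] := indep_extend Mm xI Z0I.
  by rewrite cZ0 r -ch_card c.
rewrite cZ0 r in cZ.
have [|z zZ eZ] := subset_card_succ XZ; first by rewrite cZ -ch_card c.
suff ez : z = y by apply/basesP; rewrite -ez -eZ.
move: zZ; rewrite inE => /andP[zHx zZ].
have : z \in y |: H.
  by have := subsetP ZS z zZ; rewrite in_setU (negPf zHx) /= => /(subsetP Z0S).
rewrite in_setU1 => /orP[/eqP//|zH]; move: zHx; rewrite in_setD1 zH andbT negbK => /eqP zx.
by case/negP: ch_dep; rewrite -(_ : Z = H) // eZ zx setD1K.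
Qed.
End CircuitHyperplanes.

(** In rank at most 2, X and Y have at most two elements. A circuit through a in X and c in Y
    contains neither of them, so it lies in {a, c}; but this set is an exchange X - b + c, hence a
    base. *)
Lemma ch_rank_gt2 (T : finType) (M : mat T) (X Y : {set T}) : is_matroid M -> connected M ->
  circuit_hyperplane M X -> circuit_hyperplane M Y -> [disjoint X & Y] -> X :|: Y = ground M ->
  2 < rk M (ground M).
Proof.
move=> Mm Mc chX chY dXY eXY; rewrite ltnNge; apply/negP => r2.
have two (H : {set T}) a C : circuit_hyperplane M H -> circuit M C -> a \in H -> a \in C -> ~~ (C \subset H) ->
    exists2 b, b \in H & H :\ b = [set a] /\ b \notin C.
  move=> chH cC aH aC nCH.
  have [b bH bC] : exists2 b, b \in H & b \notin C.
    apply/subsetPn; apply: contra (ch_dep chH) => HC.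
    have [z zC zH] := subsetPn nCH.
    have /and3P[_ _ /forall_inP/(_ z zC) cI] := cC.
    by apply: (indepS Mm) cI; rewrite subsetD1 HC zH.
  exists b => //; split=> //; apply/esym/eqP; rewrite eqEcard sub1set !inE aH andbT.
  rewrite (contraNneq _ bC) => [|<-//]; rewrite cards1.
  by have := cardsD1 b H; rewrite bH (ch_card Mm chH); clear - r2; lia.
have [a aX] := ch_ex Mm chX; have [c cY] := ch_ex Mm chY.
have nX : c \notin X by have := disjz dXY c; rewrite cY andbT.
have nY : a \notin Y by have := disjz dXY a; rewrite aX.
have ac : a != c by apply: contraNneq nX => <-.
have [C [cC [aC cC']]] := Mc a c (subsetP (ch_ground chX) a aX) (subsetP (ch_ground chY) c cY) ac.
have [b bX [eb bC]] := two X a C chX cC aX aC (introN subsetP (fun h => negP nX (h c cC'))).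
have [d dY [ed dC]] := two Y c C chY cC cY cC' (introN subsetP (fun h => negP nY (h a aC))).
have /basesP[I _] := ch_free Mm chX bX (subsetP (ch_ground chY) c cY) nX.
have /and3P[CE /negP nC _] := cC; case: nC; apply: (indepS Mm _ I); rewrite eb.
apply/subsetP => z zC; have := subsetP CE z zC; rewrite -eXY in_setU => /orP[zX|zY].
  have : z \in X :\ b by rewrite in_setD1 zX andbT; apply: contraNneq bC => <-.
  by rewrite eb !inE => ->; rewrite orbT.
have : z \in Y :\ d by rewrite in_setD1 zY andbT; apply: contraNneq dC => <-.
by rewrite ed !inE => ->.
Qed.

Lemma inD_excluded (T : finType) (N : mat T) : is_matroid N -> inD N -> excluded_minor_Z N.
Proof.
move=> Nm [M [X [Y [[Mm Mc] Mb [chX chY] [dXY eXY] eN]]]].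
have [cX cY] := (ch_card Mm chX, ch_card Mm chY).
have r3 := ch_rank_gt2 Mm Mc chX chY dXY eXY.
have gN : ground N = ground M by rewrite eN.
pose F := bases M :|: [set X; Y]; pose r := rk M (ground M).
have famP B : B \in F -> #|B| = r.
  by rewrite in_setU in_set2 => /orP[/basesP[]//|/orP[]/eqP->].
have indN (Z : {set T}) : Z \in indep N <-> exists2 B, B \in F & Z \subset B.
  by rewrite eN in_set; split=> /exists_inP.
have [B0 bB0] := base_ex Mm.
have rN : rk N (ground N) = r.
  apply/eqP; rewrite eqn_leq; apply/andP; split.
    have [Z [/indN[B /famP <- ZB] _ <-]] := rk_ex Nm (ground N); exact: subset_leq_card.
  have [B0I cB0] := (basesP M B0).1 bB0; rewrite /r -cB0; apply: rk_ub; last by rewrite gN (indep_ground Mm).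
  by apply/indN; exists B0; rewrite // in_setU bB0.
have bN : bases N = F.
  apply/setP => B; apply/idP/idP => [/basesP[/indN[B' B'F sB] cB]|BF].
    by have /eqP -> : B == B' by rewrite eqEcard sB cB rN (famP B' B'F) leqnn.
  by apply/basesP; rewrite rN (famP B BF); split=> //; apply/indN; exists B.
have free (H : {set T}) : circuit_hyperplane M H -> H \in F -> freebase (ground N) (bases N) H.
  move=> chH HF; rewrite bN gN; split=> // x y xH yE yH.
  by rewrite in_setU (ch_free Mm chH).
have XF : X \in F by rewrite !inE eqxx orbT.
have YF : Y \in F by rewrite !inE eqxx !orbT.
apply: (two_free_excluded Nm (free X chX XF) (free Y chY YF) dXY); rewrite ?gN ?cX ?cY //.
move=> C D w; have [dCD sE cQ pair] := w;
(* A witness of N that is not one of M uses X or Y as one of its six bases. Then C lies in that set,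
   and D, which is disjoint from it, in the other one. *)
have halves (H K : {set T}) x y : [disjoint H & K] -> H :|: K = ground M ->
    x \in ground M :\: (C :|: D) -> y \in ground M :\: (C :|: D) ->
    C :|: [set x; y] = H -> C \subset H /\ D \subset K.
  move=> dHK eHK xQ yQ eH; split; first by rewrite -eH subsetUl.
  clear - sE dCD eHK eH xQ yQ dHK; apply/subsetP => z zD.
  have := subsetP sE z; rewrite -eHK in_setU zD orbT in_setU => /(_ isT)/orP[|//].
  rewrite -eH in_setU => /orP[zC|]; first by have := disjz dCD z; rewrite zC zD.
  by rewrite !inE => /orP[]/eqP ez; [move: xQ | move: yQ]; rewrite -ez !inE zD orbT.
have [/existsP[x /existsP[y /and3P[xQ yQ xy]]]|no] := boolP [exists x, [exists y,
    [&& x \in ground M :\: (C :|: D), y \in ground M :\: (C :|: D) & C :|: [set x; y] \in [set X; Y]]]].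
  move: xy; rewrite in_set2 => /orP[]/eqP e; [left|right].
    exact: (halves X Y x y).
  by apply: (halves Y X x y); rewrite // 1?disjoint_sym // setUC.
have w' : wit (ground M) (bases M) C D.
  split=> // x y xQ yQ xy; have := pair x y xQ yQ xy; rewrite bN in_setU => /orP[//|h].
  by case/negP: no; apply/existsP; exists x; apply/existsP; exists y; rewrite xQ yQ h.
by have := binary_no_u24 Mm Mb C (ground M :\: (C :|: D)); rewrite (wit_u24 Mm w').
Qed.

Theorem theorem1p1 (T : finType) (M : mat T) :
  is_matroid M ->
  (excluded_minor_Z M <->
     [\/ iso M Q6, iso M P6, iso M (U 3 6) | iso M R6] \/
     [\/ iso M (dsum (U 2 4) (U 1 1)), iso M (dsum (U 2 4) (U 0 1)) | inD M]).
Proof.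
move=> Mm; split=> [|[|]]; [exact: excluded_minor_list | exact: six_list_excluded |].
by case=> [/u24_plus_of_iso|/u24_plus_of_iso|/(inD_excluded Mm)] // [Q [e [cQ eQ]]]; apply: u24_plus_excluded.
Qed.
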